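(* Let $h:[0,1]\to(0,\infty)$ and $\tau:[0,1]\to[0,\infty)$ be positive continuous functions, and assume that $h$ satisfies the tempered distortion property. For $r\in\mathbb{N}$ define $$\mathcal{R}_r(\tau):=\Big\{x\in[0,1):\ a_{n+1}(x)a_{n+2}(x)\cdots a_{n+r}(x)\ \ge\ e^{\tau(x)S_nh(x)}\ \text{ for infinitely many } n\in\mathbb{N}\Big\}.$$ Then $$\dim_{\mathrm{H}}\mathcal{R}_r(\tau)=s^{(r)}_{\mathbb{N}}:=\inf\Big\{s\ge 0:\ \mathsf{P}\big(T,\,-g_r(s)\,\tau_{\min}\,h-s\log|T'|\big)\le 0\Big\},$$ where $\tau_{\min}=\min\{\tau(x):x\in[0,1]\}$ and $g_r(s)$ is given recursively by $g_1(s)=s$ and $g_r(s)=\dfrac{s\,g_{r-1}(s)}{1-s+g_{r-1}(s)}$ for $r\ge 2$.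
   Context: $T:[0,1)\to[0,1)$ is the Gauss map, $T(0)=0$ and $T(x)=\frac1x-\lfloor\frac1x\rfloor$ for $0<x<1$. Every $x\in[0,1)$ has continued fraction expansion $x=[a_1(x),a_2(x),\dots]$ with partial quotients $a_1(x)=\lfloor 1/x\rfloor$, $a_n(x)=\lfloor 1/T^{n-1}(x)\rfloor$ for $n\ge2$; we also write $[a_1,\dots,a_n+y]$ for the number with continued fraction $1/(a_1+1/(\cdots+1/(a_n+y)))$. For a function $\psi$, $S_n\psi(x)=\psi(x)+\psi(Tx)+\cdots+\psi(T^{n-1}x)$ is the ergodic sum. For $(a_1,\dots,a_n)\in\mathbb{N}^n$ the basic cylinder of order $n$ is $I_n(a_1,\dots,a_n)=\{x\in[0,1):a_1(x)=a_1,\dots,a_n(x)=a_n\}$, and $I_n(x)$ denotes the cylinder of order $n$ containing $x$. The $n$th variation of $\psi$ is $\mathrm{Var}_n(\psi)=\sup\{|\psi(x)-\psi(z)|: I_n(x)=I_n(z)\}$; $\psi$ satisfies the tempered distortion property if $\mathrm{Var}_1(\psi)<\infty$ and $\lim_{n\to\infty}\mathrm{Var}_n(\psi)=0$. The pressure of a potential $\psi:[0,1)\to\mathbb{R}$ with respect to $T$ is $$\mathsf{P}(T,\psi)=\lim_{n\to\infty}\frac1n\log\sum_{a_1,\dots,a_n\in\mathbb{N}}\ \sup_{x\in[0,1)} e^{S_n\psi([a_1,\dots,a_n+x])}.$$ $\dim_{\mathrm H}$ denotes Hausdorff dimension. *)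

(* Defs.v *)
From HB Require Import structures.
From mathcomp Require Import all_boot all_order all_algebra.
From mathcomp Require Import all_classical all_reals all_analysis.

Set Implicit Arguments.
Unset Strict Implicit.
Unset Printing Implicit Defensive.

Import Order.TTheory GRing.Theory Num.Theory.
Import numFieldNormedType.Exports.

Local Open Scope classical_set_scope.
Local Open Scope ring_scope.

Section ContinuedFractions.
Context {R : realType}.
Implicit Types (x : R) (psi : R -> R) (n : nat).

(* Defined on all of R; only the points of [0, 1] matter. *)
Definition gauss x : R := if x == 0 then 0 else x^-1 - (Num.floor x^-1)%:~R.

(* T is discontinuous at the points 1/k, where T' is understood along the
   cylinder I_1(k), which lies to the left of 1/k: hence a left derivative.
   It agrees with the derivative wherever T is differentiable
   (gauss_deriv_derive1), and it is - x^-2 for x > 0 (gauss_derivE). The value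
   at 0 is immaterial: the pressure meets it only in the last term of the
   ergodic sum at [a_1, ..., a_(n-1), 1 + 0], a bounded contribution. *)
Definition gauss_deriv x : R :=
  lim (e^-1 *: (gauss (e + x) - gauss x) @[e --> 0^'-]).

(* a_n(x), for n >= 1. Since 0^-1 = 0, we have a_n(x) = 0 when T^(n-1) x = 0,
   i.e., once the (finite) expansion of a rational number is exhausted. *)
Definition pquot n x : nat := Num.truncn (iter n.-1 gauss x)^-1.

(* [a_1, ..., a_n + y] *)
Definition cfrac (a : seq nat) (y : R) : R :=
  foldr (fun k z => (k%:R + z)^-1) y a.

Definition ergsum n psi x : R := \sum_(k < n) psi (iter k gauss x).

Definition cylinder n (a : n.-tuple nat) : set R :=
  [set x | (0 <= x < 1) /\ forall i : 'I_n, pquot i.+1 x = tnth a i].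

(* I_n(x) *)
Definition cylinder_of n x : set R :=
  cylinder [tuple pquot i.+1 x | i < n].

Definition cyl_variation n psi : \bar R :=
  ereal_sup [set v | exists x z,
    [/\ 0 <= x < 1, 0 <= z < 1, cylinder_of n x = cylinder_of n z
      & v = `|psi x - psi z|%:E]].

Definition tempered_distortion psi : Prop :=
  (cyl_variation 1 psi < +oo)%E /\ cyl_variation n psi @[n --> \oo] --> 0%E.

Definition partition_sum n psi : \bar R :=
  \esum_(a in [set a : n.-tuple nat | forall i, (0 < tnth a i)%N])
    ereal_sup [set (expR (ergsum n psi (cfrac a x)))%:E | x in `[0, 1[].

Definition pressure psi : \bar R :=
  limn (fun n => (n%:R^-1)%:E * lne (partition_sum n psi))%E.

(* g_r(s), for r >= 1. *)
Fixpoint g_fun (r : nat) (s : R) : R :=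
  match r with
  | 0 => 0
  | 1 => s
  | r'.+1 => s * g_fun r' s / (1 - s + g_fun r' s)
  end.

Definition min01 (f : R -> R) : R := inf [set f x | x in `[0, 1]].

Definition potential (r : nat) (tau h : R -> R) (s x : R) : R :=
  - g_fun r s * min01 tau * h x - s * ln `|gauss_deriv x|.

Definition dim_number (r : nat) (tau h : R -> R) : \bar R :=
  ereal_inf [set s%:E | s in
    [set s : R | 0 <= s /\ (pressure (potential r tau h s) <= 0)%E]].

Definition limsup_set (r : nat) (tau h : R -> R) : set R :=
  [set x | (0 <= x < 1) /\
    forall N, exists2 n, (N <= n)%N &
      expR (tau x * ergsum n h x) <= (\prod_(1 <= i < r.+1) pquot (n + i) x)%N%:R].

End ContinuedFractions.

Section HausdorffDimension.
Context {R : realType}.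
Implicit Types (A U : set R) (s delta : R).

(* -oo for the empty set. *)
Definition diam U : \bar R :=
  ereal_sup [set v | exists x y, [/\ U x, U y & v = `|x - y|%:E]].

(* Empty sets of the cover contribute 0, also for s = 0; a nonempty set of
   diameter 0 contributes 0 `^ s, which is 1 for s = 0. *)
Definition hausdorff_premeasure s delta A : \bar R :=
  ereal_inf [set (\sum_(0 <= i <oo | U i != set0) poweR (diam (U i)) s)%E |
    U in [set U : nat -> set R |
      A `<=` \bigcup_i U i /\ forall i, (diam (U i) <= delta%:E)%E]].

Definition hausdorff_measure s A : \bar R :=
  ereal_sup [set hausdorff_premeasure s delta A | delta in [set d | 0 < d]].

Definition hausdorff_dim A : \bar R :=
  ereal_inf [set s%:E | s in [set s | 0 <= s /\ hausdorff_measure s A = 0%E]].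

End HausdorffDimension.

Section SanityChecks.
Context {R : realType}.

Lemma min01P (f : R -> R) : {within `[0, 1], continuous f} ->
  (exists2 x, x \in `[0, 1] & f x = min01 f) /\
  forall x, x \in `[0, 1] -> min01 f <= f x.
Proof.
move=> /(EVT_min (@ler01 R))[c c01 fc].
have E : min01 f = f c.
  have lbc : lbound [set f x | x in `[0, 1]] (f c).
    by move=> _ [x /= x01 <-]; exact: fc.
  apply/le_anti/andP; split.
    by apply: ge_inf; [exists (f c) | exists c].
  by apply: lb_le_inf => //; exists (f c), c.
by rewrite E; split=> //; exists c.
Qed.

Lemma gauss_derivE (x : R) : 0 < x -> gauss_deriv x = - x ^- 2.
Proof.
move=> x0; apply: cvg_lim => //.
have xV0 : 0 < x^-1 by rewrite invr_gt0.
set m : R := (Num.floor x^-1)%:~R.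
have m0 : 0 <= m by rewrite ler0z floor_ge0 ltW.
have xm : x^-1 < m + 1 by rewrite -[m + 1](intrD _ _ 1) floorD1_gt.
have m1 : 0 < m + 1 by rewrite ltr_wpDl.
have mx : (m + 1)^-1 < x by rewrite invf_plt// posrE.
have mV0 : 0 < (m + 1)^-1 by rewrite invr_gt0.
have H : \forall e \near 0^'-,
    - (x^-1 * (e + x)^-1) = e^-1 *: (gauss (e + x) - gauss x).
  near=> e.
  have e0 : e < 0 by near: e; exact: nbhs_left_lt.
  have em : (m + 1)^-1 < e + x.
    by rewrite -ltrBlDr; near: e; apply: nbhs_left_gt; rewrite subr_lt0.
  have y0 : 0 < e + x by exact: lt_trans em.
  have Ey : Num.floor (e + x)^-1 = Num.floor x^-1.
    apply: floor_def; apply/andP; split.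
      by rewrite (le_trans (floor_le _))// lef_pV2 ?posrE// gerDr ltW.
    by rewrite intrD -/m invf_plt ?posrE.
  rewrite /gauss !gt_eqF// Ey opprB addrA subrK /GRing.scale /=.
  have -> : (e + x)^-1 - x^-1 = - (x^-1 * (e + x)^-1) * e.
    rewrite -[X in _ * X](addrK x e) mulNr mulrBr mulfVK ?gt_eqF//.
    by rewrite mulrAC mulVf ?gt_eqF// mul1r opprB.
  by rewrite [X in _ = _ * X]mulrC mulKf ?lt_eqF.
apply: (cvg_trans (near_eq_cvg H)).
rewrite expr2 invfM; apply: cvgN; apply: cvgM; first exact: cvg_cst.
apply: cvgV; first by rewrite gt_eqF.
rewrite -[X in _ --> X](add0r x); apply: cvgD; last exact: cvg_cst.
by apply: cvg_at_left_filter; exact: cvg_id.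
Unshelve. all: by end_near. Qed.

Lemma gauss_deriv_derive1 (x : R) :
  derivable gauss x 1 -> gauss_deriv x = derive1 gauss x.
Proof.
rewrite /derivable.
under eq_fun do rewrite [_ *: 1]mulr1.
by move=> dT; rewrite /derive1 cvg_at_leftE.
Qed.

End SanityChecks.

(* Main.v *)
(** The derivative of T^n is comparable on a cylinder to the inverse square of
    the continuant, so P(T, -c h - s log|T'|) is the exponential growth rate of
    the sums over words w of exp (-c inf S_n h) |I(w)|^s, which are
    submultiplicative; it is infinite as soon as the sum over single digits
    diverges.

    Upper bound. Past a cylinder of order n, the set of points whose next r
    digits have product at least B can be covered at the cost |I|^s B^(-g_r(s)):
    cover the points with a large next digit d by one interval, and for each
    small d repeat with r - 1 digits and the bound B / d. The recursion
    defining g_r says that the threshold between the two balances the costs. As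
    tau >= tau_min, the natural cover has a convergent sum for every s beyond
    the critical exponent.

    Lower bound. For s below the critical exponent, a finite set of blocks
    ending in the digit 2 has total weight at least 8. Within a cylinder on
    which tau is close to tau_min, concatenate long sequences of blocks with
    sparse runs of r digits, of orders exp (tau S_n h beta q^i) for
    0 <= i < r, where q = (1 - s) / s and beta = g_r(s) / s. The product of a
    run is large enough because beta (1 + ... + q^(r-1)) = 1. Choose the blocks
    according to their weights and the large digits uniformly. If a cylinder
    about to receive a digit of order x has mass at most x^(-s) |I|^s, then
    after that digit the mass is at most x^(s-1) |I|^s = (x^q)^(-s) |I|^s up to
    a constant, as needed for the next one, of order x^q; so the measure has
    Hoelder exponent s. *)

Require Import Defs.
From HB Require Import structures.
From mathcomp Require Import all_boot all_order all_algebra.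
From mathcomp Require Import all_classical all_reals all_analysis.
From mathcomp Require Import lra ring zify.
Import Order.TTheory GRing.Theory Num.Theory.
Import numFieldNormedType.Exports.
Local Open Scope classical_set_scope.
Local Open Scope ring_scope.
Set Implicit Arguments.
Unset Strict Implicit.
Unset Printing Implicit Defensive.

Arguments cfrac : simpl never.

(** * Words and continuants *)

(** Everything is stated with finite sums over the alphabets 1..M: if the pressure is positive, even
    infinite, some finite alphabet already gives exponential growth, so the digits in the blocks are
    bounded. Cylinders of the same order share end points, so a tiny set can meet two of them. A
    node of the Cantor tree is therefore the shrunken cylinder of all [w + y] with y <= 1 - 1/(M+2).
    The digit 2 ending each block keeps the tails in that range, where a final digit 1 would let
    them approach 1. The constants are paid for by sparsity. Concatenation loses a factor 4 in the
    lengths, so that total weight 8 leaves a gain of 2 per block. The number of blocks before a run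
    is chosen so large that this gain covers the factors 64 lost at the large digits and the weight
    exp(-g t S_n h) of the word read so far. No limit measure is constructed. The total mass of the
    nodes of generation n that meet a set decreases with n, and compactness of the Cantor set
    replaces countable covers by finite ones. *)

Definition posw (w : seq nat) : bool := all (fun k => 0 < k)%N w.

Lemma posw_cat (u v : seq nat) : posw (u ++ v) = posw u && posw v.
Proof. exact: all_cat. Qed.

Lemma posw_rcons (u : seq nat) k : posw (rcons u k) = (0 < k)%N && posw u.
Proof. exact: all_rcons. Qed.

Fixpoint words (M n : nat) : seq (seq nat) :=
  if n is n'.+1 then [seq rcons w d | w <- words M n', d <- iota 1 M]
  else [:: [::]].

Lemma mem_words M n (w : seq nat) :
  (w \in words M n) = (size w == n) && all (fun d => 0 < d <= M)%N w.
Proof.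
elim: n w => [|n IH] w; first by rewrite /= inE; case: w.
apply/allpairsP/idP => [[[u d] /= [+ + ->]]|].
  rewrite IH => /andP[/eqP<- au]; rewrite mem_iota => d1.
  by rewrite size_rcons eqxx all_rcons au andbT /=; lia.
case/lastP: w => [//|u d]; rewrite size_rcons eqSS all_rcons => /and3P[su d1 au].
exists (u, d); split => //=; first by rewrite IH su.
by rewrite mem_iota; lia.
Qed.

Lemma words_posw M n w : w \in words M n -> posw w.
Proof.
rewrite mem_words => /andP[_ /allP aw]; apply/allP => d /aw; by case/andP.
Qed.

Lemma words_size M n w : w \in words M n -> size w = n.
Proof. by rewrite mem_words => /andP[/eqP]. Qed.

Lemma words_uniq M n : uniq (words M n).
Proof.
elim: n => [//|n IH] /=; apply: allpairs_uniq => //; first exact: iota_uniq.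
by move=> [u d] [u' d'] _ _ /= /eqP; rewrite eqseq_rcons => /andP[/eqP-> /eqP->].
Qed.

Lemma words_subset M M' n : (M <= M')%N -> {subset words M n <= words M' n}.
Proof.
move=> MM' w; rewrite !mem_words => /andP[-> /allP aw] /=.
by apply/allP => d /aw /andP[-> /= /leq_trans]; apply.
Qed.

Lemma words_exhaust (L : seq (seq nat)) :
  exists M, forall w, w \in L -> posw w -> w \in words M (size w).
Proof.
exists (\max_(w <- L) \max_(d <- w) d)%N => w wL /allP pw.
rewrite mem_words eqxx /=; apply/allP => d dw; have /= -> := pw d dw.
by apply: leq_trans (leq_bigmax_seq _ wL isT); exact: (leq_bigmax_seq _ dw isT).
Qed.

Section Continuants.
Context {R : realType}.
Implicit Types (w u v : seq nat) (y z : R) (h : R -> R).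

(** The square of [cfprod w y] is the absolute value of the derivative at [y] of the inverse branch
    taking y to [w + y]; the inverse of [cfprod w 0] is the continuant of [w]. *)
Fixpoint cfprod w y : R :=
  if w is _ :: w' then cfrac w y * cfprod w' y else 1.

(** The ergodic sum read off the tails of the word instead of the orbit, so that both end points
    [y = 0] and [y = 1] can be treated like all others. *)
Fixpoint cfsum h w y : R :=
  if w is _ :: w' then h (cfrac w y) + cfsum h w' y else 0.

Lemma cfrac_cons k w y : cfrac (k :: w) y = (k%:R + cfrac w y)^-1.
Proof. by []. Qed.

Lemma cfrac_cat u v y : cfrac (u ++ v) y = cfrac u (cfrac v y).
Proof. by rewrite /cfrac foldr_cat. Qed.

Lemma cfprod_cat u v y : cfprod (u ++ v) y = cfprod u (cfrac v y) * cfprod v y.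
Proof.
elim: u => [|k u IH]; first by rewrite /= mul1r.
by rewrite /= IH mulrA -cat_cons cfrac_cat.
Qed.

Lemma cfsum_cat h u v y :
  cfsum h (u ++ v) y = cfsum h u (cfrac v y) + cfsum h v y.
Proof.
elim: u => [|k u IH]; first by rewrite /= add0r.
by rewrite /= IH addrA -cat_cons cfrac_cat.
Qed.

Lemma cfrac_itv w y : posw w -> 0 <= y <= 1 -> 0 <= cfrac w y <= 1.
Proof.
move=> + y01; elim: w => [//|k w IH] /andP[k0 /IH/andP[z0 z1]].
rewrite cfrac_cons.
have k1 : 1 <= k%:R :> R by rewrite ler1n.
have kz : 1 <= k%:R + cfrac w y by rewrite (le_trans k1)// lerDl.
by rewrite invr_ge0 (le_trans ler01 kz) invf_le1// (lt_le_trans ltr01 kz).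
Qed.

Lemma cfrac_gt0 k w y : posw (k :: w) -> 0 <= y <= 1 -> 0 < cfrac (k :: w) y.
Proof.
move=> /andP[k0 pw] y01; have /andP[z0 z1] := cfrac_itv pw y01.
by rewrite cfrac_cons invr_gt0 ltr_wpDr// ltr0n.
Qed.

Lemma cfrac_pos w y : posw w -> 0 < y <= 1 -> 0 < cfrac w y.
Proof.
case: w => [_ /andP[]//|k w] pw /andP[y0 y1].
by apply: cfrac_gt0 => //; rewrite ltW.
Qed.

Lemma cfrac_lt1 w y : posw w -> 0 < y < 1 -> cfrac w y < 1.
Proof.
case: w => [_ /andP[]//|k w] /andP[k0 pw] /andP[y0 y1].
have z0 : 0 < cfrac w y by apply: cfrac_pos => //; rewrite y0 ltW.
have k1 : 1 <= k%:R :> R by rewrite ler1n.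
by rewrite cfrac_cons invf_lt1; lra.
Qed.

Lemma cfprod_gt0 w y : posw w -> 0 <= y <= 1 -> 0 < cfprod w y.
Proof.
move=> + y01; elim: w => [//|k w IH] pw.
apply: mulr_gt0; first exact: cfrac_gt0.
by apply: IH; case/andP: pw.
Qed.

Lemma cfprod_le1 w y : posw w -> 0 <= y <= 1 -> cfprod w y <= 1.
Proof.
move=> + y01; elim: w => [//|k w IH] pw.
have /andP[pk pw'] := pw; apply: mulr_ile1; last exact: IH.
- by rewrite ltW// cfrac_gt0.
- by rewrite ltW// cfprod_gt0.
- by have /andP[] := cfrac_itv pw y01.
Qed.

(** For a Moebius map the mean value theorem is exact: the slope between two points is the geometric
    mean of the derivatives there. *)
Lemma cfrac_dist w y z : posw w -> 0 <= y <= 1 -> 0 <= z <= 1 ->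
  `|cfrac w y - cfrac w z| = `|y - z| * (cfprod w y * cfprod w z).
Proof.
move=> + y01 z01; elim: w => [|k w IH] pw; first by rewrite /= !mulr1.
have /andP[pk pw'] := pw.
have Y := cfrac_gt0 pw y01; have Z := cfrac_gt0 pw z01.
rewrite /=.
set a := cfrac w y; set b := cfrac w z.
rewrite !cfrac_cons in Y Z.
have -> : (k%:R + a)^-1 - (k%:R + b)^-1
    = (b - a) * ((k%:R + a)^-1 * (k%:R + b)^-1).
  rewrite !invr_gt0 in Y Z; rewrite -/a -/b in Y Z.
  by field; rewrite !gt_eqF.
rewrite normrM [X in _ * X]gtr0_norm ?mulr_gt0// distrC IH// !cfrac_cons; ring.
Qed.

(** Here q and q' are the last two continuants; appending a digit k turns (q, q') into (k q + q',
    q). As q' <= q, the derivative varies by a bounded factor on each cylinder. *)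
Lemma cfprod_invE w : posw w -> exists q q' : R,
  [/\ 0 <= q', q' <= q & forall y, 0 <= y <= 1 -> (cfprod w y)^-1 = q + y * q'].
Proof.
elim/last_ind: w => [_|w k IH].
  by exists 1, 0; split => // y _; rewrite invr1 mulr0 addr0.
rewrite /posw all_rcons => /andP[k0 /IH[q [q' [q'0 qq' E]]]].
have k1 : 1 <= k%:R :> R by rewrite ler1n.
exists (q * k%:R + q'), q; split => [||y y01]; [lra|nra|].
have pk : posw [:: k] by rewrite /posw /= k0.
rewrite -cats1 cfprod_cat invfM E ?cfrac_itv//= mulr1 invrK.
have /andP[y0 _] := y01; rewrite cfrac_cons /cfrac /=.
by field; rewrite gt_eqF// ltr_pwDl// ltr0n.
Qed.

Lemma cfprod_distortion w y : posw w -> 0 <= y <= 1 ->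
  cfprod w y <= cfprod w 0 <= 2 * cfprod w y.
Proof.
move=> pw y01; have [q [q' [q'0 qq' E]]] := cfprod_invE pw.
have zz : 0 <= (0:R) <= 1 by rewrite lexx ler01.
have Y := cfprod_gt0 pw y01; have Z := cfprod_gt0 pw zz.
have EY := E _ y01; have EZ := E _ zz; rewrite mul0r addr0 in EZ.
rewrite -[cfprod w y]invrK -[cfprod w 0]invrK EY EZ.
have q0 : 0 < q by rewrite -EZ invr_gt0.
have /andP[y0 y1] := y01.
have yq : 0 <= y * q' <= q.
  by rewrite mulr_ge0//= (le_trans _ qq')// ler_piMl.
have D : 0 < q + y * q' by lra.
rewrite lef_pV2 ?posrE//; apply/andP; split; first lra.
by rewrite -ler_pdivrMl// -invfM lef_pV2 ?posrE ?mulr_gt0//; lra.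
Qed.

Let itv00 : 0 <= (0:R) <= 1.
Proof. by rewrite lexx ler01. Qed.

(* Comparable to the length of the cylinder of [w]. *)
Definition clen w : R := cfprod w 0 ^+ 2.

Lemma clen_gt0 w : posw w -> 0 < clen w.
Proof. by move=> pw; rewrite exprn_gt0// cfprod_gt0. Qed.

Lemma clen_le1 w : posw w -> clen w <= 1.
Proof. by move=> pw; rewrite exprn_ile1// ?cfprod_le1// ltW// cfprod_gt0. Qed.

Lemma clen1 k : clen [:: k] = k%:R ^- 2.
Proof. by rewrite /clen /= mulr1 cfrac_cons addr0 exprVn. Qed.

Lemma clen_cat u v : posw u -> posw v ->
  4^-1 * clen u * clen v <= clen (u ++ v) <= clen u * clen v.
Proof.
move=> pu pv; rewrite /clen cfprod_cat /= !exprMn.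
have v01 := cfrac_itv pv itv00.
have /andP[lo hi] := cfprod_distortion pu v01.
have U := cfprod_gt0 pu v01; have V := cfprod_gt0 pv itv00.
have V2 : 0 <= cfprod v 0 ^+ 2 by rewrite exprn_ge0// ltW.
by apply/andP; split; apply: ler_wpM2r => //; nra.
Qed.

(** Two consecutive tails z and 1/(k + z) have product at most 1/2, so every pair of digits divides
    the squared product by at least 4. *)
Lemma clen_rate w : posw w -> clen w <= 2 * 2^-1 ^+ size w.
Proof.
have [n] := ubnP (size w); elim: n w => // n IH [|k [|l w]] sw pw.
- by rewrite /clen /= expr1n expr0; lra.
- by rewrite /= expr1 divff ?clen_le1.
have /andP[k0 /andP[l0 pw']] := pw.
have {}IH : clen w <= 2 * 2^-1 ^+ size w by apply: IH => //; rewrite /= in sw; lia.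
have pl : posw (l :: w) by rewrite /posw /= l0.
have P := cfprod_gt0 pw' itv00.
have Z := cfrac_gt0 pl itv00.
have k1 : 1 <= k%:R :> R by rewrite ler1n.
have /andP[_ Z1] := cfrac_itv pl itv00.
rewrite /clen /= mulrA exprMn [X in X * _ <= _](_ : _ = (cfrac (l :: w) 0 / (k%:R + cfrac (l :: w) 0)) ^+ 2); last first.
  by rewrite cfrac_cons mulrC.
have zz : (0 : R) <= cfrac (l :: w) 0 / (k%:R + cfrac (l :: w) 0) <= (2^-1 : R).
  have kz : (0 : R) < k%:R + cfrac (l :: w) 0 by lra.
  by rewrite divr_ge0 ?(ltW Z) ?(ltW kz)//= ler_pdivrMr//; lra.
have -> : 2 * 2^-1 ^+ (size w).+2 = 4^-1 * (2 * 2^-1 ^+ size w) :> R.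
  by rewrite !exprS; field.
apply: ler_pM => //; rewrite ?sqr_ge0//.
have /andP[t0 t1] := zz; rewrite expr2.
by apply: (le_trans (ler_pM t0 t0 t1 t1)); lra.
Qed.

Lemma cylinder_dist w y z : posw w -> 0 <= y <= 1 -> 0 <= z <= 1 ->
  4^-1 * clen w * `|y - z| <= `|cfrac w y - cfrac w z| <= clen w * `|y - z|.
Proof.
move=> pw y01 z01; rewrite cfrac_dist// /clen.
have /andP[y1 y2] := cfprod_distortion pw y01.
have /andP[z1 z2] := cfprod_distortion pw z01.
have Y := cfprod_gt0 pw y01; have Z := cfprod_gt0 pw z01.
by rewrite ![`|_| * _]mulrC; apply/andP; split; apply: ler_wpM2r => //; nra.
Qed.

Lemma sum_words_cat M n m (F : seq nat -> R) :
  \sum_(w <- words M (n + m)) F w =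
  \sum_(u <- words M n) \sum_(v <- words M m) F (u ++ v).
Proof.
elim: m F => [|m IH] F.
  by rewrite addn0; apply: eq_bigr => u _; rewrite /= big_seq1 cats0.
rewrite addnS /= big_allpairs_dep /= IH; apply: eq_bigr => u _.
rewrite big_allpairs_dep; apply: eq_bigr => v _; apply: eq_bigr => d _.
by rewrite -rcons_cat.
Qed.

(* The level sets of the first digit tile the unit interval, so that the
   lengths of the cylinders of a given order add up to at most 1. *)
Lemma sum_clen_le M n : \sum_(w <- words M n) clen w <= 2.
Proof.
(* The exact length of the cylinder, by [cfrac_dist] at the end points 0 and 1. *)
pose len w := cfprod w 0 * cfprod w 1.
have itv11 : 0 <= (1:R) <= 1 by rewrite ler01 lexx.
have step w : posw w -> \sum_(d <- iota 1 M) len (rcons w d) <= len w.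
  move=> pw.
  have [q [q' [q'0 qq' E]]] := cfprod_invE pw.
  have q0 : 0 < q by have := E _ itv00; rewrite mul0r addr0 => <-; rewrite invr_gt0 cfprod_gt0.
  have lenE d : (0 < d)%N -> len (rcons w d) =
      (q * d%:R + q')^-1 * (q * (d.+1)%:R + q')^-1.
    move=> d0; have pd : posw [:: d] by rewrite /posw /= d0.
    have d0' : 0 < d%:R :> R by rewrite ltr0n.
    rewrite /len -cats1 !cfprod_cat -[cfprod w _]invrK E ?cfrac_itv//.
    rewrite -[cfprod w (cfrac [:: d] 1)]invrK E ?cfrac_itv//= !cfrac_cons /=.
    rewrite /cfrac /= -(natr1 d); field.
    by apply/and4P; split; rewrite gt_eqF//; nra.
  (* The cylinders of consecutive last digits are adjacent, hence a telescoping sum. *)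
  have tele m : \sum_(d <- iota 1 m) len (rcons w d) =
      q^-1 * ((q + q')^-1 - (q * (m.+1)%:R + q')^-1).
    elim: m => [|m IH]; first by rewrite big_nil mulr1 subrr mulr0.
    rewrite -[in LHS](addn1 m) iotaD big_cat /= IH big_seq1 add1n lenE//.
    have m0 : 0 <= m%:R :> R by [].
    rewrite -!natr1; field.
    by rewrite !gt_eqF//=; nra.
  rewrite tele.
  have -> : len w = q^-1 * (q + q')^-1.
    rewrite /len -[cfprod w 0]invrK -[cfprod w 1]invrK !E//.
    by rewrite mul0r addr0 mul1r.
  apply: ler_wpM2l; first by rewrite invr_ge0 ltW.
  by rewrite gerBl invr_ge0 addr_ge0// mulr_ge0// ltW.
have lenW w : posw w -> clen w <= 2 * len w.
  move=> pw; have /andP[_ h1] := cfprod_distortion pw itv11.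
  have := cfprod_gt0 pw itv00; rewrite /clen /len; nra.
suff : \sum_(w <- words M n) len w <= 1.
  move=> le1; apply: (@le_trans _ _ (\sum_(w <- words M n) 2 * len w)).
    by rewrite big_seq [leRHS]big_seq; apply: ler_sum => w /words_posw/lenW.
  by rewrite -mulr_sumr; lra.
elim: n => [|n IH]; first by rewrite /= big_seq1 /len /= mulr1.
rewrite /= big_allpairs_dep; apply: le_trans IH.
by rewrite big_seq [leRHS]big_seq; apply: ler_sum => w /words_posw/step.
Qed.

End Continuants.

(** * Orbits of the Gauss map *)

Section GaussOrbits.
Context {R : realType}.
Implicit Types (w u v : seq nat) (x y z : R) (h : R -> R) (n k : nat).

Lemma gauss_itv x : 0 <= gauss x < 1.
Proof.
rewrite /gauss; case: eqP => _; first by rewrite lexx ltr01.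
by rewrite subr_ge0 floor_le/= ltrBlDr addrC -[X in _ + X]/(1%:~R) -intrD floorD1_gt.
Qed.

Lemma iter_gauss_itv n x : 0 <= x < 1 -> 0 <= iter n gauss x < 1.
Proof. by case: n => // n _; exact: gauss_itv. Qed.

Lemma gauss0 : gauss (0 : R) = 0.
Proof. by rewrite /gauss eqxx. Qed.

Lemma iter_gauss0 n : iter n gauss (0 : R) = 0.
Proof. by elim: n => //= n ->; exact: gauss0. Qed.

Lemma gauss_invD k z : (0 < k)%N -> 0 <= z < 1 -> gauss (k%:R + z)^-1 = z.
Proof.
move=> k0 /andP[z0 z1]; have kz : 0 < k%:R + z by rewrite ltr_pwDl// ltr0n.
rewrite /gauss invr_eq0 gt_eqF// invrK (@floor_def _ _ k%:Z).
  by rewrite pmulrn addrAC subrr add0r.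
by rewrite intrD -!pmulrn lerDl z0 ltrD2l.
Qed.

Lemma pquot_invD k z : (0 < k)%N -> 0 <= z < 1 -> pquot 1 (k%:R + z)^-1 = k.
Proof.
move=> k0 /andP[z0 z1]; rewrite /pquot /= invrK; apply: truncn_def.
by rewrite lerDl z0 -natr1 ltrD2l.
Qed.

Lemma pquotS k x : (0 < k)%N -> pquot k.+1 x = pquot k (gauss x).
Proof. by case: k => // k _; rewrite /pquot /= -iterS iterSr. Qed.

Lemma pquotD k n x : (0 < k)%N -> pquot (n + k) x = pquot k (iter n gauss x).
Proof. by case: k => // k _; rewrite /pquot addnS /= addnC iterD. Qed.

Lemma cfrac_itvoo w y : posw w -> 0 < y < 1 -> 0 < cfrac w y < 1.
Proof.
move=> pw y01; rewrite cfrac_lt1// andbT cfrac_pos//.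
by have /andP[-> /ltW] := y01.
Qed.

Lemma iter_gauss_cfrac w y : posw w -> 0 < y < 1 ->
  iter (size w) gauss (cfrac w y) = y.
Proof.
move=> + y01; elim: w => // k w IH /andP[k0 pw].
rewrite [size _]/= iterSr cfrac_cons gauss_invD ?IH//.
by have /andP[/ltW-> ->] := cfrac_itvoo pw y01.
Qed.

Lemma ergsumS n h x : ergsum n.+1 h x = h x + ergsum n h (gauss x).
Proof.
rewrite /ergsum big_ord_recl /=; congr (_ + _); apply: eq_bigr => i _.
by rewrite /bump /= -iterS iterSr.
Qed.

Lemma ergsumSr n h x : ergsum n.+1 h x = ergsum n h x + h (iter n gauss x).
Proof. by rewrite /ergsum big_ord_recr. Qed.

Lemma ergsum_cfrac h w y : posw w -> 0 < y < 1 ->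
  ergsum (size w) h (cfrac w y) = cfsum h w y.
Proof.
move=> + y01; elim: w => [_|d w IH /andP[d0 pw]]; first by rewrite /ergsum big_ord0.
have zz : 0 <= cfrac w y < 1 by have /andP[/ltW-> ->] := cfrac_itvoo pw y01.
by rewrite [size _]/= ergsumS [gauss _]gauss_invD// IH.
Qed.

(* Only at [y = 0] with last digit 1 does the orbit of [a_1, ..., a_n + y]
   leave the sequence of the tails: there T^(n-1) is 0 instead of 1. *)
Lemma ergsum_cfrac0 h w : posw w ->
  ergsum (size w) h (cfrac w 0) = cfsum h w 0 \/
  ergsum (size w) h (cfrac w 0) = cfsum h w 0 - h 1 + h 0.
Proof.
case/lastP: w => [_|w d]; first by left; rewrite /ergsum big_ord0.
rewrite posw_rcons => /andP[d0 pw].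
have E0 : cfrac [:: d] 0 = d%:R^-1 :> R by rewrite cfrac_cons addr0.
rewrite -cats1 size_cat /= addn1 cfrac_cat cfsum_cat /= E0 addr0 ergsumSr.
case: d d0 E0 => [//|[|d]] _ E0; last first.
  have d01 : 0 < (d.+2%:R^-1 : R) < 1.
    by rewrite invr_gt0 ltr0n invf_lt1 ?ltr0n// ltr1n.
  by left; rewrite iter_gauss_cfrac// ergsum_cfrac.
rewrite invr1; case/lastP: w pw => [_|w e].
  by left; rewrite /= /ergsum !big_ord0 /cfrac.
rewrite posw_rcons => /andP[e0 pw]; right.
have E1 : cfrac [:: e] 1 = (e%:R + 1)^-1 :> R by rewrite cfrac_cons.
have e01 : 0 < ((e%:R + 1)^-1 : R) < 1.
  by rewrite natr1 invr_gt0 ltr0n invf_lt1 ?ltr0n// ltr1n.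
rewrite -cats1 size_cat /= addn1 cfrac_cat cfsum_cat /= E1 ergsumSr addr0.
rewrite iter_gauss_cfrac// ergsum_cfrac// natr1.
have -> : gauss (e.+1%:R^-1 : R) = 0.
  by have := @gauss_invD e.+1 0 isT; rewrite addr0 lexx ltr01; exact.
ring.
Qed.

Lemma iter_gauss_gt0 x n : 0 <= x < 1 -> 0 < iter n gauss x -> 0 < x.
Proof.
move=> /andP[x0 _] xn; rewrite lt_neqAle x0 andbT eq_sym.
by apply: contraTneq xn => ->; rewrite iter_gauss0 ltxx.
Qed.

Lemma pquot1_inv x : 0 < x < 1 ->
  (0 < pquot 1 x)%N /\ x = ((pquot 1 x)%:R + gauss x)^-1.
Proof.
move=> /andP[x0 x1].
have xV1 : 1 <= x^-1 by rewrite ltW// invf_gt1.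
split; first by rewrite /pquot /= truncn_gt0.
have xV0 : 0 <= x^-1 := le_trans ler01 xV1.
rewrite -[LHS]invrK; congr (_^-1); rewrite /pquot /= /gauss gt_eqF//.
by rewrite truncn_floor xV0 natr_absz ger0_norm ?floor_ge0// addrC subrK.
Qed.

Lemma cfrac_expansion n x : 0 <= x < 1 -> 0 < iter n gauss x ->
  exists w, [/\ posw w, size w = n & x = cfrac w (iter n gauss x)].
Proof.
elim: n x => [|n IH] x x01 xn; first by exists [::].
have x0 := iter_gauss_gt0 x01 xn; rewrite iterSr in xn *.
have [w [pw sw E]] := IH _ (gauss_itv x) xn.
have x01' : 0 < x < 1 by have /andP[_ ->] := x01; rewrite x0.
have [k0 Ex] := pquot1_inv x01'.
exists (pquot 1 x :: w); split; [by rewrite /posw /= k0|by rewrite /= sw|].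
by rewrite cfrac_cons -E.
Qed.

End GaussOrbits.

(** * Distortion and cylinder weights *)

Section Potentials.
Context {R : realType}.

Lemma ler_powR_base (s a b : R) : 0 <= s -> 0 <= a -> a <= b -> a `^ s <= b `^ s.
Proof.
move=> s0 a0 ab; apply: ge0_ler_powR => //; rewrite nnegrE//.
exact: le_trans ab.
Qed.

Lemma ler_sum_uniq (T : eqType) (F : T -> R) (r1 r2 : seq T) :
  uniq r1 -> {subset r1 <= r2} -> (forall x, x \in r2 -> 0 <= F x) ->
  \sum_(x <- r1) F x <= \sum_(x <- r2) F x.
Proof.
elim: r1 r2 => [|x r1 IH] r2; first by rewrite big_nil big_seq => _ _; exact: sumr_ge0.
move=> /= /andP[xr1 u1] sub F0; rewrite big_cons.
have xr2 : x \in r2 by apply: sub; rewrite mem_head.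
rewrite (perm_big _ (perm_to_rem xr2)) big_cons lerD2l; apply: IH => //.
  move=> z zr1; have zx : z != x by apply: contraNneq xr1 => <-.
  have : z \in r2 by apply: sub; rewrite inE zr1 orbT.
  by rewrite (perm_mem (perm_to_rem xr2)) inE (negPf zx).
by move=> z /mem_rem; exact: F0.
Qed.

Lemma half_pow_small (d : R) : 0 < d ->
  exists n0, forall n, (n0 <= n)%N -> 2 * 2^-1 ^+ n < d.
Proof.
move=> d0.
have /cvgrPdist_lt/(_ _ d0) : (2 * 2^-1 ^+ n : R) @[n --> \oo] --> (2 * 0 : R).
  by apply: cvgM; [exact: cvg_cst|apply: cvg_expr; rewrite ger0_norm; lra].
move=> [n0 _ n0P]; exists n0 => n nn0.
by have /= := n0P n nn0; rewrite mulr0 sub0r normrN ger0_norm.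
Qed.

Lemma segment_uniformly_continuous (f : R -> R) :
  {within `[0, 1], continuous f} -> forall e : R, 0 < e ->
  exists2 d : R, 0 < d & forall x y, x \in `[0, 1] -> y \in `[0, 1] ->
    `|x - y| < d -> `|f x - f y| <= e.
Proof.
move=> fc e e0; have e20 : 0 < e / 2 by rewrite divr_gt0.
have K := @segment_compact R 0 1.
pose P (d x : R) := x \in `[0, 1] -> forall y, y \in `[0, 1] ->
    `|x - y| < d -> `|f x - f y| <= e.
have : \forall d \near (0:R)^'+, `[0, 1] `<=` P d.
  apply: (iffLR (compact_near_coveringP _) K) => x Kx.
  have /subspace_continuousP/(_ x Kx)/cvgrPdist_lt/(_ _ e20) := fc.
  rewrite near_withinE => /nbhs_ballP[r /= r0 xr].
  have r20 : 0 < r / 2 by rewrite divr_gt0.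
  near=> x' d => x'01 y y01 x'y.
  have xx' : `|x - x'| < r / 2.
    by near: x'; apply/nbhs_ballP; exists (r / 2).
  have dr : d < r / 2 by near: d; exact: nbhs_right_lt.
  have X : `|f x - f x'| < e / 2.
    by apply: (xr x') => //; rewrite /ball /=; lra.
  have Y : `|f x - f y| < e / 2.
    apply: (xr y) => //; rewrite /ball /=.
    by have := ler_distD x' x y; rewrite /= in x'y; lra.
  have := ler_distD (f x) (f x') (f y); rewrite (distrC (f x') (f x)) /=; lra.
move=> H; have [d [d0 dP]] := filter_ex (filterI (nbhs_right_gt (0:R)) H).
by exists d => // x y x01 y01; apply: (dP x) => //; rewrite inE in x01.
Unshelve. all: by end_near. Qed.

Context (h : R -> R).
Hypothesis h_gt0 : forall x, x \in `[0, 1] -> 0 < h x.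
Hypothesis h_cont : {within `[0, 1], continuous h}.
Implicit Types (w u v : seq nat) (y z c s : R).

Let itv00 : 0 <= (0:R) <= 1.
Proof. by rewrite lexx ler01. Qed.

Let h_ge0 x : 0 <= x <= 1 -> 0 <= h x.
Proof. by move=> x01; rewrite ltW// h_gt0// in_itv. Qed.

Lemma potential_bounded : exists2 M, 0 < M & forall x, 0 <= x <= 1 -> h x <= M.
Proof.
have [c c01 hc] := EVT_max (@ler01 R) h_cont.
by exists (h c) => [|x x01]; [exact: h_gt0|apply: hc; rewrite in_itv].
Qed.

Lemma cfsum_ge0 w y : posw w -> 0 <= y <= 1 -> 0 <= cfsum h w y.
Proof.
move=> + y01; elim: w => //= k w IH pw; have /andP[k0 pw'] := pw.
by rewrite addr_ge0 ?IH// h_ge0// cfrac_itv.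
Qed.

Lemma cfsum_le M w y : (forall x, 0 <= x <= 1 -> h x <= M) ->
  posw w -> 0 <= y <= 1 -> cfsum h w y <= M * (size w)%:R.
Proof.
move=> hM + y01; elim: w => [|k w IH] pw; first by rewrite mulr0.
have /andP[k0 pw'] := pw.
rewrite /= -natr1 mulrDr mulr1 addrC lerD ?IH// hM// cfrac_itv//.
Qed.

(** All but the [n0] shortest tails lie in cylinders so small that [h] varies by at most [e] on
    them; each of the short ones costs at most the bound of [h], which goes into the constant. *)
Lemma cfsum_distortion e : 0 < e -> exists2 C, 0 <= C &
  forall w y z, posw w -> 0 <= y <= 1 -> 0 <= z <= 1 ->
  cfsum h w y <= cfsum h w z + e * (size w)%:R + C.
Proof.
move=> e0; have [d d0 hd] := segment_uniformly_continuous h_cont e0.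
have [M M0 hM] := potential_bounded.
have [n0 n0P] := half_pow_small d0.
exists (M * n0%:R); first by rewrite mulr_ge0// ltW.
move=> w y z pw y01 z01.
suff H : cfsum h w y <= cfsum h w z + e * (size w)%:R + M * (minn (size w) n0)%:R.
  by apply: (le_trans H); rewrite lerD2l ler_wpM2l ?(ltW M0)// ler_nat geq_minr.
elim: w pw => [|k w IH] pw; first by rewrite /= min0n !mulr0 !addr0.
have /andP[k0 pw'] := pw; have {IH} := IH pw'.
have Y := cfrac_itv pw y01; have Z := cfrac_itv pw z01.
rewrite [cfsum h (k :: w) y]/= [cfsum h (k :: w) z]/= [size (k :: w)]/=.
have [lt|ge] := ltnP (size w) n0.
  rewrite (minn_idPl lt) -!natr1.
  by have := hM _ Y; have := h_ge0 Z; nra.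
rewrite (minn_idPr (leq_trans ge (leqnSn _))) -!natr1.
suff : h (cfrac (k :: w) y) - h (cfrac (k :: w) z) <= e by nra.
apply: le_trans (ler_norm _) _; apply: hd; rewrite ?in_itv//.
have /andP[_ D] := cylinder_dist pw y01 z01.
apply: le_lt_trans D _.
have W := @clen_rate R _ pw; have W0 := @clen_gt0 R _ pw.
have yz : `|y - z| <= 1 by rewrite ler_norml; lra.
have D1 : 2 * 2^-1 ^+ (size (k :: w)) < d by apply: n0P; rewrite /= leqW.
have := normr_ge0 (y - z); nra.
Qed.

(** The infimum is superadditive under concatenation; this is what makes [weight] submultiplicative
    without constants. *)
Definition hinf w : R := inf [set cfsum h w y | y in `[0, 1]].

Lemma hinf_le w y : posw w -> 0 <= y <= 1 -> hinf w <= cfsum h w y.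
Proof.
move=> pw y01; apply: ge_inf; last by exists y => //=; rewrite in_itv.
by exists 0 => _ [z /= z01 <-]; apply: cfsum_ge0 => //; rewrite in_itv in z01.
Qed.

Lemma le_hinf w a : (forall y, 0 <= y <= 1 -> a <= cfsum h w y) -> a <= hinf w.
Proof.
move=> H; apply: lb_le_inf.
  by exists (cfsum h w 0), 0 => //=; rewrite in_itv /= lexx ler01.
by move=> _ [z /= z01 <-]; apply: H; rewrite in_itv in z01.
Qed.

Lemma hinf_ge0 w : posw w -> 0 <= hinf w.
Proof. by move=> pw; apply: le_hinf => y y01; exact: cfsum_ge0. Qed.

Lemma hinf_cat u v : posw u -> posw v -> hinf u + hinf v <= hinf (u ++ v).
Proof.
move=> pu pv; apply: le_hinf => y y01; rewrite cfsum_cat lerD//.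
  by rewrite hinf_le// cfrac_itv.
exact: hinf_le.
Qed.

Definition weight c s w : R := expR (- c * hinf w) * clen w `^ s.

Lemma weight_gt0 c s w : posw w -> 0 < weight c s w.
Proof. by move=> pw; rewrite mulr_gt0 ?expR_gt0// powR_gt0// clen_gt0. Qed.

Lemma weight_cat c s u v : 0 <= c -> 0 <= s -> posw u -> posw v ->
  weight c s (u ++ v) <= weight c s u * weight c s v.
Proof.
move=> c0 s0 pu pv; rewrite /weight mulrACA -expRD.
have cu := @clen_gt0 R _ pu; have cv := @clen_gt0 R _ pv.
apply: ler_pM; rewrite ?expR_ge0 ?powR_ge0//.
  by rewrite ler_expR; have := hinf_cat pu pv; nra.
rewrite -powRM ?(ltW cu) ?(ltW cv)//.
have /andP[_ cuv] := @clen_cat R _ _ pu pv.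
apply: (ge0_ler_powR s0 _ _ cuv); rewrite nnegrE; last by rewrite mulr_ge0 ?ltW.
by rewrite ltW// clen_gt0// posw_cat pu.
Qed.

(** These finite sums increase with [M] to the sum over all words of length [n], which may be
    infinite. *)
Definition wsum c s M n : R := \sum_(w <- words M n) weight c s w.

Lemma wsum_ge0 c s M n : 0 <= wsum c s M n.
Proof.
by rewrite /wsum big_seq; apply: sumr_ge0 => w /words_posw/weight_gt0/ltW.
Qed.

Lemma wsum_add c s M n m : 0 <= c -> 0 <= s ->
  wsum c s M (n + m) <= wsum c s M n * wsum c s M m.
Proof.
move=> c0 s0; rewrite /wsum sum_words_cat big_distrl /=.
rewrite big_seq [leRHS]big_seq; apply: ler_sum => u /words_posw pu.
rewrite big_distrr big_seq [leRHS]big_seq; apply: ler_sum => v /words_posw pv.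
exact: weight_cat.
Qed.

Lemma wsum_mono c s M M' n : (M <= M')%N -> wsum c s M n <= wsum c s M' n.
Proof.
move=> MM'; apply: ler_sum_uniq; [exact: words_uniq|exact: words_subset|].
by move=> w /words_posw/weight_gt0/ltW.
Qed.

End Potentials.

(** * Pressure *)

Section Fekete.
Context {R : realType}.

(** Fekete's lemma, with [L] the infimum of the quotients [u n / n]; the linear lower bound keeps it
    finite. *)
Lemma fekete (u : nat -> R) (B : R) :
  (forall n m, u (n + m)%N <= u n + u m) ->
  (forall n, - B * n%:R <= u n) ->
  exists L, forall e, 0 < e -> exists N, forall n, (N <= n)%N ->
    (L - e) * n%:R <= u n <= (L + e) * n%:R.
Proof.
move=> sub lo; pose S := [set u n / n%:R | n in [set n | (0 < n)%N]].
have S0 : S !=set0 by exists (u 1%N / 1), 1%N.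
have lbS : has_lbound S.
  exists (- B) => _ [n /= n0 <-].
  by rewrite ler_pdivlMr ?ltr0n.
exists (inf S) => e e0; set L := inf S.
have [_ [m /= m0 <-] Hm] : exists2 y, S y & y < L + e / 2.
  by apply: inf_lt => //; rewrite ltrDl divr_gt0.
have m0' : 0 < m%:R :> R by rewrite ltr0n.
rewrite ltr_pdivrMr// in Hm.
pose A := \sum_(j < m) `|u j|.
have subk k : u (k * m)%N <= k%:R * u m + `|u 0%N|.
  elim: k => [|k IH]; first by rewrite mul0n mul0r add0r ler_norm.
  by rewrite mulSn -natr1; apply: (le_trans (sub _ _)); lra.
(* [Q] collects what does not grow with [n]: the remainder of the division by [m], and [u 0], which
   may be nonzero. *)
pose Q := m%:R * `|L + e / 2| + A + `|u 0%N|.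
have A0 : 0 <= A by apply: sumr_ge0.
have Q0 : 0 <= Q by rewrite /Q addr_ge0// addr_ge0// mulr_ge0.
exists (Num.truncn (Q / (e / 2))).+1 => n nN.
have n0 : (0 < n)%N by apply: leq_trans nN.
have n0' : 0 < n%:R :> R by rewrite ltr0n.
apply/andP; split.
  have : L <= u n / n%:R by apply: ge_inf => //; exists n.
  by rewrite ler_pdivlMr//; nra.
have Qn : Q <= e / 2 * n%:R.
  rewrite -ler_pdivrMl ?divr_gt0// mulrC; apply/ltW.
  apply: lt_le_trans (truncnS_gt _) _; by rewrite ler_nat.
rewrite {1}(divn_eq n m).
apply: le_trans (sub _ _) _.
have jm : (n %% m < m)%N by rewrite ltn_mod.
have uA : u (n %% m)%N <= A.
  rewrite /A (bigD1 (Ordinal jm))//= (le_trans (ler_norm _))// lerDl.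
  exact: sumr_ge0.
have k1 := subk (n %/ m)%N.
have k0 : 0 <= (n %/ m)%:R :> R by [].
have En : n%:R = (n %/ m)%:R * m%:R + (n %% m)%:R :> R.
  by rewrite -natrM -natrD -divn_eq.
have jm' : 0 <= ((n %% m)%:R : R) <= m%:R by rewrite ler0n ler_nat ltnW.
have k2 : (n %/ m)%:R * u m <= (n %/ m)%:R * (m%:R * (L + e / 2)).
  by rewrite ler_wpM2l// mulrC ltW.
have j2 : - ((n %% m)%:R * (L + e / 2)) <= m%:R * `|L + e / 2|.
  rewrite -mulrN; apply: (@le_trans _ _ ((n %% m)%:R * `|L + e / 2|)).
    by rewrite ler_wpM2l// -normrN ler_norm.
  by rewrite ler_wpM2r// ler_nat ltnW.
rewrite /Q in Qn.
have -> : (L + e) * n%:R =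
    (L + e / 2) * ((n %/ m)%:R * m%:R + (n %% m)%:R) + e / 2 * n%:R.
  by rewrite -En; field.
lra.
Qed.

End Fekete.

(** * Pressure as the growth rate of weight sums *)

Section Pressure.
Context {R : realType} (h : R -> R) (c s : R) (psi : R -> R).
Hypothesis h_gt0 : forall x, x \in `[0, 1] -> 0 < h x.
Hypothesis h_cont : {within `[0, 1], continuous h}.
Hypothesis c_ge0 : 0 <= c.
Hypothesis s_ge0 : 0 <= s.
Hypothesis psiE : forall x, 0 < x -> psi x = - c * h x + s * ln (x ^+ 2).
Implicit Types (w u v : seq nat) (y z : R).

Let itv00 : 0 <= (0:R) <= 1.
Proof. by rewrite lexx ler01. Qed.

Let W := weight h c s.
Let Z := wsum h c s.

Lemma expR_cfsum w y : posw w -> 0 <= y <= 1 ->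
  expR (cfsum psi w y) = expR (- c * cfsum h w y) * (cfprod w y ^+ 2) `^ s.
Proof.
move=> + y01; elim: w => [|k w IH] pw.
  by rewrite /= !mulr0 expR0 expr1n powR1 mulr1.
have /andP[_ pw'] := pw; have x0 := cfrac_gt0 pw y01.
rewrite [cfsum psi _ _]/= expRD IH// psiE// [cfsum h (k :: w) _]/= [cfprod (k :: w) _]/=.
have E : (cfrac (k :: w) y ^+ 2) `^ s = expR (s * ln (cfrac (k :: w) y ^+ 2)).
  by rewrite /powR gt_eqF ?exprn_gt0.
rewrite exprMn (powRM _ (sqr_ge0 _) (sqr_ge0 _)) E.
by rewrite mulrDr !expRD; ring.
Qed.

Lemma expR_cfsum_le w y : posw w -> 0 <= y <= 1 -> expR (cfsum psi w y) <= W w.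
Proof.
move=> pw y01; rewrite expR_cfsum// /W /weight.
have /andP[d _] := cfprod_distortion pw y01.
have P := cfprod_gt0 pw y01.
apply: ler_pM; rewrite ?expR_ge0 ?powR_ge0//.
  by rewrite ler_expR !mulNr lerN2 ler_wpM2l// hinf_le.
apply: ge0_ler_powR; rewrite ?nnegrE ?sqr_ge0//.
by rewrite /clen !expr2 ler_pM// ltW.
Qed.

Lemma partition_sum_term_le : exists2 C, 0 < C & forall a y,
  posw a -> 0 <= y < 1 -> expR (ergsum (size a) psi (cfrac a y)) <= C * W a.
Proof.
(* The exponential corrects the one orbit that reaches 0 where the tail is 1, namely [y = 0] after a
   last digit 1. *)
exists (1 + expR (psi 0 - psi 1)); first by rewrite ltr_pwDl ?expR_ge0.
move=> a y pa /andP[y0 y1].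
have E0 := expR_ge0 (psi 0 - psi 1).
have Wa := weight_gt0 h c s pa.
have y01 : 0 <= y <= 1 by rewrite y0 ltW.
have H : expR (cfsum psi a y) <= W a := expR_cfsum_le pa y01.
have H1 : expR (cfsum psi a y) <= (1 + expR (psi 0 - psi 1)) * W a.
  by rewrite mulrDl mul1r (le_trans H)// lerDl mulr_ge0// ltW.
move: y0; rewrite le_eqVlt => /orP[/eqP yE|y0].
  rewrite -yE in H H1 *; have [->//|->] := ergsum_cfrac0 psi pa.
  rewrite -addrA [- psi 1 + _]addrC [leLHS]expRD.
  by rewrite mulrC; apply: ler_pM; rewrite ?expR_ge0// lerDr.
by rewrite ergsum_cfrac// y0.
Qed.

(** The supremum in the pressure is bounded below by the value at the interior point 1/2, where
    [ergsum] and [cfsum] agree. *)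
Lemma partition_sum_term_ge e : 0 < e -> exists2 C, 0 < C &
  forall a, posw a ->
  C * expR (- e * (size a)%:R) * W a <= expR (ergsum (size a) psi (cfrac a 2^-1)).
Proof.
(* With [c + 1] in place of [c] the quotient also makes sense for [c = 0], and [c * e' <= e]. *)
move=> e0; pose e' := e / (c + 1).
have c1 : 0 < c + 1 by rewrite ltr_wpDl.
have e'0 : 0 < e' by rewrite divr_gt0.
have [D D0 HD] := cfsum_distortion h_gt0 h_cont e'0.
exists (expR (- c * D) * 4^-1 `^ s) => [|a pa].
  by rewrite mulr_gt0 ?expR_gt0// powR_gt0.
have hh : 0 < (2^-1 : R) < 1 by lra.
have hh' : 0 <= (2^-1 : R) <= 1 by lra.
rewrite ergsum_cfrac// expR_cfsum//.
set n := size a.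
have /andP[_ d] := cfprod_distortion pa hh'.
have P := cfprod_gt0 pa hh'; have P0 := cfprod_gt0 pa itv00.
rewrite [expR _ * _ * _ * _](_ : _ =
    expR (- c * D + - e * n%:R + - c * hinf h a) * (4^-1 * clen a) `^ s); last first.
  by rewrite powRM ?invr_ge0 ?(ltW (clen_gt0 pa))// !expRD /W /weight; ring.
have cl0 := @clen_gt0 R _ pa.
apply: ler_pM; rewrite ?expR_ge0 ?powR_ge0//.
  rewrite ler_expR.
  have : cfsum h a 2^-1 <= hinf h a + e' * n%:R + D.
    rewrite -lerBlDr -lerBlDr; apply: le_hinf => y y01.
    by rewrite lerBlDr lerBlDr; apply: HD.
  have n0 : 0 <= n%:R :> R by [].
  have ce : c * e' * n%:R <= e * n%:R.
    rewrite ler_wpM2r// /e' mulrA ler_pdivrMr// [leLHS]mulrC.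
    by rewrite ler_wpM2l ?ltW// ltrDl.
  by move=> H; have := ler_wpM2l c_ge0 H; lra.
apply: ge0_ler_powR; rewrite ?nnegrE ?sqr_ge0//.
  by rewrite mulr_ge0// ltW.
by rewrite /clen; nra.
Qed.

Let posw_set n : set (n.-tuple nat) :=
  [set a : n.-tuple nat | forall i, (0 < tnth a i)%N].

Let posw_setP n (a : n.-tuple nat) : posw_set a <-> posw a.
Proof.
split=> [H|/all_tnthP H i]; last exact: H.
by apply/all_tnthP.
Qed.

Let term n (a : n.-tuple nat) : \bar R :=
  ereal_sup [set (expR (ergsum n psi (cfrac a x)))%:E | x in `[0, 1[].

Lemma partition_sum_le : exists2 C, 0 < C & forall n X,
  (forall M, Z M n <= X) -> (partition_sum n psi <= (C * X)%:E)%E.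
Proof.
have [C C0 HC] := partition_sum_term_le; exists C => // n X HX.
apply: ge_ereal_sup => _ [A [finA AP] <-].
rewrite fsbig_finite//=.
set L := finmap.enum_fset _.
have LP a : a \in L -> posw a.
  move=> aL; apply/posw_setP/AP; rewrite -inE -(in_fset_set finA); exact: aL.
have tW a : a \in L -> (term a <= (C * W a)%:E)%E.
  move=> /LP pa; apply: ge_ereal_sup => _ [x /= x01 <-].
  by rewrite lee_fin -[n in ergsum n](size_tuple a) HC//; rewrite in_itv in x01.
apply: (@le_trans _ _ (\sum_(a <- L) (C * W a)%:E)%E).
  by rewrite big_seq [leRHS]big_seq; apply: lee_sum => a /tW.
rewrite sumEFin lee_fin -mulr_sumr ler_wpM2l ?(ltW C0)//.
have [M HM] : exists M, {subset [seq tval a | a <- L] <= words M n}.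
  have [M HM] := words_exhaust [seq tval a | a <- L]; exists M => w wL.
  have [a aL E] := mapP wL; have := HM w wL.
  by rewrite {3}E size_tuple; apply; rewrite E; exact: LP.
apply: le_trans (HX M).
rewrite -(big_map (fun a : n.-tuple nat => tval a) xpredT W); apply: ler_sum_uniq => //.
  by rewrite map_inj_uniq ?finmap.fset_uniq//; exact: val_inj.
by move=> w /words_posw/(weight_gt0 h c s)/ltW.
Qed.

Lemma partition_sum_ge e : 0 < e -> exists2 C, 0 < C &
  forall n M, ((C * expR (- e * n%:R) * Z M n)%:E <= partition_sum n psi)%E.
Proof.
move=> e0; have [C C0 HC] := partition_sum_term_ge e0; exists C => // n M.
pose L : seq (n.-tuple nat) := pmap insub (words M n).
have LE : [seq tval a | a <- L] = words M n.
  rewrite /L (pmap_filter (insubK _)); apply/all_filterP/allP => w /words_size sw.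
  by rewrite isSome_insub sw.
have uL : uniq L by rewrite -(map_inj_uniq val_inj) LE words_uniq.
have LP a : a \in L -> posw a.
  by move=> aL; apply: (@words_posw M n); rewrite -LE; apply: map_f.
apply: esum_ge; exists [set` L].
  by split=> [|a /LP/posw_setP//]; apply/finite_seqP; exists L.
rewrite -fsbig_seq//= /Z /wsum -LE big_map big_distrr /= -sumEFin.
rewrite big_seq [leRHS]big_seq; apply: lee_sum => a /LP pa.
have h2 : (2^-1 : R) \in `[0, 1[ by rewrite in_itv /=; lra.
apply: (@le_trans _ _ (expR (ergsum n psi (cfrac a 2^-1)))%:E).
  by rewrite lee_fin; have := HC a pa; rewrite size_tuple.
by apply: ereal_sup_ubound; exists 2^-1.
Qed.

Lemma posw_nseq1 n : posw (nseq n 1%N).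
Proof. by rewrite /posw all_nseq orbT. Qed.

Lemma clen_nseq1 n : 4^-1 ^+ n <= clen (nseq n 1%N) :> R.
Proof.
elim: n => [|n IH]; first by rewrite expr0 /clen /= expr1n.
have pn := posw_nseq1 n.
have p1 : posw [:: 1%N] by [].
have /andP[+ _] := @clen_cat R _ _ p1 pn.
by rewrite clen1 expr1n invr1 mulr1 exprS; have := IH; rewrite /=; nra.
Qed.

Lemma weight_lower : exists2 B, 0 <= B &
  forall w, posw w -> expR (- B * (size w)%:R) * clen w `^ s <= W w.
Proof.
have [M M0 hM] := potential_bounded h_gt0 h_cont.
exists (c * M) => [|w pw]; first by rewrite mulr_ge0// ltW.
rewrite /W /weight ler_wpM2r ?powR_ge0// ler_expR.
have H : hinf h w <= M * (size w)%:R.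
  exact: le_trans (hinf_le h_gt0 pw itv00) (cfsum_le hM pw itv00).
by have := ler_wpM2l c_ge0 H; lra.
Qed.

(** The word 1...1 alone suffices; its length is at least 4^(-n). This is the linear lower bound
    that Fekete's lemma asks for. *)
Lemma wsum_lower : exists B, forall M n, (0 < M)%N ->
  expR (- B * n%:R) <= Z M n.
Proof.
have [B B0 HB] := weight_lower; exists (B + s * ln 4) => M n M0.
have p1 := posw_nseq1 n.
have n1 : nseq n 1%N \in words M n.
  by rewrite mem_words size_nseq eqxx all_nseq /= M0 orbT.
apply: (@le_trans _ _ (W (nseq n 1%N))); last first.
  rewrite /Z /wsum (perm_big _ (perm_to_rem n1)) big_cons lerDl.
  by rewrite big_seq; apply: sumr_ge0 => w /mem_rem/words_posw/(weight_gt0 h c s)/ltW.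
apply: le_trans (HB _ p1); rewrite size_nseq.
rewrite [expR _](_ : _ = expR (- B * n%:R) * (4^-1 ^+ n) `^ s).
  apply: ler_wpM2l; first exact: expR_ge0.
  apply: ge0_ler_powR => //; rewrite ?nnegrE; last exact: clen_nseq1.
    by rewrite exprn_ge0 ?invr_ge0.
  exact: ltW (clen_gt0 p1).
rewrite /powR gt_eqF ?exprn_gt0 ?invr_gt0// lnXn ?invr_gt0// lnV ?posrE//.
by rewrite -expRD; congr expR; rewrite -mulr_natl; ring.
Qed.

(** Appending [n] digits 1 to a single digit costs a factor bounded below independently of that
    digit, so divergence at order 1 spreads to every order. *)
Lemma wsum_unbounded : (forall K, exists M, K < Z M 1) ->
  forall n K, exists M, K < Z M n.+1.
Proof.
move=> unb n K; have [B B0 HB] := weight_lower.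
pose v := nseq n 1%N; have pv : posw v := posw_nseq1 n.
pose D := expR (- B * n.+1%:R) * (4^-1 * clen v) `^ s.
have cv := @clen_gt0 R _ pv.
have D0 : 0 < D by rewrite mulr_gt0 ?expR_gt0// powR_gt0// mulr_gt0.
have [M HM] := unb (K / D).
exists M.+1; rewrite ltr_pdivrMr// in HM; apply: (lt_le_trans HM).
rewrite mulrC -[in leRHS](add1n n).
apply: (@le_trans _ _ (D * Z M.+1 1)).
  by rewrite ler_wpM2l ?(ltW D0)//; exact: wsum_mono.
have n1 : v \in words M.+1 n.
  by rewrite mem_words size_nseq eqxx all_nseq /= orbT.
rewrite /Z /wsum sum_words_cat big_distrr big_seq [leRHS]big_seq.
apply: ler_sum => u uw; have pu := words_posw uw; have su := words_size uw.
apply: (@le_trans _ _ (W (u ++ v))); last first.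
  rewrite (perm_big _ (perm_to_rem n1)) big_cons lerDl.
  rewrite big_seq; apply: sumr_ge0 => w /mem_rem/words_posw pw.
  by apply/ltW/weight_gt0; rewrite posw_cat pu.
have puv : posw (u ++ v) by rewrite posw_cat pu.
apply: le_trans (HB _ puv); rewrite size_cat su size_nseq add1n /D.
have cu := @clen_gt0 R _ pu.
have Wu : weight h c s u <= clen u `^ s.
  rewrite /weight ler_piMl ?powR_ge0// -expR0 ler_expR.
  by have := hinf_ge0 h_gt0 pu; have := c_ge0; nra.
rewrite /= -mulrA; apply: ler_wpM2l; first exact: expR_ge0.
apply: (@le_trans _ _ ((4^-1 * clen v) `^ s * clen u `^ s)).
  by rewrite ler_wpM2l// powR_ge0.
have cv4 : (0 : R) <= 4^-1 * clen v by rewrite mulr_ge0// ltW.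
rewrite -(powRM _ cv4 (ltW cu)).
have /andP[cuv _] := @clen_cat R _ _ pu pv.
apply: ler_powR_base => //; first by rewrite mulr_ge0// ltW.
by apply: le_trans cuv; rewrite mulrAC.
Qed.

(** Fekete's lemma for the logarithm of the supremum over [M]. The supremum is approached by a
    single [M], which later provides the finite set of blocks. *)
Lemma wsum_growth K : (forall M, Z M 1 <= K) -> exists L, forall e, 0 < e ->
  exists N, forall n, (N <= n)%N ->
    (forall M, Z M n <= expR ((L + e) * n%:R)) /\
    (exists M, expR ((L - e) * n%:R) <= Z M n).
Proof.
move=> HK; have [B HB] := wsum_lower.
have Z0 M n : 0 <= Z M n by exact: wsum_ge0.
have ZK M n : Z M n <= Num.max 1 K ^+ n.
  elim: n => [|n IH].
    rewrite expr0 /Z /wsum big_seq1 /weight /clen /= expr1n powR1 mulr1 -expR0.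
    by rewrite ler_expR mulNr oppr_le0 mulr_ge0// hinf_ge0.
  rewrite -add1n exprD expr1; apply: (le_trans (wsum_add h_gt0 M 1 n c_ge0 s_ge0)).
  by apply: ler_pM => //; rewrite (le_trans (HK M))// le_max lexx orbT.
pose S n := [set Z M n | M in [set: nat]].
have S0 n : S n !=set0 by exists (Z 0 n), 0%N.
have Sub n : has_ubound (S n) by exists (Num.max 1 K ^+ n) => _ [M _ <-].
pose z n := sup (S n).
have zZ M n : Z M n <= z n by apply: ub_le_sup => //; exists M.
have z0 n : expR (- B * n%:R) <= z n by apply: le_trans (zZ 1%N n); exact: HB.
have zp n : 0 < z n by apply: lt_le_trans (z0 n); exact: expR_gt0.
have zsub n m : z (n + m)%N <= z n * z m.
  apply: ge_sup => // _ [M _ <-].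
  apply: (le_trans (wsum_add h_gt0 M n m c_ge0 s_ge0)).
  exact: ler_pM (Z0 M n) (Z0 M m) (zZ M n) (zZ M m).
have [L HL] : exists L, forall e, 0 < e -> exists N, forall n, (N <= n)%N ->
    (L - e) * n%:R <= ln (z n) <= (L + e) * n%:R.
  apply: (@fekete _ (fun n => ln (z n)) B) => [n m|n].
    by rewrite -lnM ?posrE// ler_ln ?posrE ?mulr_gt0.
  by rewrite -ler_expR lnK ?posrE.
exists L => e e0; have e20 : 0 < e / 2 by rewrite divr_gt0.
have [N HN] := HL _ e20; exists N.+1 => n Nn.
have /andP[lo hi] := HN n (ltnW Nn).
have n0 : 0 < n%:R :> R by rewrite ltr0n (leq_trans _ Nn).
split=> [M|].
  apply: le_trans (zZ M n) _; rewrite -[z n]lnK ?posrE// ler_expR.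
  by apply: (le_trans hi); nra.
have : expR ((L - e) * n%:R) < z n.
  rewrite -[z n]lnK ?posrE// ltr_expR; apply: lt_le_trans lo; nra.
by move=> /(sup_gt (S0 n))[_ [M _ <-] /ltW]; exists M.
Qed.

(** All later arguments reach the pressure through this statement. The multiplicative constants
    between partition sums and weight sums disappear after taking logarithms and dividing by [n]. *)
Lemma pressure_dichotomy :
  (pressure psi = +oo%E /\ forall n K, exists M, K < Z M n.+1) \/
  exists L, pressure psi = L%:E /\ forall e, 0 < e ->
    exists N, forall n, (N <= n)%N ->
    (forall M, Z M n <= expR ((L + e) * n%:R)) /\
    (exists M, expR ((L - e) * n%:R) <= Z M n).
Proof.
have [[K HK]|unb] := pselect (exists K, forall M, Z M 1 <= K); last first.
  left; have {}unb K : exists M, K < Z M 1.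
    apply: contrapT => nK; apply: unb; exists K => M.
    by rewrite leNgt; apply/negP => KM; apply: nK; exists M.
  have H := wsum_unbounded unb; split=> //.
  have [C C0 HC] := partition_sum_ge ltr01.
  have pinf n : partition_sum n.+1 psi = +oo%E.
    apply/eqyP => A A0; pose D := C * expR (- 1 * n.+1%:R).
    have D0 : 0 < D by rewrite mulr_gt0// expR_gt0.
    have [M HM] := H n (A / D); apply: le_trans (HC n.+1 M).
    by rewrite lee_fin mulrC -ler_pdivrMr// ltW.
  apply: cvg_lim => //; apply: cvg_near_cst; exists 1%N => // -[//|n] _.
  rewrite pinf /=.
  by rewrite gt0_muley// lte_fin invr_gt0 ltr0n.
right; have [L HL] := wsum_growth HK; exists L; split=> //.
have [C1 C10 HC1] := partition_sum_le.
have near_p e : 0 < e -> exists N, forall n, (N <= n)%N -> exists p,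
    ((n%:R^-1)%:E * lne (partition_sum n psi))%E = p%:E /\ `|L - p| <= e.
  move=> e0; have e30 : 0 < e / 3 by rewrite divr_gt0.
  have [C2 C20 HC2] := partition_sum_ge e30.
  have [N HN] := HL _ e30.
  pose Q := (`|ln C1| + `|ln C2|) / (e / 3).
  exists (maxn N.+1 (Num.truncn Q).+1) => n; rewrite geq_max => /andP[Nn Qn].
  have n0 : 0 < n%:R :> R by rewrite ltr0n (leq_trans _ Nn).
  have {}Qn : `|ln C1| + `|ln C2| <= e / 3 * n%:R.
    rewrite -ler_pdivrMl// mulrC; apply/ltW.
    by apply: lt_le_trans (truncnS_gt _) _; rewrite ler_nat.
  have [up [M lo]] := HN n (ltnW Nn).
  have pu := HC1 _ _ up; have pl := HC2 n M.
  have pl' : (((C2 * expR (- (e / 3) * n%:R)) * expR ((L - e / 3) * n%:R))%:E <=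
      partition_sum n psi)%E.
    by apply: le_trans pl; rewrite lee_fin ler_wpM2l// mulr_ge0 ?expR_ge0// ltW.
  case: (partition_sum n psi) pu pl' => [p| |]//.
  rewrite !lee_fin => pu pl'.
  have p0 : 0 < p by apply: lt_le_trans pl'; rewrite !mulr_gt0 ?expR_gt0.
  exists (n%:R^-1 * ln p); split; first by rewrite lne_EFin// EFinM.
  have l1 : ln p <= ln C1 + (L + e / 3) * n%:R.
    rewrite -[X in _ + X]expRK -lnM ?posrE ?expR_gt0//.
    by rewrite ler_ln ?posrE// mulr_gt0 ?expR_gt0.
  have l2 : ln C2 + (- (e / 3) * n%:R) + (L - e / 3) * n%:R <= ln p.
    rewrite -[- _ * _]expRK -[X in _ + X]expRK -!lnM ?posrE ?mulr_gt0 ?expR_gt0//.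
    by rewrite ler_ln ?posrE// !mulr_gt0 ?expR_gt0.
  have k1 := ler_norm (ln C1); have k2 := ler_norm (- ln C2); rewrite normrN in k2.
  have g1 := normr_ge0 (ln C1); have g2 := normr_ge0 (ln C2).
  rewrite ler_norml; apply/andP; split.
    rewrite lerBrDr addrC -lerBrDr opprK mulrC ler_pdivrMr//; lra.
  rewrite lerBlDr addrC -lerBlDr mulrC ler_pdivlMr//; lra.
apply: cvg_lim => //; apply/fine_cvgP; split.
  have [N HN] := near_p _ ltr01; exists N => // n /= Nn.
  by have [p [-> _]] := HN n Nn.
apply/cvgrPdist_le => e e0; have [N HN] := near_p _ e0; exists N => // n /= Nn.
by have [p [-> ]] := HN n Nn.
Qed.

End Pressure.

(** * Hausdorff measures *)

Section HausdorffGeneral.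
Context {R : realType}.
Implicit Types (A U : set R) (s d X : R).

Lemma le_diam U x y : U x -> U y -> (`|x - y|%:E <= diam U)%E.
Proof. by move=> Ux Uy; apply: ereal_sup_ubound; exists x, y. Qed.

Lemma diam_le U d : (forall x y, U x -> U y -> `|x - y| <= d) ->
  (diam U <= d%:E)%E.
Proof.
by move=> H; apply: ge_ereal_sup => _ [x [y [Ux Uy ->]]]; rewrite lee_fin H.
Qed.

Lemma diam_ge0 U : U !=set0 -> (0 <= diam U)%E.
Proof. by move=> [x Ux]; have := le_diam Ux Ux; rewrite subrr normr0. Qed.

Lemma le_diam_powR U d s : 0 <= s -> U !=set0 -> (diam U <= d%:E)%E ->
  (poweR (diam U) s <= (d `^ s)%:E)%E.
Proof.
move=> s0 U0 Ud; have D0 := diam_ge0 U0.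
case: (diam U) D0 Ud => [r| |]//; rewrite !lee_fin => r0 rd.
exact: ler_powR_base.
Qed.

Lemma hausdorff_premeasure_ge0 s d A : (0 <= hausdorff_premeasure s d A)%E.
Proof.
apply: le_ereal_inf_tmp => _ [U _ <-].
by apply: nneseries_ge0 => n _ _; exact: poweR_ge0.
Qed.

(** Covers indexed by any countable type, through its enumeration; indices outside the range of
    [pickle] get the empty set. The costs being nonnegative, a bound on the finite sums is
    enough. *)
Lemma hausdorff_premeasure_le (I : countType) (U : I -> set R) (c : I -> R)
    s d X A : 0 <= s -> A `<=` \bigcup_i U i ->
  (forall i, U i !=set0 -> (diam (U i) <= (c i)%:E)%E /\ c i <= d) ->
  (forall F : seq I, uniq F -> \sum_(i <- F) c i `^ s <= X) ->
  (hausdorff_premeasure s d A <= X%:E)%E.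
Proof.
move=> s0 AU Uc HF.
pose V n := if pickle_inv n is Some i then U i else set0.
have cvgV : cvgn (fun k => \sum_(0 <= i < k | V i != set0) poweR (diam (V i)) s)%E.
  by apply: is_cvg_nneseries => n _ _; exact: poweR_ge0.
apply: (@le_trans _ _ (\sum_(0 <= i <oo | V i != set0) poweR (diam (V i)) s)%E).
  apply: ereal_inf_lbound; exists V => //; split=> [x /AU[i _ Uix]|n].
    by exists (pickle i) => //; rewrite /V pickleK_inv.
  rewrite /V; case: pickle_inv => [i|]; last by rewrite diam_le.
  have [->|/set0P U0] := eqVneq (U i) set0; first by rewrite diam_le.
  by have [h1 h2] := Uc i U0; rewrite (le_trans h1)// lee_fin.
apply: lime_le => //; apply: nearW => k.
pose f n := if pickle_inv n is Some i then c i `^ s else 0.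
apply: (@le_trans _ _ (\sum_(0 <= n < k) (f n)%:E)%E).
  rewrite big_mkcond /=; apply: lee_sum => n _; rewrite /f /V.
  case: pickle_inv => [i|]; last by rewrite eqxx.
  case: ifPn => [/set0P U0|_]; last by rewrite lee_fin powR_ge0.
  by apply: le_diam_powR => //; have [] := Uc i U0.
rewrite sumEFin lee_fin.
have -> : \sum_(0 <= n < k) f n = \sum_(i <- pmap pickle_inv (index_iota 0 k)) c i `^ s :> R.
  elim: (index_iota 0 k) => [|n l IH] /=; first by rewrite !big_nil.
  by rewrite big_cons {1}/f IH; case: (pickle_inv n) => [i|]; rewrite ?big_cons ?add0r.
apply: HF; apply: (@pmap_uniq _ _ _ pickle); last exact: iota_uniq.
exact: pickle_invK.
Qed.

Lemma hausdorff_measure_eq0 s A :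
  (forall d e, 0 < d -> 0 < e -> (hausdorff_premeasure s d A <= e%:E)%E) ->
  hausdorff_measure s A = 0%E.
Proof.
move=> H; apply/eqP; rewrite eq_le; apply/andP; split.
  apply: ge_ereal_sup => _ [d /= d0 <-]; apply/lee_addgt0Pr => e e0.
  by rewrite add0e H.
apply: (@le_trans _ _ (hausdorff_premeasure s 1 A)).
  exact: hausdorff_premeasure_ge0.
by apply: ereal_sup_ubound; exists 1 => //=.
Qed.

Lemma hausdorff_measure_eq0_sub (A B : set R) s : A `<=` B ->
  hausdorff_measure s B = 0%E -> hausdorff_measure s A = 0%E.
Proof.
move=> AB HB; apply: hausdorff_measure_eq0 => d e d0 e0.
apply: (@le_trans _ _ 0%E); last by rewrite lee_fin ltW.
rewrite -HB; apply: (@le_trans _ _ (hausdorff_premeasure s d B)); last first.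
  by apply: ereal_sup_ubound; exists d.
apply: ereal_inf_le_tmp => _ [U [BU Ud] <-].
by exists U => //; split=> // x /AB/BU.
Qed.

Lemma hausdorff_measure_mono s s' A : 0 <= s -> s <= s' ->
  hausdorff_measure s A = 0%E -> hausdorff_measure s' A = 0%E.
Proof.
move=> s0 ss' HA; apply: hausdorff_measure_eq0 => d e d0 e0.
(* Raising the exponent lowers the cost only for diameters at most 1. *)
pose d' := Num.min d 1.
have d'0 : 0 < d' by rewrite lt_min d0 ltr01.
have H : (hausdorff_premeasure s d' A < e%:E)%E.
  apply: (@le_lt_trans _ _ 0%E); last by rewrite lte_fin.
  by rewrite -HA; apply: ereal_sup_ubound; exists d'.
have [_ [U [AU Ud] <-] Ue] := ereal_inf_lt H.
apply: (@le_trans _ _ (\sum_(0 <= i <oo | U i != set0) poweR (diam (U i)) s')%E).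
  apply: ereal_inf_lbound; exists U => //; split=> // i; apply: (le_trans (Ud i)).
  by rewrite lee_fin /d' ge_min lexx.
apply: le_trans (ltW Ue); apply: lee_nneseries => [n _ _|n /set0P U0]; first exact: poweR_ge0.
have := Ud n; have D0 := diam_ge0 U0.
case: (diam (U n)) D0 => [r| |]//; rewrite !lee_fin => r0 rd'.
have r1 : r <= 1 by rewrite (le_trans rd')// /d' ge_min lexx orbT.
(* A point has diameter 0, and 0 to the power 0 is 1; but if [s'] is 0 then so is [s]. *)
move: r0; rewrite le_eqVlt => /orP[/eqP<-|r0]; last by apply: ger_powR; rewrite ?r0.
have [s'0|s'0] := eqVneq s' 0; last by rewrite powR0// powR_ge0.
by have -> : s = s' by lra.
Qed.

Lemma hausdorff_dim_le A d : 0 <= d ->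
  (forall s, d < s -> hausdorff_measure s A = 0%E) -> (hausdorff_dim A <= d%:E)%E.
Proof.
move=> d0 H; apply/lee_addgt0Pr => e e0; rewrite -EFinD.
apply: ereal_inf_lbound; exists (d + e) => //=; split; first by rewrite addr_ge0// ltW.
by apply: H; rewrite ltrDl.
Qed.

(** The [n] intervals of a uniform grid cost n^(1 - s) in total. *)
Lemma hausdorff_measure_itv01 s : 1 < s ->
  hausdorff_measure s [set x : R | 0 <= x < 1] = 0%E.
Proof.
move=> s1; apply: hausdorff_measure_eq0 => d e d0 e0.
have s0 : 0 < s - 1 by lra.
pose t := Num.min d (e `^ (s - 1)^-1).
have t0 : 0 < t by rewrite lt_min d0 powR_gt0.
pose n := (Num.truncn t^-1).+1.
have n0 : 0 < n%:R :> R by rewrite ltr0n.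
have nt : n%:R^-1 <= t.
  by rewrite invf_ple ?posrE//; apply/ltW; exact: truncnS_gt.
pose U (i : 'I_n) := [set x : R | i%:R / n%:R <= x <= i.+1%:R / n%:R].
apply: (@hausdorff_premeasure_le _ U (fun=> n%:R^-1)).
- by lra.
- move=> x /= /andP[x0 x1].
  have nx0 : 0 <= n%:R * x by rewrite mulr_ge0// ltW.
  have xn : (Num.truncn (n%:R * x) < n)%N.
    by rewrite -(ltr_nat R) (@le_lt_trans _ _ (n%:R * x)) ?truncn_le// gtr_pMr.
  exists (Ordinal xn) => //=; rewrite /U /= ler_pdivrMr// ler_pdivlMr//.
  by rewrite [x * _]mulrC; apply/andP; split; [rewrite truncn_le|exact/ltW/truncnS_gt].
- move=> i _; split; last by rewrite (le_trans nt)// /t ge_min lexx.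
  apply: diam_le => x y /andP[x1 x2] /andP[y1 y2].
  rewrite -natr1 mulrDl mul1r in x2 y2.
  rewrite ler_norml; lra.
- move=> F uF.
  apply: (@le_trans _ _ (\sum_(i < n) n%:R^-1 `^ s)).
    by apply: ler_sum_uniq => // i _; rewrite ?powR_ge0 ?mem_index_enum.
  rewrite sumr_const card_ord -(mulr_natl (_ `^ s)).
  have nV0 : 0 < n%:R^-1 :> R by rewrite invr_gt0.
  have -> : n%:R * n%:R^-1 `^ s = n%:R^-1 `^ (s - 1) :> R.
    rewrite -[X in X * _]invrK -[X in X * _](@powR_inv1 _ n%:R^-1) ?invr_ge0 ?ltW//.
    by rewrite -powRD ?(gt_eqF nV0) ?implybT//; congr (_ `^ _); lra.
  have -> : e = (e `^ (s - 1)^-1) `^ (s - 1).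
    by rewrite -powRrM mulVf ?gt_eqF// powRr1// ltW.
  apply: ler_powR_base; [exact: ltW|by rewrite invr_ge0 ltW|].
  by rewrite (le_trans nt)// /t ge_min lexx orbT.
Qed.

End HausdorffGeneral.

(** * Upper bound *)

Section UpperBound.
Context {R : realType}.
Implicit Types (s y B : R) (w : seq nat) (r : nat).

Lemma g_funSS r s : g_fun r.+2 s = s * g_fun r.+1 s / (1 - s + g_fun r.+1 s).
Proof. by []. Qed.

Lemma g_fun_itv r s : 0 < s <= 1 -> 0 < g_fun r.+1 s <= s.
Proof.
move=> /andP[s0 s1]; elim: r => [|r /andP[g0 gs]]; first by rewrite /= s0 lexx.
have D : 0 < 1 - s + g_fun r.+1 s by rewrite ltr_wpDl// subr_ge0.
rewrite g_funSS divr_gt0 ?mulr_gt0//= ler_pdivrMr// ler_pM2l//.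
by rewrite lerDr subr_ge0.
Qed.

Lemma g_fun0 r : g_fun r (0 : R) = 0.
Proof. by case: r => // -[//|r]; rewrite g_funSS !mul0r. Qed.

Lemma g_fun_ge0 r s : 0 <= s <= 1 -> 0 <= g_fun r s.
Proof.
move=> /andP[]; rewrite le_eqVlt => /orP[/eqP<- _|s0 s1]; first by rewrite g_fun0.
by case: r => // r; have /andP[/ltW] := @g_fun_itv r s (introT andP (conj s0 s1)).
Qed.

(** This makes the exponent 1 - 2 s + g positive, so that in the cover below the sum over the small
    digits is governed by the largest of them. *)
Lemma g_fun_gt r s : 0 < s < 1 -> 2 * s - 1 < g_fun r.+1 s.
Proof.
move=> /andP[s0 s1]; elim: r => [|r IH]; first by rewrite /=; lra.
have /andP[g0 gs] : 0 < g_fun r.+1 s <= s by rewrite g_fun_itv// s0 ltW.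
by rewrite g_funSS ltr_pdivlMr; nra.
Qed.

Lemma g_fun_mono r s s' : 0 <= s -> s <= s' -> s' <= 1 -> g_fun r s <= g_fun r s'.
Proof.
move=> s_ge0 ss' s'1; move: (s_ge0); rewrite le_eqVlt => /orP[/eqP s0|s0].
  by rewrite -s0 g_fun0 g_fun_ge0// s'1 andbT; lra.
case: r => // r; elim: r => // r IH.
have /andP[g0 gs] : 0 < g_fun r.+1 s <= s by rewrite g_fun_itv//; lra.
have /andP[G0 Gs] : 0 < g_fun r.+1 s' <= s' by rewrite g_fun_itv//; lra.
rewrite !g_funSS ler_pdivrMr; last lra.
rewrite [leRHS]mulrAC ler_pdivlMr; last lra.
move: IH g0 gs G0 Gs; set g := g_fun r.+1 s; set G := g_fun r.+1 s' => IH g0 gs G0 Gs.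
have h1 : s * g * (1 - s') <= s' * G * (1 - s).
  by apply: ler_pM; rewrite ?mulr_ge0 ?subr_ge0//; try lra; apply: ler_pM; lra.
have h2 : 0 <= (s' - s) * (g * G) by rewrite mulr_ge0 ?subr_ge0// mulr_ge0 ?ltW.
nra.
Qed.

(** Comparison with the integral of t^(a - 1), with a factor 2 to spare. *)
Lemma sum_powR_le (a : R) (m : nat) : 0 < a <= 1 ->
  \sum_(d <- iota 1 m) d%:R `^ (a - 1) <= 2 / a * m%:R `^ a.
Proof.
move=> /andP[a0 a1]; elim: m => [|m IH].
  by rewrite big_nil mulr_ge0 ?powR_ge0// divr_ge0// ltW.
rewrite -[in iota _ _](addn1 m) iotaD big_cat /= big_seq1 add1n.
set n := m.+1%:R : R.
have n0 : 0 < n by rewrite ltr0n.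
have nE : n `^ (a - 1) = n `^ a / n.
  by rewrite powRD ?(gt_eqF n0) ?implybT// powR_inv1// ltW.
have P0 : 0 < n `^ a by rewrite powR_gt0.
(* [H] amounts to (1 - 1/n)^a <= exp(-a/n) <= 1/(1 + a/n); it closes the induction because 1/(1 + t)
   <= 1 - t/2 for 0 < t <= 1. *)
suff H : m%:R `^ a <= n `^ a / (1 + a / n).
  have an : 0 < a / n <= 1.
    by rewrite divr_gt0//= ler_pdivrMr// mul1r (le_trans a1)// ler1n.
  have H2 : n `^ a / (1 + a / n) <= n `^ a - a / 2 * (n `^ a / n).
    rewrite [a / 2 * _](_ : _ = n `^ a * (a / n) / 2); last by field; rewrite gt_eqF.
    move: an; set t := a / n => /andP[t0 t1].
    have t1' : 0 <= 1 - t by rewrite subr_ge0.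
    have := mulr_ge0 (mulr_ge0 (ltW P0) (ltW t0)) t1'.
    by clearbody t; move: (n `^ a) => P HP; rewrite ler_pdivrMr; lra.
  apply: (le_trans (lerD IH (lexx _))); rewrite nE.
  have := le_trans H H2 => {}H2.
  have a20 : 0 <= 2 / a by rewrite divr_ge0// ltW.
  have K := ler_wpM2l a20 H2.
  rewrite [leRHS](_ : _ = 2 / a * n `^ a - n `^ a / n) in K.
    by rewrite -lerBrDr.
  by field; rewrite !gt_eqF.
case: m @n n0 nE P0 {IH} => [|m] n n0 nE P0.
  rewrite powR0 ?(gt_eqF a0)//; apply: divr_ge0; first exact: ltW.
  by apply: addr_ge0 => //; apply: divr_ge0 => //; exact: ltW.
have m0 : 0 < m.+1%:R :> R by rewrite ltr0n.
have -> : m.+1%:R = n * (1 - n^-1).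
  by rewrite mulrBr mulr1 divff ?gt_eqF// /n -(natr1 m.+1) addrK.
have n1 : 1 < n by rewrite ltr1n.
have nV : 0 < n^-1 < 1 by rewrite invr_gt0 n0 invf_lt1.
have /andP[nV0 nV1] := nV.
have n1' : 0 < 1 - n^-1 by rewrite subr_gt0.
rewrite (powRM _ (ltW n0) (ltW n1')) ler_wpM2l//; first exact: ltW.
rewrite /powR gt_eqF//.
have L : ln (1 - n^-1) <= - n^-1 by apply: le_ln1Dx; rewrite ltrN2.
apply: (@le_trans _ _ (expR (- (a / n)))).
  by rewrite ler_expR -mulrN ler_wpM2l// ltW.
have an : 0 < a / n by rewrite divr_gt0.
rewrite expRN lef_pV2 ?posrE ?expR_gt0//; last by rewrite addr_gt0.
exact: expR_ge1Dx.
Qed.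

Definition digit_prod r y : nat := (\prod_(1 <= i < r.+1) pquot i y)%N.

Lemma digit_prodS r y : digit_prod r.+1 y = (pquot 1 y * digit_prod r (gauss y))%N.
Proof.
rewrite /digit_prod big_ltn//; congr (_ * _)%N.
rewrite big_add1 [LHS]big_nat [RHS]big_nat; apply: eq_bigr => i /andP[i1 _].
by rewrite pquotS.
Qed.

Lemma pquot1_le y : 0 < y -> (pquot 1 y)%:R <= y^-1.
Proof. by move=> y0; rewrite /pquot /= truncn_le invr_ge0 ltW. Qed.

Lemma clen_rcons_le w d : posw w -> (0 < d)%N ->
  clen (rcons w d) <= clen w * d%:R ^- 2 :> R.
Proof.
move=> pw d0; rewrite -cats1 -clen1.
have pd : posw [:: d] by rewrite /posw /= d0.
by have /andP[] := @clen_cat R _ _ pw pd.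
Qed.

(* The pair [(v, u)] stands for the interval of all [v_1, ..., v_k + z] with
   [0 <= z <= u], of length at most [clen v * u]. The digit [d] is treated as
   large beyond [B `^ (g / (1 - s + g))], the threshold at which covering by a
   single interval is as cheap as covering each small [d] recursively. *)
Lemma digit_prod_cover r s : 0 < s < 1 -> exists2 C, 0 < C &
  forall w B, posw w -> 0 < B -> exists l : seq (seq nat * R),
  [/\ forall y, 0 <= y < 1 -> B <= (digit_prod r.+1 y)%:R ->
        exists2 p, p \in l & exists2 z, 0 <= z <= p.2 & cfrac w y = cfrac p.1 z,
      forall p, p \in l -> [/\ posw p.1, 0 <= p.2 <= 1 & clen p.1 * p.2 <= clen w] &
      \sum_(p <- l) (clen p.1 * p.2) `^ s <= C * clen w `^ s * B `^ (- g_fun r.+1 s)].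
Proof.
move=> /andP[s0 s1].
have s01 : 0 < s <= 1 by rewrite s0 ltW.
(* For [B <= 1] the factor B^(-g) is at least 1, and the whole cylinder is an admissible cover. *)
have trivial_cover C w B g : 1 <= C -> 0 <= g -> posw w -> 0 < B <= 1 ->
    exists l : seq (seq nat * R),
  [/\ forall y, 0 <= y < 1 ->
        exists2 p, p \in l & exists2 z, 0 <= z <= p.2 & cfrac w y = cfrac p.1 z,
      forall p, p \in l -> [/\ posw p.1, 0 <= p.2 <= 1 & clen p.1 * p.2 <= clen w] &
      \sum_(p <- l) (clen p.1 * p.2) `^ s <= C * clen w `^ s * B `^ (- g)].
  move=> C1 g0 pw /andP[B0 B1]; exists [:: (w, 1)]; split.
  - move=> y /andP[y0 y1]; exists (w, 1); first by rewrite mem_head.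
    by exists y => //=; rewrite y0 ltW.
  - by move=> p; rewrite inE => /eqP-> /=; rewrite ler01 lexx mulr1.
  - rewrite big_seq1 /= mulr1.
    have B1' : 1 <= B `^ (- g).
      rewrite powRN -[X in X <= _]invr1 lef_pV2 ?posrE ?powR_gt0//.
      by have := ler_powR_base g0 (ltW B0) B1; rewrite powR1.
    by rewrite mulrAC -[leLHS]mul1r ler_wpM2r ?powR_ge0//; nra.
have large w X : posw w -> 1 <= X -> forall y, 0 <= y < 1 -> X <= (pquot 1 y)%:R ->
    exists2 z, 0 <= z <= X^-1 & cfrac w y = cfrac w z.
  move=> pw X1 y /andP[y0 y1] Xd; have X0 : 0 < X by apply: lt_le_trans X1.
  have {}y0 : 0 < y.
    rewrite lt_neqAle y0 andbT; apply/eqP => y0'.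
    by move: Xd; rewrite -y0' /pquot /= invr0 truncn0 leNgt X0.
  exists y => //; rewrite (ltW y0)/= -[y]invrK lef_pV2 ?posrE ?invr_gt0//.
  exact: le_trans Xd (pquot1_le y0).
elim: r => [|r [C C0 IH]].
  exists 1 => // w B pw B0; have [B1|B1] := leP B 1.
    have [l [l1 l2 l3]] := trivial_cover 1 w B s (lexx _) (ltW s0) pw (introT andP (conj B0 B1)).
    by exists l; split => // y y01 _; exact: l1.
  exists [:: (w, B^-1)]; split.
  - move=> y y01; rewrite /digit_prod big_nat1 => By.
    have [z z0 E] := large w B pw (ltW B1) y y01 By.
    by exists (w, B^-1); [rewrite mem_head|exists z].
  - move=> p; rewrite inE => /eqP-> /=; rewrite invr_ge0 (ltW B0) invf_le1// ltW//.
    by split => //; rewrite ler_piMr ?invf_le1 ?ltW// clen_gt0.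
  - rewrite big_seq1 /= mul1r powRM ?invr_ge0 ?(ltW B0)// ?(ltW (clen_gt0 _))//.
    by rewrite -powR_inv1 ?(ltW B0)// -powRrM mulN1r.
have g'01 := @g_fun_itv r s s01; have /andP[g'0 g's] := g'01.
have g'gt : 2 * s - 1 < g_fun r.+1 s by rewrite g_fun_gt// s0.
set g' := g_fun r.+1 s in IH g'01 g'0 g's g'gt *.
have g0 : 0 < g_fun r.+2 s by have /andP[] := @g_fun_itv r.+1 s s01.
rewrite g_funSS -/g' in g0 *.
have D0 : 0 < 1 - s + g' by lra.
(* A small digit d costs d^(-2 s) for the length and d^(g') for the relaxed bound B / d, that is
   d^(ga - 1). With X = B^al the small digits add up to B^(-g') X^ga and the large ones cost X^(-s);
   by [gE'] both are B^(-s al). *)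
pose al := g' / (1 - s + g'); pose ga := 1 - 2 * s + g'.
have al0 : 0 < al by rewrite divr_gt0.
have al1 : al <= 1 by rewrite ler_pdivrMr//; lra.
have ga01 : 0 < ga <= 1 by rewrite /ga; lra.
have gE : s * g' / (1 - s + g') = s * al by rewrite mulrA.
have gE' : al * ga - g' = - (s * al).
  by rewrite /ga /al; field; rewrite gt_eqF.
have ga0 : 0 < ga by have /andP[] := ga01.
have K0 : 0 < C * (2 / ga) by rewrite mulr_gt0// divr_gt0.
exists (1 + C * (2 / ga)) => [|w B pw B0]; first lra.
have [B1|B1] := leP B 1.
  have [l [l1 l2 l3]] := trivial_cover (1 + C * (2 / ga)) w B _ ltac:(lra) (ltW g0) pw (introT andP (conj B0 B1)).
  by exists l; split => // y y01 _; exact: l1.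
pose X := B `^ al.
have X1 : 1 <= X by rewrite -(powRr0 B) /X ler_powR ?ltW.
have X0 : 0 < X by apply: lt_le_trans X1.
have /choice[F HF] : forall d, exists l : seq (seq nat * R), (0 < d)%N ->
  [/\ forall y, 0 <= y < 1 -> B / d%:R <= (digit_prod r.+1 y)%:R ->
        exists2 p, p \in l & exists2 z, 0 <= z <= p.2 & cfrac (rcons w d) y = cfrac p.1 z,
      forall p, p \in l -> [/\ posw p.1, 0 <= p.2 <= 1 & clen p.1 * p.2 <= clen (rcons w d)] &
      \sum_(p <- l) (clen p.1 * p.2) `^ s <= C * clen (rcons w d) `^ s * (B / d%:R) `^ (- g')].
  move=> d; have [d0|d0] := posnP d; first by exists [::]; rewrite d0.
  have pd : posw (rcons w d) by rewrite posw_rcons d0.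
  have Bd : 0 < B / d%:R by rewrite divr_gt0// ltr0n.
  by have [l Hl] := IH _ _ pd Bd; exists l.
pose m := Num.truncn X.
exists ((w, X^-1) :: flatten [seq F d | d <- iota 1 m]); split.
- move=> y y01 By; have [Xd|dX] := leP X (pquot 1 y)%:R.
    have [z z0 E] := large w X pw X1 y y01 Xd.
    by exists (w, X^-1); [rewrite mem_head|exists z].
  (* At [y = 0] the next digit is 0 by convention, and the product cannot reach the positive bound
     [B]. *)
  have y0 : 0 < y < 1.
    have /andP[y0 ->] := y01; rewrite andbT lt_neqAle y0 andbT.
    apply/eqP => y0'; move: By.
    by rewrite digit_prodS -y0' /pquot /= invr0 truncn0 mul0n leNgt B0.
  have [d0 Ey] := pquot1_inv y0; set d := pquot 1 y in d0 Ey dX By.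
  have d0' : 0 < d%:R :> R by rewrite ltr0n.
  have [c1 _ _] := HF d d0.
  have Bd : B / d%:R <= (digit_prod r.+1 (gauss y))%:R.
    by rewrite ler_pdivrMr// -natrM mulnC -digit_prodS.
  have [p pF [z z0 E]] := c1 (gauss y) (gauss_itv y) Bd.
  exists p.
    rewrite inE; apply/orP; right; apply/flattenP; exists (F d) => //.
    apply: map_f; rewrite mem_iota d0 add1n ltnS /m.
    by rewrite /= -ltnS -(ltr_nat R) (lt_trans dX)// truncnS_gt.
  by exists z => //; rewrite -E -cats1 cfrac_cat cfrac_cons /cfrac /= -Ey.
- have cw := @clen_gt0 R _ pw.
  move=> p; rewrite inE => /orP[/eqP-> /=|/flattenP[l /mapP[d + ->] pl]].
    rewrite invr_ge0 (ltW X0) invf_le1// X1; split => //.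
    by rewrite ler_piMr ?invf_le1// ltW.
  rewrite mem_iota => /andP[d0 _]; have [_ c2 _] := HF d d0.
  have [p1 p2 p3] := c2 p pl; split => //; apply: (le_trans p3).
  apply: (le_trans (clen_rcons_le pw d0)); rewrite ler_piMr ?(ltW cw)//.
  by rewrite -exprVn exprn_ile1 ?invr_ge0// invf_le1 ?ltr0n// ler1n.
- have cw := @clen_gt0 R _ pw; have cws := powR_ge0 (clen w) s.
  rewrite big_cons big_flatten big_map /= gE.
  rewrite [leRHS](_ : _ = clen w `^ s * B `^ (- (s * al)) +
    C * (2 / ga) * clen w `^ s * B `^ (- (s * al))); last ring.
  apply: lerD.
    rewrite powRM ?invr_ge0 ?(ltW X0) ?(ltW cw)// ler_wpM2l//.
    rewrite -powR_inv1 ?(ltW X0)// -powRrM mulN1r /X -powRrM.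
    by rewrite mulrN [al * s]mulrC.
  apply: (@le_trans _ _ (\sum_(d <- iota 1 m) C * clen w `^ s * B `^ (- g') * d%:R `^ (ga - 1))).
    rewrite big_seq [leRHS]big_seq; apply: ler_sum => d.
    rewrite mem_iota => /andP[d0 _]; have [_ _ c3] := HF d d0.
    have d0' : 0 < d%:R :> R by rewrite ltr0n.
    apply: (le_trans c3).
    rewrite -!mulrA ler_wpM2l ?(ltW C0)//.
    apply: (@le_trans _ _ ((clen w * d%:R ^- 2) `^ s * (B / d%:R) `^ (- g'))).
      rewrite ler_wpM2r ?powR_ge0// ler_powR_base ?(ltW s0) ?clen_rcons_le//.
      by rewrite ltW// clen_gt0// posw_rcons d0.
    rewrite powRM ?(ltW cw) ?invr_ge0 ?exprn_ge0// powRM ?(ltW B0) ?invr_ge0//.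
    rewrite -!mulrA ler_wpM2l// mulrCA ler_wpM2l ?powR_ge0//.
    have -> : d%:R ^- 2 = d%:R `^ (- 2) :> R by rewrite powRN powR_mulrn.
    rewrite -(@powR_inv1 _ d%:R) ?(ltW d0')// -!powRrM.
    rewrite -powRD ?(gt_eqF d0') ?implybT//.
    by rewrite (_ : - 2 * s + - 1 * - g' = ga - 1)// /ga; ring.
  rewrite -mulr_sumr.
  apply: (@le_trans _ _ (C * clen w `^ s * B `^ (- g') * (2 / ga * X `^ ga))).
    rewrite ler_wpM2l ?mulr_ge0 ?powR_ge0 ?(ltW C0)//.
    apply: (le_trans (sum_powR_le m ga01)).
    rewrite ler_wpM2l ?divr_ge0 ?(ltW ga0)// ler_powR_base ?(ltW ga0)//.
    by rewrite /m truncn_le ltW.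
  rewrite /X -powRrM.
  have -> : B `^ (- (s * al)) = B `^ (- g') * B `^ (al * ga).
    by rewrite -powRD ?(gt_eqF B0) ?implybT// -gE'; congr (_ `^ _); ring.
  by rewrite le_eqVlt; apply/orP; left; apply/eqP; ring.
Qed.

(** Once an expansion has ended, its digits are 0 and so is their product; the event itself thus
    guarantees that the orbit has not yet reached 0. *)
Lemma limsup_set_prefix r h tau n x :
  (0 < r)%N -> limsup_set r tau h x -> exists N, [/\ (n <= N)%N &
  exists w, [/\ posw w, size w = N, exists2 y, 0 < y < 1 & x = cfrac w y &
    expR (tau x * cfsum h w (iter N gauss x)) <= (digit_prod r (iter N gauss x))%:R]].
Proof.
move=> r0 [x01 /(_ n)[N nN HN]]; exists N; split=> //.
have E : (\prod_(1 <= i < r.+1) pquot (N + i) x = digit_prod r (iter N gauss x))%N.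
  rewrite /digit_prod [LHS]big_nat [RHS]big_nat.
  by apply: eq_bigr => i /andP[i0 _]; rewrite pquotD.
rewrite E in HN; have y01 := iter_gauss_itv N x01.
have y0 : 0 < iter N gauss x.
  have /andP[y0 _] := y01; rewrite lt_neqAle y0 andbT; apply/eqP => y0'.
  move: HN; case: r r0 E => // r _ _; rewrite digit_prodS -y0'.
  by rewrite /pquot /= invr0 truncn0 mul0n leNgt expR_gt0.
have y0' : 0 < iter N gauss x < 1 by have /andP[_ ->] := y01; rewrite y0.
have [w [pw sw E']] := cfrac_expansion x01 y0.
exists w; split=> //; first by exists (iter N gauss x).
by move: HN; rewrite {2}E' -sw ergsum_cfrac// sw.
Qed.

Context (h : R -> R) (tau : R -> R) (m : R).
Hypothesis h_gt0 : forall x, x \in `[0, 1] -> 0 < h x.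
Hypothesis m_ge0 : 0 <= m.
Hypothesis tau_ge : forall x, x \in `[0, 1] -> m <= tau x.

Lemma geometric_le (q : R) N K : 0 <= q < 1 ->
  \sum_(n <- iota N K) q ^+ n <= q ^+ N / (1 - q).
Proof.
move=> /andP[q0 q1]; have q1' : 0 < 1 - q by rewrite subr_gt0.
elim: K N => [|K IH] N.
  by rewrite big_nil divr_ge0 ?exprn_ge0// ltW.
rewrite big_cons; apply: (le_trans (lerD (lexx _) (IH _))).
by rewrite le_eqVlt; apply/orP; left; apply/eqP; rewrite exprS; field; rewrite gt_eqF.
Qed.

(* Since [h] and [tau] are positive, the event at [x = [w + y]] forces the
   product of the next [r] digits above [exp (m * inf S_n h)], where the
   infimum is over the cylinder of [w]: no distortion estimate is needed. *)
Lemma hausdorff_measure_limsup_set r s1 s : 0 <= s1 -> s1 < s -> s < 1 ->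
  (forall e, 0 < e -> exists N, forall n, (N <= n)%N -> forall M,
     wsum h (g_fun r.+1 s1 * m) s1 M n <= expR (e * n%:R)) ->
  hausdorff_measure s (limsup_set r.+1 tau h) = 0%E.
Proof.
move=> s10 s1s s_lt1 Hw.
have s0 : 0 < s by apply: le_lt_trans s1s.
have s01 : 0 < s < 1 by rewrite s0.
have [C C0 cover] := digit_prod_cover r s01.
pose bound w := expR (m * hinf h w).
have b0 w : 0 < bound w by exact: expR_gt0.
have /choice[l Hl] : forall w, exists l : seq (seq nat * R), posw w ->
  [/\ forall y, 0 <= y < 1 -> bound w <= (digit_prod r.+1 y)%:R ->
        exists2 p, p \in l & exists2 z, 0 <= z <= p.2 & cfrac w y = cfrac p.1 z,
      forall p, p \in l -> [/\ posw p.1, 0 <= p.2 <= 1 & clen p.1 * p.2 <= clen w] &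
      \sum_(p <- l) (clen p.1 * p.2) `^ s <= C * clen w `^ s * bound w `^ (- g_fun r.+1 s)].
  move=> w; have [pw|npw] := boolP (posw w); last by exists [::].
  by have [l Hl] := cover w _ pw (b0 w); exists l.
have ss : 0 < s - s1 by rewrite subr_gt0.
(* Cylinders of order n have length at most 2 * 2^(-n), so passing from [s1] to [s] gains exp(-2 e
   n). One half absorbs the growth exp(e n) of the weights, the other half leaves a geometric series
   of ratio [q]. *)
pose e := (s - s1) * ln 2 / 2.
have e0 : 0 < e by rewrite divr_gt0// mulr_gt0// ln_gt0// ltr1n.
have [N0 HN0] := Hw _ e0.
pose q := expR (- e).
have q01 : 0 <= q < 1 by rewrite expR_ge0 expR_lt1 oppr_lt0.
pose D := C * 2 `^ (s - s1).
have D0 : 0 < D by rewrite mulr_gt0// powR_gt0.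
have cost w : posw w -> \sum_(p <- l w) (clen p.1 * p.2) `^ s <=
    D * (q ^+ 2) ^+ size w * weight h (g_fun r.+1 s1 * m) s1 w.
  move=> pw; have [_ _ l3] := Hl w pw; apply: (le_trans l3).
  have cw := @clen_gt0 R _ pw.
  rewrite -!mulrA ler_wpM2l ?(ltW C0)//.
  rewrite {1}(_ : s = s1 + (s - s1)); last by rewrite addrC subrK.
  rewrite powRD; last by rewrite (gt_eqF cw) implybT.
  have h1 : clen w `^ (s - s1) <= 2 `^ (s - s1) * (q ^+ 2) ^+ size w.
    apply: (le_trans (ler_powR_base (ltW ss) (ltW cw) (clen_rate pw))).
    rewrite powRM ?exprn_ge0 ?invr_ge0// ler_wpM2l ?powR_ge0//.
    rewrite -exprM /q -expRM_natl /powR gt_eqF ?exprn_gt0 ?invr_gt0//.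
    rewrite ler_expR lnXn ?invr_gt0// lnV ?posrE// /e -mulr_natl natrM.
    by rewrite le_eqVlt; apply/orP; left; apply/eqP; field.
  have h2 : bound w `^ (- g_fun r.+1 s) <= expR (- (g_fun r.+1 s1 * m) * hinf h w).
    rewrite /bound -expRM ler_expR.
    have gg := @g_fun_mono r.+1 s1 s s10 (ltW s1s) (ltW s_lt1).
    have := mulr_ge0 m_ge0 (hinf_ge0 h_gt0 pw); nra.
  rewrite /weight [leRHS](_ : _ = 2 `^ (s - s1) * (q ^+ 2) ^+ size w *
      (clen w `^ s1 * expR (- (g_fun r.+1 s1 * m) * hinf h w))); last ring.
  rewrite [leLHS](_ : _ = clen w `^ (s - s1) *
      (clen w `^ s1 * bound w `^ (- g_fun r.+1 s))); last ring.
  apply: ler_pM; rewrite ?powR_ge0 ?mulr_ge0 ?powR_ge0//.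
  by rewrite ler_wpM2l ?powR_ge0.
apply: hausdorff_measure_eq0 => d e1 d0 e10.
have [N [N0N Nd Ne]] : exists N, [/\ (N0 <= N)%N, 2 * 2^-1 ^+ N <= d &
    D * (q ^+ N / (1 - q)) <= e1].
  have [N1 HN1] := half_pow_small d0.
  have c2 : (D * (q ^+ n / (1 - q)) : R) @[n --> \oo] --> (D * (0 / (1 - q)) : R).
    apply: cvgM; first exact: cvg_cst.
    apply: cvgM; last exact: cvg_cst.
    by have /andP[q0 q1] := q01; apply: cvg_expr; rewrite ger0_norm.
  move/cvgrPdist_le/(_ _ e10) : c2 => c2.
  have [N [[n1 n2] n3]] := filter_ex (filterI (filterI (nbhs_infty_ge N1) c2) (nbhs_infty_ge N0)).
  exists N; split=> //; first exact/ltW/HN1.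
  by move: n2; rewrite mul0r mulr0 sub0r normrN; apply: le_trans; exact: ler_norm.
(* The cover is indexed by a word and a position in its list of intervals; all other indices give
   the empty set, with cost 0 to the power [s], which is 0 as [s > 0]. *)
pose ok (i : seq nat * nat) := [&& (N <= size i.1)%N, posw i.1 & (i.2 < size (l i.1))%N].
pose pr (i : seq nat * nat) := nth ([::], 0) (l i.1) i.2.
pose U i := if ok i then [set cfrac (pr i).1 z | z in `[0, (pr i).2]] else set0.
pose c i := if ok i then clen (pr i).1 * (pr i).2 else 0.
apply: (@hausdorff_premeasure_le _ _ U c).
- exact: ltW.
- move=> x Rx; have [K [NK [w [pw sw [y y01 Ex] Hx]]]] := limsup_set_prefix N (ltn0Sn r) Rx.
  have y01' : 0 <= y < 1 by have /andP[/ltW-> ->] := y01.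
  have yE : iter K gauss x = y by rewrite Ex -sw iter_gauss_cfrac.
  rewrite yE in Hx.
  have By : bound w <= (digit_prod r.+1 y)%:R.
    apply: le_trans Hx; rewrite ler_expR.
    have y01'' : 0 <= y <= 1 by have /andP[/ltW-> /ltW->] := y01.
    apply: ler_pM => //; first exact: hinf_ge0.
      by apply: tau_ge; rewrite in_itv /= Ex cfrac_itv.
    exact: hinf_le.
  have [l1 _ _] := Hl w pw; have [p pl [z z0 E]] := l1 y y01' By.
  exists (w, index p (l w)) => //.
  have okw : ok (w, index p (l w)) by rewrite /ok /= sw NK pw index_mem pl.
  rewrite /U okw; exists z; first by rewrite /pr /= nth_index// in_itv.
  by rewrite /pr /= nth_index// Ex E.
- move=> i [x]; rewrite /U /c; case: ifP => // /and3P[Ni pi il] _.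
  have [_ l2 _] := Hl _ pi.
  have [p1 /andP[p20 p21] p3] := l2 (pr i) (mem_nth _ il); split.
    apply: diam_le => _ _ [z /= + <-] [z' /= + <-].
    rewrite !in_itv /= => /andP[z0 z1] /andP[z'0 z'1].
    have zz : 0 <= z <= 1 by rewrite z0 (le_trans z1).
    have zz' : 0 <= z' <= 1 by rewrite z'0 (le_trans z'1).
    have /andP[_ H] := cylinder_dist p1 zz zz'; apply: (le_trans H).
    by rewrite (ler_wpM2l (ltW (@clen_gt0 R _ p1)))// ler_norml; lra.
  apply: (le_trans p3); apply: le_trans Nd; apply: (le_trans (clen_rate pi)).
  rewrite ler_wpM2l// !exprVn lef_pV2 ?posrE ?exprn_gt0//.
  by rewrite ler_eXn2l ?ltr1n.
- move=> F uF.
  have [M HM] := words_exhaust [seq i.1 | i <- F].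
  pose K := (\max_(i <- F) size i.1).+1.
  pose G := [seq (w, j) | w <- flatten [seq words M n | n <- iota N K],
                          j <- iota 0 (size (l w))].
  have E : \sum_(i <- F) c i `^ s = \sum_(i <- [seq i <- F | ok i]) c i `^ s.
    rewrite big_filter [RHS]big_mkcond; apply: eq_bigr => i _.
    by rewrite /c; case: ifP => // _; rewrite powR0 ?gt_eqF.
  rewrite E; apply: (@le_trans _ _ (\sum_(i <- G) c i `^ s)).
    apply: ler_sum_uniq => [|i|i _]; [exact: filter_uniq| |exact: powR_ge0].
    rewrite mem_filter => /andP[/and3P[Ni pi il] iF].
    apply/allpairsPdep; exists i.1, i.2; rewrite mem_iota il; split=> //; last by case: (i).
    apply/flattenP; exists (words M (size i.1)); last first.
      by apply: HM => //; exact: map_f.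
    apply: map_f; rewrite mem_iota Ni /= ltn_addl// ltnS.
    exact: (leq_bigmax_seq _ iF isT).
  rewrite /G big_allpairs_dep big_flatten big_map.
  apply: (@le_trans _ _ (\sum_(n <- iota N K) D * q ^+ n)); last first.
    by rewrite -mulr_sumr (le_trans _ Ne)// ler_wpM2l ?(ltW D0)//; exact: geometric_le.
  rewrite big_seq [leRHS]big_seq; apply: ler_sum => n; rewrite mem_iota => /andP[Nn _].
  apply: (@le_trans _ _ (\sum_(w <- words M n)
      D * (q ^+ 2) ^+ n * weight h (g_fun r.+1 s1 * m) s1 w)).
    rewrite big_seq [leRHS]big_seq; apply: ler_sum => w wn.
    have pw := words_posw wn; have sw := words_size wn.
    rewrite -sw; apply: le_trans (cost w pw).
    rewrite (big_nth ([::], 0)) /index_iota subn0.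
    rewrite big_seq [leRHS]big_seq; apply: ler_sum => j; rewrite mem_iota => jl.
    by rewrite /c /ok /= sw Nn pw; have /= := jl; rewrite add0n => ->.
  rewrite -mulr_sumr -mulrA ler_wpM2l ?(ltW D0)//.
  have := HN0 n (leq_trans N0N Nn) M; rewrite /wsum.
  have -> : expR (e * n%:R) = (q ^+ n)^-1.
    by rewrite /q -expRM_natl -expRN mulrN opprK mulrC.
  have qn : 0 < q ^+ n by rewrite exprn_gt0// expR_gt0.
  move=> H; rewrite -exprM mul2n -addnn exprD -mulrA ler_piMr ?(ltW qn)//.
  by rewrite -ler_pdivlMl// mulr1.
Qed.

End UpperBound.

(** * Mass distribution on a tree of intervals *)

Section MassDistribution.
Context {R : realType} (X : eqType) (root : X) (ch : X -> seq (R * X)).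
Context (lo hi : X -> R) (inv : X -> Prop).
Implicit Types (x y : X) (n : nat) (U A : set R).

Fixpoint descendants n x : seq X :=
  if n is n'.+1 then flatten [seq descendants n' p.2 | p <- ch x] else [:: x].

Definition node_set x : set R := [set z | lo x <= z <= hi x].

Definition limit_set : set R :=
  [set z | forall n, exists2 y, y \in descendants n root & node_set y z].

(** The share of the mass of [x] carried by descendants of generation [n] that meet [U]: an upper
    approximation to the measure of [U]. *)
Fixpoint node_mass n x U : R :=
  if n is n'.+1 then \sum_(p <- ch x) p.1 * node_mass n' p.2 U
  else if `[< node_set x `&` U !=set0 >] then 1 else 0.

Hypothesis inv_root : inv root.
Hypothesis lo_hi : forall x, inv x -> lo x <= hi x.
Hypothesis chP : forall x p, inv x -> p \in ch x ->
  [/\ 0 <= p.1, inv p.2 & node_set p.2 `<=` node_set x].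
Hypothesis ch1 : forall x, inv x -> \sum_(p <- ch x) p.1 = 1.

Lemma descendantsD n k x :
  descendants (n + k) x = flatten [seq descendants k y | y <- descendants n x].
Proof.
elim: n x => [|n IH] x; first by rewrite /= cats0.
rewrite /= map_flatten -map_comp.
elim: (ch x) => [//|p l IHl] /=; by rewrite flatten_cat IHl IH.
Qed.

Lemma descendants_inv n x y : inv x -> y \in descendants n x ->
  inv y /\ node_set y `<=` node_set x.
Proof.
elim: n x => [|n IH] x ix /=; first by rewrite inE => /eqP->; split.
move=> /flattenP[l /mapP[p px ->]] yl; have [_ ip sp] := chP ix px.
by have [iy sy] := IH _ ip yl; split=> // z /sy/sp.
Qed.

Lemma node_mass_ge0 n x U : inv x -> 0 <= node_mass n x U.
Proof.
elim: n x => [|n IH] x ix /=; first by case: ifP.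
rewrite big_seq; apply: sumr_ge0 => p px; have [p0 ip _] := chP ix px.
by rewrite mulr_ge0// IH.
Qed.

Lemma node_mass_anti n x U : inv x -> node_mass n.+1 x U <= node_mass n x U.
Proof.
elim: n x => [|n IH] x ix.
  rewrite /=; case: ifPn => [_|nx].
    rewrite -[leRHS](ch1 ix) big_seq [leRHS]big_seq; apply: ler_sum => p px.
    by have [p0 ip _] := chP ix px; rewrite ler_piMr//; case: ifP.
  rewrite big_seq big1// => p px; have [p0 ip sp] := chP ix px.
  case: ifPn => [/asboolP[z [/sp zx Uz]]|]; last by rewrite mulr0.
  by move/asboolP: nx => []; exists z.
change (\sum_(p <- ch x) p.1 * node_mass n.+1 p.2 U <=
        \sum_(p <- ch x) p.1 * node_mass n p.2 U).
rewrite big_seq [leRHS]big_seq; apply: ler_sum => p px.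
by have [p0 ip _] := chP ix px; rewrite ler_wpM2l// IH.
Qed.

Lemma node_mass_le n m x U : inv x -> (n <= m)%N -> node_mass m x U <= node_mass n x U.
Proof.
move=> ix /subnKC<-; elim: (m - n)%N => [|k IH]; first by rewrite addn0.
by rewrite addnS; apply: le_trans IH; exact: node_mass_anti.
Qed.

Let next x : X := if ch x is p :: _ then p.2 else x.

Let next_ch x : inv x -> exists2 p, p \in ch x & next x = p.2.
Proof.
move=> ix; rewrite /next; have := ch1 ix.
case: (ch x) => [|p l _]; first by rewrite big_nil => /eqP; rewrite eq_sym oner_eq0.
by exists p => //; rewrite mem_head.
Qed.

Let nextP x : inv x -> [/\ inv (next x), node_set (next x) `<=` node_set x &
  next x \in descendants 1 x].
Proof.
move=> ix; have [p px ->] := next_ch ix; have [_ ip sp] := chP ix px; split=> //.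
rewrite /= ; apply/flattenP; exists [:: p.2]; last by rewrite mem_head.
by apply/mapP; exists p.
Qed.

Let iter_nextP k x : inv x -> [/\ inv (iter k next x),
  (forall j, (j <= k)%N -> node_set (iter k next x) `<=` node_set (iter j next x)) &
  iter k next x \in descendants k x].
Proof.
move=> ix; elim: k => [|k [ik sk dk]].
  by split=> // [j|]; [rewrite leqn0 => /eqP->|rewrite mem_head].
have [i' s' d'] := nextP ik; split => //.
  move=> j; rewrite leq_eqVlt => /orP[/eqP->//|jk] z /s'; exact: sk.
by rewrite iterS -[k.+1]addn1 descendantsD; apply/flattenP; exists (descendants 1 (iter k next x)) => //; apply: map_f.
Qed.

(** Following first children gives nested closed intervals; the supremum of their lower ends lies in
    all of them. *)
Lemma node_limit m y : y \in descendants m root ->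
  exists z, node_set y z /\ limit_set z.
Proof.
move=> yd; have [iy _] := descendants_inv inv_root yd.
pose S := [set lo (iter k next y) | k in [set: nat]].
have ub j k : lo (iter j next y) <= hi (iter k next y).
  have [i sj _] := iter_nextP (maxn j k) iy.
  have L := lo_hi i; set w := iter (maxn j k) next y in i sj L.
  have /(_ (lo w)) := sj j (leq_maxl _ _); have /(_ (hi w)) := sj k (leq_maxr _ _).
  rewrite /node_set /= !lexx L => /(_ isT)/andP[_ h1] /(_ isT)/andP[h2 _].
  exact: le_trans (le_trans h2 L) h1.
have S0 : S !=set0 by exists (lo y), 0%N.
have Sk k : node_set (iter k next y) (sup S).
  apply/andP; split.
    by apply: ub_le_sup; [exists (hi y) => _ [j _ <-]; exact: (ub j 0%N)|exists k].
  by apply: ge_sup => // _ [j _ <-].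
exists (sup S); split; first exact: (Sk 0%N).
move=> n; have [mn|nm] := leqP m n.
  exists (iter (n - m) next y) => //.
  rewrite -(subnKC mn) descendantsD addnC addnK; apply/flattenP.
  exists (descendants (n - m) y); first exact: map_f.
  by have [] := iter_nextP (n - m) iy.
move: yd; rewrite -(subnKC (ltnW nm)) descendantsD => /flattenP[l /mapP[x xd ->] yx].
exists x => //; have [ix _] := descendants_inv inv_root xd.
by have [_] := descendants_inv ix yx; apply; exact: (Sk 0%N).
Qed.

Lemma limit_set_compact : compact limit_set.
Proof.
pose F n := [set z | exists2 y, y \in descendants n root & node_set y z].
apply: (@subclosed_compact _ _ `[lo root, hi root]); last 2 first.
- exact: segment_compact.
- by move=> z /(_ 0%N)[y]; rewrite inE => /eqP-> ; rewrite /= in_itv.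
have -> : limit_set = \bigcap_n F n.
  by apply/seteqP; split=> [z zK n _|z zK n]; [exact: zK|exact: zK].
apply: closed_bigI => n _; rewrite /F.
elim: (descendants n root) => [|y l IH].
  rewrite [X in closed X](_ : _ = set0); first exact: closed0.
  by apply/seteqP; split=> // z [y].
rewrite [X in closed X](_ : _ = node_set y `|` [set z | exists2 y, y \in l & node_set y z]).
  apply: closedU => //; have -> : node_set y = `[lo y, hi y]%classic.
    by apply/seteqP; split=> z /=; rewrite in_itv.
  exact: itv_closed.
apply/seteqP; split=> z.
  by move=> [x]; rewrite inE => /orP[/eqP->|xl] zx; [left|right; exists x].
move=> [zy|[x xl zx]]; first by exists y => //; rewrite mem_head.
by exists x => //; rewrite inE xl orbT.
Qed.

(** At depth 0 each node contains a limit point, hence meets some [V i]; the weights of the children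
    sum to 1, which preserves the bound at greater depth. *)
Lemma node_mass_cover (V : nat -> set R) N : (forall z, limit_set z ->
    exists2 i, (i < N)%N & V i z) ->
  forall n m y, y \in descendants m root -> 1 <= \sum_(i < N) node_mass n y (V i).
Proof.
move=> cov; elim=> [|n IH] m y yd.
  have [z [yz Kz]] := node_limit yd; have [i iN Vz] := cov z Kz.
  have [iy _] := descendants_inv inv_root yd.
  rewrite (bigD1 (Ordinal iN))//= asboolT; last by exists z.
  rewrite lerDl; apply: sumr_ge0 => j _; exact: (@node_mass_ge0 0).
rewrite /= exchange_big /=; have [iy _] := descendants_inv inv_root yd.
rewrite -[leLHS](ch1 iy) big_seq [leRHS]big_seq; apply: ler_sum => p py.
have [p0 _ _] := chP iy py; rewrite -mulr_sumr ler_peMr//.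
apply: (IH m.+1); rewrite -addn1 descendantsD; apply/flattenP.
exists (descendants 1 y); first exact: map_f.
rewrite /=; apply/flattenP; exists [:: p.2]; last by rewrite mem_head.
by apply/mapP; exists p.
Qed.

(** Node masses are only finitely subadditive at a given depth. The sets of a cheap cover are
    therefore enlarged to open ones, and a finite subcover of the compact limit set is compared at a
    common depth. *)
Lemma mass_distribution (s C : R) A : 0 < s -> 0 < C ->
  (forall U d, 0 < d -> (forall a b, U a -> U b -> `|a - b| <= d) ->
    exists n, node_mass n root U <= C * d `^ s) ->
  limit_set `<=` A -> hausdorff_measure s A <> 0%E.
Proof.
move=> s0 C0 mass KA HA.
(* Enlarged sets have diameter at most 4 max(d, eta), whose power is at most 4^s (d^s + eta^s). The
   masses then total less than C 4^s (e + e) = 1/2, against the lower bound 1. *)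
pose e := (4 * C * 4 `^ s)^-1.
have e0 : 0 < e by rewrite invr_gt0 !mulr_gt0// powR_gt0.
have H : (hausdorff_premeasure s 1 A < e%:E)%E.
  apply: (@le_lt_trans _ _ 0%E); last by rewrite lte_fin.
  by rewrite -HA; apply: ereal_sup_ubound; exists 1 => //=.
have [_ [U [AU Ud] <-] Ue] := ereal_inf_lt H.
(* The powers [eta i] to the [s] sum to less than [e], and [eta i > 0] also covers sets of diameter
   0. *)
pose eta i := (e / 2 ^+ i.+1) `^ s^-1.
have eta0 i : 0 < eta i by rewrite powR_gt0// divr_gt0// exprn_gt0.
have etas i : eta i `^ s = e / 2 ^+ i.+1.
  by rewrite /eta -powRrM mulVf ?gt_eqF// powRr1// divr_ge0// ?ltW// exprn_ge0.
pose d i := fine (diam (U i)).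
have dE i : U i !=set0 -> diam (U i) = (d i)%:E /\ 0 <= d i.
  move=> U0; have D0 := diam_ge0 U0; have := Ud i; rewrite /d.
  by case: (diam (U i)) D0.
have /choice[V HV] : forall i, exists V : set R, [/\ open V, U i `<=` V &
    U i !=set0 /\ (forall a b, V a -> V b -> `|a - b| <= 2 * (d i + eta i)) \/
    U i = set0 /\ V = set0].
  move=> i; have [U0|/set0P U0] := eqVneq (U i) set0.
    by exists set0; split; [exact: open0|rewrite U0|right].
  have [dEi d0] := dE i U0; have [x0 Ux0] := U0.
  exists (ball x0 (d i + eta i)); split.
  - by apply: ball_open; rewrite ltr_wpDl.
  - move=> x Ux; rewrite /ball /=; have := le_diam Ux0 Ux.
    by rewrite dEi lee_fin => /le_lt_trans; apply; rewrite ltrDl.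
  - left; split=> // x y; rewrite /ball /= => h1 h2.
    by have := ler_distD x0 x y; rewrite (distrC x x0); lra.
have [N HN] : exists N, forall z, limit_set z -> exists2 i, (i < N)%N & V i z.
  have := limit_set_compact; rewrite compact_cover => /(_ nat setT V).
  case=> [i _|z /KA/AU[i _ Uz]|D _ KD].
  - by have [] := HV i.
  - by exists i => //; have [_ + _] := HV i; apply.
  - exists (\max_(i <- finmap.enum_fset D) i).+1 => z /KD[i /= iD Vz].
    by exists i => //; rewrite ltnS; exact: (leq_bigmax_seq _ iD isT).
pose b i := if `[< U i !=set0 >] then C * (4 `^ s * (d i `^ s + eta i `^ s)) else 0.
have /choice[n Hn] : forall i, exists n, node_mass n root (V i) <= b i.
  move=> i; have [_ _ [[U0 Vd]|[U0 V0]]] := HV i; rewrite /b; last first.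
    exists 0%N; rewrite /= V0 U0 asboolF; last by move=> [z []].
    by rewrite asboolF// => -[].
  have [_ d0] := dE i U0; rewrite asboolT//.
  have de : 0 < 2 * (d i + eta i) by rewrite mulr_gt0// ltr_wpDl.
  have [n Hn] := mass _ _ de Vd; exists n; apply: (le_trans Hn).
  rewrite ler_wpM2l ?(ltW C0)//.
  pose M := Num.max (d i) (eta i).
  have M0 : 0 <= M by rewrite le_max d0.
  apply: (@le_trans _ _ ((4 * M) `^ s)).
    apply: ler_powR_base; [exact: ltW|exact: ltW|].
    have : d i <= M by rewrite le_max lexx.
    have : eta i <= M by rewrite le_max lexx orbT.
    lra.
  rewrite powRM// ler_wpM2l ?powR_ge0//.
  by rewrite /M; case: (leP (d i) (eta i)) => _; rewrite ?lerDl ?lerDr powR_ge0.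
pose L := \max_(i < N) n i.
have := node_mass_cover HN L (mem_head root [::] : root \in descendants 0 root).
apply/negP; rewrite -ltNge.
apply: (@le_lt_trans _ _ (\sum_(i < N) b i)).
  apply: ler_sum => i _; apply: le_trans (Hn i); apply: node_mass_le => //.
  exact: (leq_bigmax i).
apply: (@le_lt_trans _ _ (C * 4 `^ s * (\sum_(i < N | `[< U i !=set0 >]) d i `^ s +
    \sum_(i < N) eta i `^ s))).
  rewrite mulrDr !mulr_sumr [X in _ <= X + _]big_mkcond -big_split /=.
  apply: ler_sum => i _; rewrite /b; case: ifP => _.
    by rewrite -mulrDr mulrA.
  by rewrite add0r !mulr_ge0 ?powR_ge0 ?(ltW C0).
have l1 : \sum_(i < N | `[< U i !=set0 >]) d i `^ s <= e.
  rewrite -lee_fin; apply: le_trans (ltW Ue).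
  apply: (@le_trans _ _ (\sum_(0 <= i < N | U i != set0) poweR (diam (U i)) s)%E); last first.
    by apply: nneseries_lim_ge => i _ _; exact: poweR_ge0.
  rewrite -sumEFin big_mkord [leRHS](eq_bigl (fun i : 'I_N => `[< U i !=set0 >])).
    apply: lee_sum => i /asboolP U0; have [-> _] := dE i U0.
    by rewrite poweR_EFin.
  by move=> i; apply/idP/idP => [/set0P/asboolP|/asboolP/set0P].
have l2 : \sum_(i < N) eta i `^ s < e.
  have -> : \sum_(i < N) eta i `^ s = e * (1 - (2 ^+ N)^-1).
    elim: (N) => [|k IH]; first by rewrite big_ord0 expr0 invr1 subrr mulr0.
    rewrite big_ord_recr /= IH etas exprS; field.
    by rewrite expf_neq0.
  by rewrite gtr_pMr// ltrBlDr ltrDl invr_gt0 exprn_gt0.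
have P : 0 < C * 4 `^ s by rewrite mulr_gt0// powR_gt0.
apply: (@lt_le_trans _ _ (C * 4 `^ s * (e + e))).
  by rewrite ltr_pM2l// ler_ltD.
have -> : C * 4 `^ s * (e + e) = 2^-1.
  by rewrite /e; field; rewrite !gt_eqF ?powR_gt0.
lra.
Qed.

End MassDistribution.

(** * Gaps between cylinders *)

Section CylinderIntervals.
Context {R : realType}.
Implicit Types (w b : seq nat) (y z v : R).

(** The end points of the set of all [w + y] with 0 <= y <= v, in increasing order: the swap
    accounts for each digit reversing the orientation. *)
Fixpoint cyl_itv v w : R * R :=
  if w is k :: w' then
    ((k%:R + (cyl_itv v w').2)^-1, (k%:R + (cyl_itv v w').1)^-1)
  else (0, v).

Lemma cyl_itv_ge0 v w : posw w -> 0 <= v ->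
  0 <= (cyl_itv v w).1 <= (cyl_itv v w).2.
Proof.
move=> + v0; elim: w => [|k w IH] /=; first by rewrite lexx.
move=> /andP[k0 /IH/andP[l0 lu]]; have k0' : 0 < k%:R :> R by rewrite ltr0n.
have u0 : 0 <= (cyl_itv v w).2 by apply: le_trans lu.
rewrite invr_ge0 addr_ge0 ?(ltW k0')//= lef_pV2 ?posrE ?ltr_wpDr//.
by rewrite lerD2l.
Qed.

Lemma cyl_itvP v w z : posw w -> 0 <= v ->
  (cyl_itv v w).1 <= z <= (cyl_itv v w).2 <->
  exists2 y, 0 <= y <= v & z = cfrac w y.
Proof.
move=> + v0; elim: w z => [|k w IH] z.
  by split=> [zv|[y yv ->]//]; exists z.
move=> /[dup] pkw /andP[k0 pw]; have k0' : 0 < k%:R :> R by rewrite ltr0n.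
have /andP[l0 lu] := cyl_itv_ge0 pw v0.
have u0 : 0 <= (cyl_itv v w).2 by apply: le_trans lu.
have L : 0 < k%:R + (cyl_itv v w).1 by rewrite ltr_wpDr.
have U : 0 < k%:R + (cyl_itv v w).2 by rewrite ltr_wpDr.
split=> /= [/andP[z1 z2]|[y yv zE]].
  have z0 : 0 < z by apply: lt_le_trans z1; rewrite invr_gt0.
  have /IH-/(_ pw)[y yv E] : (cyl_itv v w).1 <= z^-1 - k%:R <= (cyl_itv v w).2.
    rewrite lerBrDl lerBlDl -[X in X <= _]invrK -[X in _ && (_ <= X)]invrK.
    by rewrite !lef_pV2 ?posrE ?invr_gt0// z2 z1.
  by exists y => //; rewrite cfrac_cons -E addrC subrK invrK.
have /(IH _ pw)/andP[h1 h2] : exists2 y', 0 <= y' <= v & cfrac w y = cfrac w y' by exists y.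
have Y : 0 < k%:R + cfrac w y by rewrite ltr_wpDr// (le_trans l0).
by rewrite zE cfrac_cons !lef_pV2 ?posrE// !lerD2l h1 h2.
Qed.

Lemma cfrac_itvoo_size2 w y : posw w -> (1 < size w)%N -> 0 <= y <= 1 -> 0 < cfrac w y < 1.
Proof.
case: w => [//|k [//|l w]] /[dup] pw /andP[k0 pw'] _ y01.
have Z := cfrac_gt0 pw' y01; rewrite cfrac_gt0//= cfrac_cons.
have k1 : 1 <= k%:R :> R by rewrite ler1n.
by rewrite invf_lt1; lra.
Qed.

Context (M : nat).
(** If another digit at most M follows, the tail is at least 1/(M+1), and the value at most 1/(1 +
    1/(M+1)) = 1 - 1/(M+2). After a last digit at least 2 it is at most 1/2. Hence tame words map
    [0, v] into itself. *)
Let v : R := 1 - M.+2%:R^-1.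

Let th01 : 0 < (M.+2%:R^-1 : R) <= 2^-1.
Proof. by rewrite invr_gt0 ltr0n/= lef_pV2 ?posrE// ?ltr0n// ler_nat. Qed.

(** The default 2 of [last] makes the empty word tame, so that tameness passes to all tails. *)
Definition tame b := all (fun d => 0 < d <= M)%N b && (1 < last 2 b)%N.

Lemma tame_posw b : tame b -> posw b.
Proof. by move=> /andP[/allP ab _]; apply/allP => d /ab/andP[]. Qed.

Lemma tame_cons d b : tame (d :: b) -> tame b.
Proof.
rewrite /tame => /andP[/= /andP[_ ->]] /=; by case: b.
Qed.

Lemma tame_cfrac b y : tame b -> 0 <= y <= v -> 0 <= cfrac b y <= v.
Proof.
have /andP[th0 th1] := th01.
case: b => [//|d [|d' b]] tb yv.
  have d2 : (1 < d)%N by case/andP: tb.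
  have d2' : 2 <= d%:R :> R by rewrite ler_nat.
  have /andP[y0 _] := yv.
  have D : 2 <= d%:R + y by rewrite (le_trans d2')// lerDl.
  rewrite cfrac_cons /cfrac /= invr_ge0 (le_trans _ D)//=.
  have hv : 2^-1 <= v by rewrite /v lerBrDr -lerBrDl (le_trans th1)//; lra.
  apply: le_trans hv.
  by rewrite lef_pV2 ?posrE//; exact: lt_le_trans D.
have pb := tame_posw tb; have pb' := tame_posw (tame_cons tb).
have y01 : 0 <= y <= 1 by case/andP: yv => -> /= /le_trans; apply; rewrite /v gerBl ltW.
have Z := cfrac_itv pb y01; have /andP[-> _] := Z.
have /andP[/= /and3P[/andP[d0 _] /andP[d'0 d'M] _] _] := tb.
have pw : posw b by case/andP: pb'.
have /andP[w0 w1] := cfrac_itv pw y01.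
rewrite cfrac_cons; set z := cfrac (d' :: b) y.
have zz : M.+1%:R^-1 <= z.
  rewrite /z cfrac_cons lef_pV2 ?posrE ?ltr_wpDr ?ltr0n//.
  by rewrite -natr1 lerD// ler_nat.
have d1 : 1 <= d%:R :> R by rewrite ler1n.
have M1 : 0 < M.+1%:R :> R by rewrite ltr0n.
apply: (@le_trans _ _ (1 + M.+1%:R^-1)^-1).
  have M1' : 0 < M.+1%:R^-1 :> R by rewrite invr_gt0.
  have D1 : 0 < 1 + M.+1%:R^-1 :> R by rewrite addr_gt0.
  have D2 : 0 < d%:R + z.
    by rewrite ltr_wpDr ?(le_trans (ltW M1') zz)// (lt_le_trans ltr01).
  by rewrite lef_pV2 ?posrE//; exact: lerD.
rewrite /v -natr1 le_eqVlt; apply/orP; left; apply/eqP; field.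
by rewrite !gt_eqF//=; lra.
Qed.

(** At the first place where the words differ, tails in [0, v] leave a gap of at least 1 - v between
    the denominators; each inversion shrinks distances by a factor at least (M+1)^(-2). *)
Lemma tame_gap b b' y y' : tame b -> tame b' -> size b = size b' -> b <> b' ->
  0 <= y <= v -> 0 <= y' <= v ->
  M.+2%:R^-1 * M.+1%:R^-1 ^+ 2 ^+ size b <= `|cfrac b y - cfrac b' y'|.
Proof.
have /andP[th0 th1] := th01.
move=> + + + + yv y'v; elim: b b' => [|d b IH] [|d' b']//.
move=> tb tb' /= [ss] bb'.
have := tame_cfrac (tame_cons tb) yv; have := tame_cfrac (tame_cons tb') y'v.
have {IH} := IH b' (tame_cons tb) (tame_cons tb') ss.
rewrite !cfrac_cons; set z := cfrac b y; set z' := cfrac b' y'.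
move=> IH /andP[z'0 z'v] /andP[z0 zv].
have /andP[/= /andP[/andP[d0 dM] _] _] := tb.
have /andP[/= /andP[/andP[d'0 d'M] _] _] := tb'.
have d0' : 0 < d%:R :> R by rewrite ltr0n.
have d'0' : 0 < d'%:R :> R by rewrite ltr0n.
have dM' : d%:R <= M%:R :> R by rewrite ler_nat.
have d'M' : d'%:R <= M%:R :> R by rewrite ler_nat.
have v1 : v <= 1 by rewrite /v gerBl ltW.
have D : 0 < d%:R + z by rewrite ltr_wpDr.
have D' : 0 < d'%:R + z' by rewrite ltr_wpDr.
have MS : M.+1%:R = M%:R + 1 :> R by rewrite natr1.
have M1 : 0 < M.+1%:R :> R by rewrite ltr0n.
have -> : (d%:R + z)^-1 - (d'%:R + z')^-1 =
    (d'%:R + z' - (d%:R + z)) * ((d%:R + z)^-1 * (d'%:R + z')^-1).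
  by field; rewrite !gt_eqF.
have DD : M.+1%:R^-1 ^+ 2 <= (d%:R + z)^-1 * (d'%:R + z')^-1.
  have z1 := le_trans zv v1; have z'1 := le_trans z'v v1.
  by rewrite expr2; apply: ler_pM; rewrite ?invr_ge0 ?(ltW M1)// lef_pV2 ?posrE//; lra.
have P : 0 < (d%:R + z)^-1 * (d'%:R + z')^-1 by rewrite mulr_gt0 ?invr_gt0.
rewrite normrM (gtr0_norm P).
have M2 : 0 <= M.+1%:R^-1 ^+ 2 :> R by rewrite exprn_ge0// invr_ge0 ltW.
have M21 : M.+1%:R^-1 ^+ 2 <= 1 :> R by rewrite exprn_ile1 ?invr_ge0 ?(ltW M1)// invf_le1// ler1n.
rewrite exprS [X in _ * X <= _]mulrC mulrA; apply: ler_pM => //.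
have [dd'|dd'] := eqVneq d d'.
  rewrite -dd' opprD addrACA subrr add0r distrC; apply: IH.
  by move=> bE; apply: bb'; rewrite dd' bE.
apply: (@le_trans _ _ M.+2%:R^-1).
  by rewrite ler_piMr ?(ltW th0)// exprn_ile1.
have vE : v = 1 - M.+2%:R^-1 by [].
rewrite vE in zv z'v.
move: zv z'v th0; move: (M.+2%:R^-1) => th zv z'v th0.
move: dd'; rewrite neq_ltn => /orP[lt|lt].
  have lt' : d%:R + 1 <= d'%:R :> R by rewrite natr1 ler_nat.
  by apply: le_trans (ler_norm _); lra.
have lt' : d'%:R + 1 <= d%:R :> R by rewrite natr1 ler_nat.
by rewrite -normrN; apply: le_trans (ler_norm _); lra.
Qed.

End CylinderIntervals.

Lemma digit_prod_cfrac {R : realType} (e : seq nat) (y : R) : posw e -> 0 < y < 1 ->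
  digit_prod (size e) (cfrac e y) = (\prod_(d <- e) d)%N.
Proof.
move=> + y01; elim: e => [|d e IH] pe; first by rewrite /digit_prod big_geq// big_nil.
have /andP[d0 pe'] := pe.
have zz : 0 <= cfrac e y < 1 by have /andP[/ltW-> ->] := cfrac_itvoo pe' y01.
rewrite [size _]/= digit_prodS cfrac_cons pquot_invD// gauss_invD// IH//.
by rewrite big_cons.
Qed.

(** The bound grows with the difference of the digits, as needed for sets that meet many
    neighbouring large digits. It uses up - lo >= 1 to turn the loss 1 - th into a factor th;
    denominators are at most 3 N. *)
Lemma cfrac1_gap {R : realType} (lo up : nat) (N th y y' : R) :
  (0 < lo < up)%N -> 1 <= N -> lo%:R <= 2 * N -> up%:R <= 2 * N -> 0 < th ->
  0 <= y <= 1 - th -> 0 <= y' <= 1 ->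
  th * (up%:R - lo%:R) / (9 * N ^+ 2) <= `|cfrac [:: lo] y - cfrac [:: up] y'|.
Proof.
move=> /andP[lo0 lu] N1 loN upN th0 /andP[y0 y1] /andP[y'0 y'1].
rewrite !cfrac_cons /cfrac /=.
have lo0' : 0 < lo%:R :> R by rewrite ltr0n.
have up0' : 0 < up%:R :> R by rewrite ltr0n (ltn_trans lo0).
have lu' : lo%:R + 1 <= up%:R :> R by rewrite natr1 ler_nat.
have Y : 0 < lo%:R + y by lra.
have Y' : 0 < up%:R + y' by lra.
have N0 : 0 < N by lra.
apply: le_trans (ler_norm _).
have -> : (lo%:R + y)^-1 - (up%:R + y')^-1 =
    (up%:R + y' - (lo%:R + y)) * ((lo%:R + y)^-1 * (up%:R + y')^-1).
  by field; rewrite !gt_eqF.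
apply: ler_pM; rewrite ?invr_ge0 ?mulr_ge0 ?exprn_ge0 ?(ltW N0)//; try lra.
  by have := @ler_wpM2r _ (up%:R - lo%:R - 1) _ th 1; nra.
rewrite (_ : 9 * N ^+ 2 = (3 * N) * (3 * N)); last ring.
rewrite invfM; apply: ler_pM; rewrite ?invr_ge0 ?mulr_ge0 ?(ltW N0)//.
  by rewrite lef_pV2 ?posrE ?mulr_gt0//; lra.
by rewrite lef_pV2 ?posrE ?mulr_gt0//; lra.
Qed.

(** * The Cantor set *)

Section CantorTree.
Context {R : realType} (h : R -> R) (s t g be q Hm : R) (M r : nat).
Context (blk : seq (seq nat)) (nb : nat) (Hb : seq nat -> R).
Context (kk : nat -> nat) (c : seq nat).
Implicit Types (w b : seq nat).

Hypothesis h_itv : forall x, 0 <= x <= 1 -> 0 <= h x <= Hm.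
Hypothesis s_gt0 : 0 < s.
Hypothesis s_le1 : s <= 1.
Hypothesis t_gt0 : 0 < t.
Hypothesis g_gt0 : 0 < g.
Hypothesis q_s : q * s = 1 - s.
Hypothesis be_s : be * s = g.
Hypothesis be_sum : be * (\sum_(j < r.+1) q ^+ j) = 1.
Hypothesis posc : posw c.

Let fb b : R := clen b `^ s * expR (- (g * t * Hb b)).
Let F := \sum_(b <- blk) fb b.
(** Each large digit loses a factor 64: 4 from [clen_cat], and 16 because a digit of order x may be
    as large as 4 x. *)
Let D : R := 64 ^+ r.+1.
Let C1 : R := (clen c `^ s)^-1.

Hypothesis blk_uniq : uniq blk.
Hypothesis blkP : forall b, b \in blk ->
  [/\ tame M b, size b = nb.+1 & forall y, 0 <= y <= 1 -> cfsum h b y <= Hb b].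
Hypothesis F_ge8 : 8 <= F.
(** With a gain of 2 per block, [kk n] blocks after a word of length [n] outweigh the losses [D] of
    the next run and the crude bound [Hm * n] for the ergodic sum of that word. *)
Hypothesis kkP : forall n, C1 * D * expR (g * t * (Hm * n%:R)) <= 2 ^+ kk n.

(* A node is a word together with its mass and its state: either [(true, k, sg)],
   with [k + 1] further blocks to come before the next run of large digits and
   [sg] a bound for the ergodic sums of [h] along the word, or [(false, i, x)],
   with [i + 1] large digits to come, the next one being of order [x]. *)
Definition node : Type := (seq nat * R * (bool * nat * R))%type.
HB.instance Definition _ := Equality.copy node (seq nat * R * (bool * nat * R))%type.

Definition nword (x : node) := x.1.1.
Definition nmass (x : node) := x.1.2.

Definition block_child w m k sg b : R * node :=
  (fb b / F, (w ++ b, m * (fb b / F),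
    if k is k'.+1 then (true, k', sg + Hb b)
    else (false, r, expR (t * be * (sg + Hb b))))).

(** With N = floor(x) + 1 the digits are N+1, ..., 2N: for x >= 1 all of them lie between x and 4 x,
    and each gets the share 1/N <= 1/x. *)
Definition large_count (x : R) : nat := (Num.truncn x).+1.

Definition large_child w m i x d : R * node :=
  let N : R := (large_count x)%:R in
  (N^-1, (rcons w d, m * N^-1,
    if i is i'.+1 then (false, i', x `^ q)
    else (true, kk (size w).+1, Hm * (size w).+1%:R))).

Definition large_digits (x : R) := iota (large_count x).+1 (large_count x).

Local Arguments large_digits : simpl never.
Local Arguments large_count : simpl never.

Definition kids (x : node) : seq (R * node) :=
  let: (w, m, (ty, k, sg)) := x in
  if ty then [seq block_child w m k sg b | b <- blk]
  else [seq large_child w m k sg d | d <- large_digits sg].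

Lemma kids_block w m k e :
  kids (w, m, (true, k, e)) = [seq block_child w m k e b | b <- blk].
Proof. by []. Qed.

Lemma kids_large w m k e :
  kids (w, m, (false, k, e)) = [seq large_child w m k e d | d <- large_digits e].
Proof. by []. Qed.

(** The power of 2 is halved by each block to come. After the last one the bound D^(-1) exp(-g t sg)
    equals 64^(-(r+1)) x^(-s) for x = exp(t be sg), because be s = g; the power of 64 then drops
    with each large digit. *)
Definition node_inv (x : node) : Prop :=
  let: (w, m, (ty, k, sg)) := x in
  [/\ posw w, 0 < m, m <= C1 * clen w `^ s &
   if ty then [/\ 0 <= sg, forall y, 0 <= y <= 1 -> cfsum h w y <= sg &
       m <= 2 ^+ k.+1 * D^-1 * expR (- (g * t * sg)) * clen w `^ s]
   else 1 <= sg /\ m <= (64 ^+ k.+1)^-1 * sg `^ (- s) * clen w `^ s].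

Definition root : node := (c, 1, (true, kk (size c), Hm * (size c)%:R)).

Let v : R := 1 - M.+2%:R^-1.

Definition nlo (x : node) := (cyl_itv v (nword x)).1.
Definition nhi (x : node) := (cyl_itv v (nword x)).2.

Let th01 : 0 < (M.+2%:R^-1 : R) <= 2^-1.
Proof. by rewrite invr_gt0 ltr0n/= lef_pV2 ?posrE// ?ltr0n// ler_nat. Qed.

Let v01 : 2^-1 <= v <= 1.
Proof.
have /andP[a b] := th01; rewrite /v gerBl (ltW a) andbT.
by rewrite lerBrDr -lerBrDl (le_trans b)//; lra.
Qed.

Let v_ge0 : 0 <= v.
Proof. by have /andP[a _] := v01; apply: le_trans a. Qed.

Let in01 y : 0 <= y <= v -> 0 <= y <= 1.
Proof. by have /andP[_ b] := v01 => /andP[-> /le_trans]; apply. Qed.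

Let Hm_ge0 : 0 <= Hm.
Proof.
have /andP[a b] : 0 <= h 0 <= Hm by apply: h_itv; rewrite lexx ler01.
exact: le_trans b.
Qed.

Let cfsum_bound w y : posw w -> 0 <= y <= 1 -> 0 <= cfsum h w y <= Hm * (size w)%:R.
Proof.
move=> + y01; elim: w => [|k w IH] pw; first by rewrite /= mulr0 lexx.
have /andP[_ pw'] := pw; have /andP[a b] := IH pw'.
have /andP[a' b'] := h_itv (cfrac_itv pw y01).
by rewrite /= addr_ge0//= -natr1 mulrDr mulr1 addrC lerD.
Qed.

Let Hb_ge0 b : b \in blk -> 0 <= Hb b.
Proof.
move=> /blkP[tb _ /(_ 0)]; rewrite lexx ler01 => /(_ isT); apply: le_trans.
have z01 : 0 <= (0:R) <= 1 by rewrite lexx ler01.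
by have /andP[] := cfsum_bound (tame_posw tb) z01.
Qed.

Let blk_posw b : b \in blk -> posw b.
Proof. by move=> /blkP[/tame_posw]. Qed.

Let F_gt0 : 0 < F.
Proof. exact: lt_le_trans F_ge8. Qed.

Let fb_gt0 b : b \in blk -> 0 < fb b.
Proof. by move=> bb; rewrite mulr_gt0 ?expR_gt0// powR_gt0// clen_gt0// blk_posw. Qed.

Let D_gt0 : 0 < D.
Proof. exact: exprn_gt0. Qed.

Let C1_ge1 : 1 <= C1.
Proof.
have cs : 0 < clen c `^ s by rewrite powR_gt0// clen_gt0.
rewrite /C1 -[X in X <= _]invr1 lef_pV2 ?posrE//.
have := ler_powR_base (ltW s_gt0) (ltW (clen_gt0 posc)) (@clen_le1 R _ posc).
by rewrite powR1.
Qed.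

Let pow64 (a : R) : 0 <= a -> (4 * a) `^ s <= 4 * a `^ s.
Proof.
move=> a0; rewrite powRM// ler_wpM2r ?powR_ge0//.
by rewrite -[leRHS]powRr1// ler_powR// ler1n.
Qed.

(** The factor 4 lost in [clen_cat] against [F >= 8] leaves 1/2. *)
Let block_step w m b K : posw w -> b \in blk -> 0 <= K -> m <= K * clen w `^ s ->
  m * (fb b / F) <= 2^-1 * K * expR (- (g * t * Hb b)) * clen (w ++ b) `^ s.
Proof.
move=> pw bb K0 mK; have pb := blk_posw bb.
have cw := @clen_gt0 R _ pw; have cb := @clen_gt0 R _ pb.
have f0 : 0 <= fb b / F by rewrite divr_ge0 ?ltW// fb_gt0.
apply: (le_trans (ler_wpM2r f0 mK)).
have cc : clen w `^ s * clen b `^ s <= 4 * clen (w ++ b) `^ s.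
  rewrite -(powRM _ (ltW cw) (ltW cb)).
  have cwb : 0 <= clen (w ++ b) :> R by rewrite ltW// clen_gt0// posw_cat pw.
  apply: le_trans (pow64 cwb); apply: ler_powR_base; first exact: ltW.
    by rewrite mulr_ge0// ltW.
  by have /andP[H _] := @clen_cat R _ _ pw pb; lra.
have FV : F^-1 <= 8^-1 by rewrite lef_pV2 ?posrE.
rewrite [leLHS](_ : _ = K * expR (- (g * t * Hb b)) * (F^-1 * (clen w `^ s * clen b `^ s))).
  rewrite [leRHS](_ : _ = K * expR (- (g * t * Hb b)) * (8^-1 * (4 * clen (w ++ b) `^ s))).
    apply: ler_wpM2l; first by rewrite mulr_ge0 ?expR_ge0.
    by apply: ler_pM => //; rewrite ?invr_ge0 ?(ltW F_gt0)// mulr_ge0 ?powR_ge0.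
  by field.
by rewrite /fb; ring.
Qed.

Let large_countP x : 1 <= x -> [/\ x < (large_count x)%:R,
  (large_count x)%:R <= 2 * x & (1 <= large_count x)%N].
Proof.
move=> x1; have x0 : 0 <= x by apply: le_trans x1.
rewrite /large_count; split=> //; first exact: truncnS_gt.
have : (Num.truncn x)%:R <= x by rewrite truncn_le.
by rewrite -natr1; lra.
Qed.

Let large_digitP x d : 1 <= x -> d \in large_digits x ->
  [/\ (1 < d)%N, x <= d%:R & d%:R <= 4 * x].
Proof.
move=> x1; have [h1 h2 h3] := large_countP x1.
rewrite mem_iota => /andP[d1 d2]; split.
- by apply: leq_trans d1.
- by rewrite (le_trans (ltW h1))// ler_nat ltnW.
- have : (d <= 2 * large_count x)%N by rewrite mul2n -addnn -ltnS -addSn.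
  by rewrite -(ler_nat R) natrM; lra.
Qed.

Let large_step w m d i x : posw w -> 0 < m -> 1 <= x -> d \in large_digits x ->
  m <= (64 ^+ i.+1)^-1 * x `^ (- s) * clen w `^ s ->
  m * (large_count x)%:R^-1 <= (64 ^+ i)^-1 * x `^ (s - 1) * clen (rcons w d) `^ s.
Proof.
move=> pw m0 x1 dx mK; have [d1 d2 d3] := large_digitP x1 dx.
have [n1 n2 n3] := large_countP x1.
have x0 : 0 < x by apply: lt_le_trans x1.
have pd : posw [:: d] by rewrite /posw /= ltnW.
have d0 : 0 < d%:R :> R by apply: lt_le_trans d2.
have cw := @clen_gt0 R _ pw.
have cd : clen w <= 64 * (x ^+ 2 * clen (rcons w d)).
  have /andP[H _] := @clen_cat R _ _ pw pd; rewrite cats1 clen1 in H.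
  have d2' : d%:R ^+ 2 <= 16 * x ^+ 2 :> R.
    have := ler_pM (ltW d0) (ltW d0) d3 d3; lra.
  have cr : 0 < clen (rcons w d) :> R by rewrite clen_gt0// posw_rcons pw andbT ltnW.
  have {}H : clen w <= 4 * clen (rcons w d) * d%:R ^+ 2 :> R.
    rewrite -ler_pdivrMr ?exprn_gt0// ; lra.
  by apply: (le_trans H); nra.
have cr : 0 <= clen (rcons w d) :> R by rewrite ltW// clen_gt0// posw_rcons pw andbT ltnW.
have nV : (large_count x)%:R^-1 <= x^-1.
  by rewrite lef_pV2 ?posrE// ?ltr0n// ltW.
apply: (@le_trans _ _ ((64 ^+ i.+1)^-1 * x `^ (- s) * clen w `^ s * x^-1)).
  by apply: ler_pM => //; exact: ltW.
have c64 : clen w `^ s <= 64 * (x `^ (2 * s) * clen (rcons w d) `^ s).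
  apply: (le_trans (ler_powR_base (ltW s_gt0) (ltW cw) cd)).
  have X2 : 0 <= x ^+ 2 by rewrite exprn_ge0// ltW.
  rewrite (powRM _ (ler0n R 64) (mulr_ge0 X2 cr)) (powRM _ X2 cr).
  have -> : (x ^+ 2) `^ s = x `^ (2 * s) by rewrite powRrM powR_mulrn// ltW.
  rewrite ler_wpM2r ?mulr_ge0 ?powR_ge0//.
  by rewrite -[leRHS]powRr1// ler_powR// ler1n.
rewrite [leLHS](_ : _ = (64 ^+ i.+1)^-1 * (x `^ (- s) * x^-1) * clen w `^ s); last ring.
apply: (le_trans (ler_wpM2l _ c64)).
  by rewrite mulr_ge0 ?mulr_ge0 ?invr_ge0 ?exprn_ge0 ?powR_ge0 ?(ltW x0).
rewrite -[x^-1]powR_inv1 ?(ltW x0)//.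
have xD (a a' : R) : x `^ a * x `^ a' = x `^ (a + a') by rewrite powRD// (gt_eqF x0) implybT.
rewrite exprS [leLHS](_ : _ = (64 ^+ i)^-1 * (x `^ (- s) * x `^ (- 1) * x `^ (2 * s)) *
   clen (rcons w d) `^ s); last by field; rewrite gt_eqF ?exprn_gt0.
rewrite !xD (_ : - s + - 1 + 2 * s = s - 1)//; ring.
Qed.

Let q_ge0 : 0 <= q.
Proof. by rewrite -(pmulr_lge0 _ s_gt0) q_s subr_ge0. Qed.

Let be_gt0 : 0 < be.
Proof. by rewrite -(pmulr_lgt0 _ s_gt0) be_s. Qed.

Let powq_ge1 x : 1 <= x -> 1 <= x `^ q.
Proof. by move=> x1; rewrite -(powRr0 x) ler_powR. Qed.

Let powqs x : x `^ q `^ (- s) = x `^ (s - 1).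
Proof. by rewrite -powRrM mulrN q_s opprB. Qed.

Let powx_le1 x : 1 <= x -> x `^ (s - 1) <= 1.
Proof.
by move=> x1; rewrite -[leRHS](powRr0 x) ler_powR// subr_le0.
Qed.

Lemma root_inv : node_inv root.
Proof.
have cs : 0 < clen c `^ s by rewrite powR_gt0// clen_gt0.
have kc := kkP (size c); rewrite /node_inv /=; split=> //.
  by rewrite /C1 mulVf ?gt_eqF.
split; first by rewrite mulr_ge0.
  by move=> y y01; have /andP[] := cfsum_bound posc y01.
rewrite expRN exprS.
set E := expR _ in kc *; have E0 : 0 < E by exact: expR_gt0.
rewrite -ler_pdivrMr// mul1r -/C1 -ler_pdivrMr ?invr_gt0// invrK.
rewrite -ler_pdivrMr ?invr_gt0// invrK mulrAC -mulrA in kc *.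
by have : 0 <= 2 ^+ kk (size c) :> R by []; nra.
Qed.

Lemma kids_inv (x : node) p : node_inv x -> p \in kids x ->
  [/\ 0 <= p.1, node_inv p.2 & node_set nlo nhi p.2 `<=` node_set nlo nhi x].
Proof.
case: x => [[w m] [[ty k] sg]] [pw m0 mC].
have subset e : posw e -> (forall y, 0 <= y <= v -> 0 <= cfrac e y <= v) ->
    forall z, (cyl_itv v (w ++ e)).1 <= z <= (cyl_itv v (w ++ e)).2 ->
    (cyl_itv v w).1 <= z <= (cyl_itv v w).2.
  move=> pe ev z /cyl_itvP-/(_ _ v_ge0)[|y yv ->]; first by rewrite posw_cat pw.
  by apply/(cyl_itvP _ pw v_ge0); rewrite cfrac_cat; exists (cfrac e y) => //; exact: ev.
case: ty => [[sg0 Sh mS]|[sg1 mS]]; rewrite ?kids_block ?kids_large => /mapP[e ee ->] /=.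
  have pe := blk_posw ee; have pwe : posw (w ++ e) by rewrite posw_cat pw.
  have He := Hb_ge0 ee; have f0 := fb_gt0 ee.
  have [te _ he] := blkP ee.
  have expr01 : 0 <= expR (- (g * t * Hb e)) <= 1.
    by rewrite expR_ge0 /= -expR0 ler_expR oppr_le0 !mulr_ge0// ltW.
  have cwe : 0 <= clen (w ++ e) `^ s by exact: powR_ge0.
  have m'C : m * (fb e / F) <= C1 * clen (w ++ e) `^ s.
    apply: (le_trans (block_step pw ee (le_trans ler01 C1_ge1) mC)).
    rewrite ler_wpM2r//; have /andP[a b] := expr01; have := C1_ge1; nra.
  have sg'0 : 0 <= sg + Hb e by rewrite addr_ge0.
  have eS : expR (- (g * t * (sg + Hb e))) = expR (- (g * t * sg)) * expR (- (g * t * Hb e)).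
    by rewrite -expRD; congr expR; ring.
  have K0 : 0 <= 2 ^+ k.+1 * D^-1 * expR (- (g * t * sg)).
    by rewrite !mulr_ge0 ?invr_ge0 ?expR_ge0 ?exprn_ge0.
  have mm := block_step pw ee K0 mS.
  split; [by rewrite divr_ge0 ?ltW| |].
    have m'0 : 0 < m * (fb e / F) := mulr_gt0 m0 (divr_gt0 f0 F_gt0).
    case: k mS K0 mm => [|k] mS K0 mm; split=> //.
      split; first by rewrite -expR0 ler_expR !mulr_ge0// ltW.
      apply: (le_trans mm); rewrite ler_wpM2r//.
      rewrite -expRM (_ : t * be * (sg + Hb e) * - s = - (be * s * t * (sg + Hb e))); last ring.
      rewrite be_s eS expr1 -/D le_eqVlt; apply/orP; left; apply/eqP; field.
      by rewrite gt_eqF.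
    split=> //.
      move=> y y01; rewrite cfsum_cat lerD ?Sh ?he// cfrac_itv//.
    apply: (le_trans mm); rewrite ler_wpM2r// eS exprS le_eqVlt.
    by apply/orP; left; apply/eqP; field; rewrite gt_eqF.
  move=> z; apply: subset => // y yv; exact: (@tame_cfrac _ M).
have [d1 d2 d3] := large_digitP sg1 ee.
have pd : posw [:: e] by rewrite /posw /= ltnW.
have pwe : posw (rcons w e) by rewrite posw_rcons pw andbT ltnW.
have [n1 n2 n3] := large_countP sg1.
have cwe : 0 <= clen (rcons w e) `^ s by exact: powR_ge0.
have mm := large_step pw m0 sg1 ee mS.
(* As x^(s - 1) <= 1, the constant is at most 1 after every large digit; after the last of a run
   this restarts the count of blocks. *)
have m1 : m * (large_count sg)%:R^-1 <= clen (rcons w e) `^ s.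
  apply: (le_trans mm); rewrite ler_piMl// mulr_ile1 ?powx_le1 ?powR_ge0// ?invr_ge0 ?exprn_ge0//.
  by rewrite invf_le1 ?exprn_gt0// exprn_ege1// ler1n.
have m'C : m * (large_count sg)%:R^-1 <= C1 * clen (rcons w e) `^ s.
  by apply: (le_trans m1); rewrite ler_peMl.
have m'0 : 0 < m * (large_count sg)%:R^-1 by rewrite mulr_gt0// invr_gt0 ltr0n.
split; [by rewrite invr_ge0| |].
  case: k mS mm => [|k] mS mm; split=> //.
    split; first by rewrite mulr_ge0.
      by move=> y y01; have /andP[_] := cfsum_bound pwe y01; rewrite size_rcons.
    have kc := kkP (size w).+1.
    apply: (le_trans m1); rewrite ler_peMl// expRN exprS.
    set E := expR _ in kc *; have E0 : 0 < E by exact: expR_gt0.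
    rewrite -ler_pdivrMr ?invr_gt0// invrK mul1r -ler_pdivrMr ?invr_gt0// invrK.
    have := mulr_ge0 (ltW E0) (ltW D_gt0); have := C1_ge1; nra.
  by split; [exact: powq_ge1|rewrite powqs].
rewrite -cats1; move=> z; apply: subset => // y /andP[y0 yv].
have e2 : 2 <= e%:R :> R by rewrite ler_nat.
have /andP[v2 v1] := v01.
rewrite cfrac_cons /cfrac /= invr_ge0 (@le_trans _ _ 2)//=; last lra.
by apply: le_trans v2; rewrite lef_pV2 ?posrE//; lra.
Qed.

Lemma kids_sum (x : node) : node_inv x -> \sum_(p <- kids x) p.1 = 1.
Proof.
case: x => [[w m] [[ty k] sg]] [pw m0 mC].
case: ty => [_|[sg1 _]]; rewrite ?kids_block ?kids_large big_map /=.
  by rewrite -mulr_suml divff// gt_eqF.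
have [n1 n2 n3] := large_countP sg1.
rewrite big_const_seq count_predT iter_addr_0 size_iota -[LHS]mulr_natl.
by rewrite divff// gt_eqF// ltr0n.
Qed.

Lemma nlo_le_nhi (x : node) : node_inv x -> nlo x <= nhi x.
Proof.
by case: x => [[w m] [[ty k] sg]] [pw _ _ _]; have /andP[] := cyl_itv_ge0 pw v_ge0.
Qed.

Let desc := descendants kids.
Let nm := node_mass kids nlo nhi.

Lemma kids_word (x : node) p : p \in kids x ->
  exists e, [/\ nword p.2 = nword x ++ e, (0 < size e)%N & nmass p.2 = nmass x * p.1].
Proof.
case: x => [[w m] [[[] k] sg]]; rewrite ?kids_block ?kids_large => /mapP[b bb ->].
  by exists b; split=> //; have [_ -> _] := blkP bb.
by exists [:: b]; rewrite cats1.
Qed.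

Lemma desc_word n x y : y \in desc n x ->
  exists e, nword y = nword x ++ e /\ (n <= size e)%N.
Proof.
elim: n x => [|n IH] x; first by rewrite inE => /eqP->; exists [::]; rewrite cats0.
move=> /flattenP[l /mapP[p px ->] /IH[e [yE se]]].
have [e' [pE e'0 _]] := kids_word px.
by exists (e' ++ e); rewrite yE pE catA size_cat -add1n leq_add.
Qed.

Lemma desc_inv n x y : node_inv x -> y \in desc n x -> node_inv y.
Proof. by move=> ix yx; have [] := descendants_inv kids_inv ix yx. Qed.

(** * Runs of large digits along every branch *)

Definition good n0 w : Prop := exists u e u',
  [/\ w = u ++ e ++ u', (n0 <= size u)%N, size e = r.+1 &
   forall y, 0 <= y <= 1 -> expR (t * cfsum h u y) <= (\prod_(d <- e) d)%N%:R].

Lemma good_cat n0 n1 w w' : (n1 <= n0)%N -> good n0 w -> good n1 (w ++ w').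
Proof.
move=> n10 [u [e [u' [-> su se H]]]]; exists u, e, (u' ++ w').
by rewrite !catA; split=> //; exact: leq_trans su.
Qed.

Lemma large_run i w m x y : node_inv (w, m, (false, i, x)) ->
  y \in desc i.+1 (w, m, (false, i, x)) -> exists e,
  [/\ nword y = w ++ e, size e = i.+1,
    x `^ (\sum_(j < i.+1) q ^+ j) <= (\prod_(d <- e) d)%N%:R & y.2.1.1].
Proof.
elim: i w m x => [|i IH] w m x ix /flattenP[l /mapP[p pk ->]].
  have [_ _ _ [x1 _]] := ix.
  move: pk; rewrite kids_large => /mapP[d /(large_digitP x1)[_ d2 _] ->].
  rewrite inE => /eqP->; exists [:: d]; rewrite cats1; split=> //=.
  by rewrite big_seq1 big_ord_recl big_ord0 addr0 expr0 powRr1// (le_trans ler01).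
have [_ ip _] := kids_inv ix pk.
have [_ _ _ [x1 _]] := ix.
move: pk ip; rewrite kids_large => /mapP[d /(large_digitP x1)[_ d2 _] ->] ip.
move=> /(IH _ _ _ ip)[e [yE se pe yb]]; exists (d :: e); split=> //.
- by rewrite yE cat_rcons.
- by rewrite /= se.
rewrite big_ord_recl big_cons natrM expr0.
have x0 : 0 < x by apply: lt_le_trans x1.
rewrite powRD; last by rewrite (gt_eqF x0) implybT.
rewrite powRr1 ?(ltW x0)//; apply: ler_pM => //; rewrite ?(ltW x0) ?powR_ge0//.
apply: le_trans pe; rewrite -powRrM mulr_sumr.
by under eq_bigr do rewrite /bump /= exprS.
Qed.

Lemma block_run k w m a y : node_inv (w, m, (true, k, a)) ->
  y \in desc k.+1 (w, m, (true, k, a)) -> exists e m' a',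
  y = (w ++ e, m', (false, r, expR (t * be * a'))) /\
  (forall z, 0 <= z <= 1 -> cfsum h (w ++ e) z <= a').
Proof.
elim: k w m a => [|k IH] w m a ix /flattenP[l /mapP[p pk ->]].
  have [pw _ _ [_ ha _]] := ix.
  move: pk; rewrite kids_block => /mapP[b bb ->].
  rewrite inE => /eqP->; exists b, (m * (fb b / F)), (a + Hb b); split=> //.
  move=> z z01; have [tb _ hb] := blkP bb.
  by rewrite cfsum_cat lerD ?ha ?hb// cfrac_itv// (tame_posw tb).
have [_ ip _] := kids_inv ix pk.
move: pk ip; rewrite kids_block => /mapP[b bb ->] ip.
move=> /(IH _ _ _ ip)[e [m' [a' [-> H]]]].
by exists (b ++ e), m', a'; rewrite catA.
Qed.

Lemma block_good k w m a y : node_inv (w, m, (true, k, a)) ->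
  y \in desc (k.+1 + r.+1) (w, m, (true, k, a)) -> good (size w) (nword y).
Proof.
move=> ix; rewrite /desc descendantsD => /flattenP[l /mapP[x xd ->] yd].
have inv_x := desc_inv ix xd.
have [e [m' [a' [xE H]]]] := block_run ix xd.
rewrite xE in inv_x yd.
have [e' [yE se' pe' _]] := large_run inv_x yd.
exists (w ++ e), e', [::]; rewrite cats0 yE; split=> // [|z z01].
  by rewrite size_cat leq_addr.
apply: le_trans pe'; rewrite -expRM ler_expR.
rewrite (_ : t * be * a' * _ = t * a' * (be * \sum_(j < r.+1) q ^+ j)); last ring.
by rewrite be_sum mulr1 ler_wpM2l ?(ltW t_gt0)// H.
Qed.

(** Each generation is finite, so the waiting times have a maximum, and [P] is inherited by
    descendants. *)
Lemma desc_uniform x n (P : node -> Prop) :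
  (forall y z k, P y -> z \in desc k y -> P z) ->
  (forall y, y \in desc n x -> exists L, forall z, z \in desc L y -> P z) ->
  exists L, forall z, z \in desc (n + L) x -> P z.
Proof.
move=> hered H.
have /choice[L HL] : forall y, exists L, y \in desc n x -> forall z, z \in desc L y -> P z.
  move=> y; have [yd|nyd] := boolP (y \in desc n x); last by exists 0%N.
  by have [L HL] := H y yd; exists L.
exists (\max_(y <- desc n x) L y)%N => z.
rewrite /desc descendantsD => /flattenP[l /mapP[y yd ->]].
have Ly : (L y <= \max_(y <- desc n x) L y)%N by exact: (leq_bigmax_seq _ yd isT).
rewrite -(subnKC Ly) descendantsD => /flattenP[l' /mapP[z' z'd ->] zz'].
by apply: hered zz'; exact: HL z'd.
Qed.

(** A node in the middle of a run may have too few digits left, so that run is completed first and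
    the next full one is used. *)
Lemma eventually_good x : node_inv x ->
  exists L, forall y, y \in desc L x -> good (size (nword x)) (nword y).
Proof.
have hered n0 y z k : good n0 (nword y) -> z \in desc k y -> good n0 (nword z).
  by move=> gy /desc_word[e [-> _]]; exact: good_cat gy.
case: x => [[w m] [[[] k] a]] ix.
  by exists (k.+1 + r.+1)%N => y; exact: block_good.
have [L HL] : exists L, forall z, z \in desc (k.+1 + L) (w, m, (false, k, a)) ->
    good (size w) (nword z).
  apply: desc_uniform => [y z k'|y yd]; first exact: hered.
  have iy := desc_inv ix yd; have [e [yE _ _ yb]] := large_run ix yd.
  case: y yd iy yE yb => [[w1 m1] [[[] k1] a1]]// yd iy yE _.
  exists (k1.+1 + r.+1)%N => z /(block_good iy) gz.
  rewrite -[nword z]cats0; apply: good_cat gz.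
  by rewrite -[w1]/(nword (w1, m1, (true, k1, a1))) yE size_cat leq_addr.
by exists (k.+1 + L)%N.
Qed.

Lemma limit_good n0 : exists L, forall y, y \in desc L root -> good n0 (nword y).
Proof.
have [L HL] : exists L, forall z, z \in desc (n0 + L) root -> good n0 (nword z).
  apply: desc_uniform => [y z k gy /desc_word[e [-> _]]|y yd]; first exact: good_cat gy.
  have iy := desc_inv root_inv yd; have [L HL] := eventually_good iy.
  exists L => z /HL gz; rewrite -[nword z]cats0; apply: good_cat gz.
  by have [e [-> le]] := desc_word yd; rewrite size_cat (leq_trans le)// leq_addl.
by exists (n0 + L)%N.
Qed.

Lemma limit_subset (tau : R -> R) :
  (forall y, 0 <= y <= 1 -> tau (cfrac c y) <= t) ->
  limit_set root kids nlo nhi `<=` limsup_set r.+1 tau h.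
Proof.
move=> htau z Kz.
have tz : tau z <= t.
  have [x xd xz] := Kz 0%N; have ix := desc_inv root_inv xd.
  move: xd xz; rewrite inE => /eqP-> /(cyl_itvP _ posc v_ge0)[y yv ->].
  by apply: htau; exact: in01.
have key n0 : exists u e z', [/\ z = cfrac (u ++ e) z', posw (u ++ e), 0 < z' < 1,
    (n0 <= size u)%N & size e = r.+1 /\
   forall y, 0 <= y <= 1 -> expR (t * cfsum h u y) <= (\prod_(d <- e) d)%N%:R].
  (* Two more generations add at least two digits, which puts the remaining tail strictly between 0
     and 1, where the orbit follows the word. *)
  have [L HL] := limit_good n0; have [x xd xz] := Kz (L + 2)%N.
  have ix := desc_inv root_inv xd.
  move: xd; rewrite descendantsD => /flattenP[l /mapP[x' x'd ->] xx'].
  have [u [e [u' [x'E su se H]]]] := HL x' x'd.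
  have [e2 [xE se2]] := desc_word xx'.
  case: x ix xz xE xx' => [[w m] [[ty k] a]] [pw _ _ _] /(cyl_itvP _ pw v_ge0)[y yv zE] xE _.
  rewrite /nword /= -/(nword x') x'E in xE; subst w.
  rewrite -!catA catA in zE pw; rewrite cfrac_cat in zE.
  move: pw; rewrite posw_cat => /andP[pue pu'].
  exists u, e, (cfrac (u' ++ e2) y); split=> //.
  by apply: cfrac_itvoo_size2 => //; [rewrite size_cat (leq_trans se2)// leq_addl|exact: in01].
split=> [|n0].
  have [u [e [z' [-> pue z'01 _ _]]]] := key 0%N.
  by have /andP[/ltW-> ->] := cfrac_itvoo pue z'01.
have [u [e [z' [zE pue z'01 su [se H]]]]] := key n0.
exists (size u) => //; have /andP[pu pe] : posw u && posw e by rewrite -posw_cat.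
rewrite cfrac_cat in zE; set xi := cfrac e z' in zE.
have xi01 : 0 < xi < 1 by exact: cfrac_itvoo.
have xi01' : 0 <= xi <= 1 by have /andP[/ltW-> /ltW->] := xi01.
have -> : (\prod_(1 <= i < r.+2) pquot (size u + i) z = \prod_(d <- e) d)%N.
  rewrite -(digit_prod_cfrac pe z'01) se /digit_prod [LHS]big_nat [RHS]big_nat.
  by apply: eq_bigr => i /andP[i0 _]; rewrite pquotD// zE iter_gauss_cfrac.
apply: le_trans (H xi xi01'); rewrite zE ergsum_cfrac// ler_expR -zE.
by rewrite ler_wpM2r//; have /andP[] := cfsum_bound pu xi01'.
Qed.

(** * Hoelder bound for the mass *)

Let decay l : R := C1 * (2 * 2^-1 ^+ l) `^ s.

Let decay_anti l l' : (l <= l')%N -> decay l' <= decay l.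
Proof.
move=> ll; rewrite ler_wpM2l ?(le_trans ler01 C1_ge1)//.
apply: ler_powR_base; rewrite ?(ltW s_gt0)// ?mulr_ge0// ?exprn_ge0//.
by rewrite ler_wpM2l// !exprVn lef_pV2 ?posrE ?exprn_gt0// ler_eXn2l ?ltr1n.
Qed.

Let node_mass_le1 n x U : node_inv x -> 0 <= nm n x U <= 1.
Proof.
move=> ix; rewrite (node_mass_ge0 kids_inv)//=.
apply: (le_trans (node_mass_le kids_inv kids_sum U ix (leq0n n))).
by rewrite /=; case: ifP.
Qed.

Let node_mass_meets n x U : node_inv x -> nm n x U != 0 ->
  exists z, node_set nlo nhi x z /\ U z.
Proof.
move=> ix nz; have /andP[n0 _] := node_mass_le1 n U ix.
have := node_mass_le kids_inv kids_sum U ix (leq0n n).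
rewrite [X in _ <= X]/=; case: ifPn => [/asboolP[z [zx zU]] _|_ le0]; first by exists z.
by move: nz; rewrite eq_le le0 n0.
Qed.

Let nmS n x U : nm n.+1 x U = \sum_(p <- kids x) p.1 * nm n p.2 U.
Proof. by []. Qed.

Let mass_single (T : eqType) (A : seq T) (f : T -> R * node) (x : node) n U B :
  kids x = map f A -> uniq A -> 0 <= B ->
  (forall a, a \in A -> nmass x * ((f a).1 * nm n (f a).2 U) <= B) ->
  (forall a a', a \in A -> a' \in A -> nm n (f a).2 U != 0 -> nm n (f a').2 U != 0 -> a = a') ->
  nmass x * nm n.+1 x U <= B.
Proof.
move=> xE uA B0 HB Hs; rewrite nmS xE big_map.
have [/hasP[a aA na]|/hasPn none] := boolP (has (fun a => nm n (f a).2 U != 0) A).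
  rewrite (bigD1_seq a)//= big_seq_cond big1 ?addr0; first exact: HB.
  move=> a' /andP[a'A a'a]; apply/eqP; rewrite mulf_eq0; apply/orP; right.
  by apply: contraNT a'a => na'; rewrite (Hs a' a).
rewrite big_seq big1 ?mulr0// => a /none; rewrite negbK => /eqP->.
by rewrite mulr0.
Qed.

(* If a set of diameter at most [d] meets two children of a node, then [d] is
   bounded below by the gap between them; below that, a single child matters. *)
Lemma node_mass_holder : exists2 C, 0 < C & forall (U : set R) d, 0 < d ->
  (forall z z', U z -> U z' -> `|z - z'| <= d) -> forall n x, node_inv x ->
  nmass x * nm n x U <= Num.max (C * d `^ s) (decay (size (nword x) + n)).
Proof.
have /andP[th0 _] := th01.
pose th : R := M.+2%:R^-1.
pose gap : R := th * M.+1%:R^-1 ^+ 2 ^+ nb.+1.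
have gap0 : 0 < gap by rewrite mulr_gt0// !exprn_gt0// invr_gt0 ltr0n.
have C10 : 0 < C1 by apply: lt_le_trans C1_ge1.
pose K1 := C1 * (4 / gap) `^ s; pose K2 := 2 * 2 `^ s * (36 / th) `^ s.
have K10 : 0 < K1 by rewrite mulr_gt0// powR_gt0// divr_gt0.
have K20 : 0 < K2 by rewrite !mulr_gt0// powR_gt0// divr_gt0.
exists (K1 + K2); first exact: addr_gt0.
move=> U d d0 Ud; elim=> [|n IH] x ix.
  (* At depth 0 only the mass of the node itself is available. Since [decay] tends to 0, at large
     depth the other term of the maximum prevails for any given [d]. *)
  rewrite le_max; apply/orP; right; rewrite addn0.
  have /andP[_ le1] := node_mass_le1 0 U ix.
  case: x ix le1 => [[w m] [[ty k] a]] ix le1.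
  have [pw m0 mC _] := ix; rewrite /nmass /nword /=.
  apply: (@le_trans _ _ m); first by rewrite ler_piMr// ltW.
  apply: (le_trans mC); rewrite ler_wpM2l ?(ltW C10)//.
  by apply: ler_powR_base; rewrite ?(ltW s_gt0) ?clen_rate// ltW// clen_gt0.
have B0 : 0 <= Num.max ((K1 + K2) * d `^ s) (decay (size (nword x) + n.+1)).
  by rewrite le_max mulr_ge0 ?powR_ge0// ltW// addr_gt0.
have child p : p \in kids x ->
    nmass x * (p.1 * nm n p.2 U) <= Num.max ((K1 + K2) * d `^ s) (decay (size (nword x) + n.+1)).
  move=> px; have [e [wE e0 mE]] := kids_word px; have [_ ip _] := kids_inv ix px.
  rewrite mulrA -mE; apply: (le_trans (IH _ ip)).
  rewrite ge_max !le_max lexx /=; apply/orP; right; apply: decay_anti.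
  by rewrite wE size_cat -addnA leq_add2l addnC -addn1 leq_add2l.
case: x ix B0 child => [[w m] [[[] k] a]] ix B0 child; have [pw m0 mC st] := ix.
  have [[b [b' [bb bb' bneq nb0 nb'0]]]|none] := pselect (exists b b', [/\ b \in blk, b' \in blk,
      b <> b', nm n (block_child w m k a b).2 U != 0 & nm n (block_child w m k a b').2 U != 0]); last first.
    apply: (mass_single (kids_block w m k a) blk_uniq B0) => [b bb|b b' bb bb' n1 n2].
      by apply: child; rewrite kids_block; apply: map_f.
    by apply: contrapT => bneq; apply: none; exists b, b'.
  have pc e : e \in blk -> block_child w m k a e \in kids (w, m, (true, k, a)).
    by move=> ee; rewrite kids_block; apply: map_f.
  have [_ i1 _] := kids_inv ix (pc b bb); have [_ i2 _] := kids_inv ix (pc b' bb').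
  have [z [z1 Uz]] := node_mass_meets i1 nb0.
  have [z' [z'1 Uz']] := node_mass_meets i2 nb'0.
  have pb := blk_posw bb; have pb' := blk_posw bb'.
  have pwb : posw (w ++ b) by rewrite posw_cat pw.
  have pwb' : posw (w ++ b') by rewrite posw_cat pw.
  move/(cyl_itvP _ pwb v_ge0): z1 => [y yv zE].
  move/(cyl_itvP _ pwb' v_ge0): z'1 => [y' y'v z'E].
  rewrite cfrac_cat in zE; rewrite cfrac_cat in z'E.
  have /andP[D1 _] := cylinder_dist pw (cfrac_itv pb (in01 yv)) (cfrac_itv pb' (in01 y'v)).
  rewrite -zE -z'E in D1.
  have [tb sb _] := blkP bb; have [tb' sb' _] := blkP bb'.
  have G := tame_gap tb tb' (etrans sb (esym sb')) bneq yv y'v.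
  rewrite sb -/gap in G.
  have dd := Ud z z' Uz Uz'.
  have cw := @clen_gt0 R _ pw.
  (* The blocks form a fixed finite set, so one gap serves for all pairs, and the whole mass of the
     node is comparable to the [s]-th power of [d]. *)
  have cd : clen w <= 4 / gap * d.
    rewrite mulrAC ler_pdivlMr//.
    have H1 : 4^-1 * clen w * gap <= d.
      by apply: (le_trans _ (le_trans D1 dd)); rewrite ler_wpM2l// mulr_ge0// ltW.
    lra.
  rewrite le_max; apply/orP; left; rewrite [nmass _]/=.
  have /andP[_ le1] := node_mass_le1 n.+1 U ix.
  apply: (@le_trans _ _ m); first by rewrite ler_piMr// ltW.
  apply: (le_trans mC); apply: (@le_trans _ _ (K1 * d `^ s)); last first.
    by rewrite ler_wpM2r ?powR_ge0// lerDl ltW.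
  have g4 : 0 <= 4 / gap by rewrite divr_ge0// ltW.
  rewrite /K1 -mulrA -(powRM _ g4 (ltW d0)) ler_wpM2l ?(ltW C10)//.
  by apply: ler_powR_base; rewrite ?(ltW s_gt0)// ltW.
have [a1 ma] := st.
have [n1 n2 n3] := large_countP a1.
set N := (large_count a)%:R : R in n1 n2.
have N0 : 0 < N by rewrite /N ltr0n.
pose P e := (e \in large_digits a) && (nm n (large_child w m k a e).2 U != 0).
have [[e1 [e2 [Pe1 Pe2 e12]]]|none] := pselect (exists e1 e2, [/\ P e1, P e2 & e1 <> e2]); last first.
  apply: (mass_single (kids_large w m k a) (iota_uniq _ _) B0) => [b bb|b b' bb bb' h1 h2].
    by apply: child; rewrite kids_large; apply: map_f.
  by apply: contrapT => bneq; apply: none; exists b, b'; rewrite /P bb h1 bb' h2.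
have exP : exists e, P e by exists e1.
have Pub e : P e -> (e <= large_count a + large_count a)%N.
  by move=> /andP[+ _]; rewrite mem_iota => /andP[_]; rewrite addSn ltnS.
(* The number of large digits is unbounded, so the extreme digits met by [U] matter: their gap
   bounds [d] below by a multiple of [clen w * ka / N ^+ 2], and at most [ka + 1 <= 2 * ka] of the
   [N] children carry mass. *)
case: (ex_minnP exP) => lo Plo lomin; case: (ex_maxnP exP Pub) => up Pup upmax.
have lu : (lo < up)%N.
  rewrite ltnNge; apply/negP => ul; apply: e12; apply/eqP; rewrite eqn_leq.
  by rewrite (leq_trans (upmax _ Pe1) (leq_trans ul (lomin _ Pe2)))
             (leq_trans (upmax _ Pe2) (leq_trans ul (lomin _ Pe1))).
pose ka : R := (up - lo)%:R.
have ka1 : 1 <= ka by rewrite ler1n subn_gt0.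
have kaE : ka = up%:R - lo%:R by rewrite /ka natrB// ltnW.
have pc e : P e -> large_child w m k a e \in kids (w, m, (false, k, a)).
  by move=> /andP[ee _]; rewrite kids_large; apply: map_f.
have [_ i1 _] := kids_inv ix (pc lo Plo); have [_ i2 _] := kids_inv ix (pc up Pup).
have /andP[dlo nlo0] := Plo; have /andP[dup nup0] := Pup.
have [z [z1 Uz]] := node_mass_meets i1 nlo0.
have [z' [z'1 Uz']] := node_mass_meets i2 nup0.
have [lo1 lo2 lo3] := large_digitP a1 dlo; have [up1 up2 up3] := large_digitP a1 dup.
have plo : posw [:: lo] by rewrite /posw /= ltnW.
have pup : posw [:: up] by rewrite /posw /= ltnW.
have pwlo : posw (rcons w lo) by rewrite posw_rcons pw ltnW.
have pwup : posw (rcons w up) by rewrite posw_rcons pw ltnW.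
move/(cyl_itvP _ pwlo v_ge0): z1 => [y yv zE].
move/(cyl_itvP _ pwup v_ge0): z'1 => [y' y'v z'E].
rewrite -cats1 cfrac_cat in zE; rewrite -cats1 cfrac_cat in z'E.
have /andP[D1 _] := cylinder_dist pw (cfrac_itv plo (in01 yv)) (cfrac_itv pup (in01 y'v)).
rewrite -zE -z'E in D1.
have dd := Ud z z' Uz Uz'.
have cw := @clen_gt0 R _ pw.
have loN : lo%:R <= 2 * N.
  have : (lo <= large_count a + large_count a)%N by exact: Pub.
  by rewrite -(ler_nat R) natrD -/N; lra.
have upN : up%:R <= 2 * N.
  have : (up <= large_count a + large_count a)%N by exact: Pub.
  by rewrite -(ler_nat R) natrD -/N; lra.
have N1 : 1 <= N by rewrite /N ler1n.
have kaN : ka <= N.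
  have : (large_count a < lo)%N by move: dlo; rewrite mem_iota => /andP[].
  by rewrite -(ler_nat R) -natr1 -/N; lra.
have G : th * ka / (9 * N ^+ 2) <= `|cfrac [:: lo] y - cfrac [:: up] y'|.
  have v1 : v <= 1 by case/andP: v01.
  have /andP[y0 yv'] := yv; have /andP[y'0 y'v'] := y'v.
  rewrite kaE; apply: cfrac1_gap; rewrite ?(ltnW lo1) ?lu//.
  by rewrite y'0 (le_trans y'v').
have dlow : th / 36 * (clen w * (ka / N ^+ 2)) <= d.
  apply: (le_trans _ (le_trans D1 dd)).
  apply: (@le_trans _ _ (4^-1 * clen w * (th * ka / (9 * N ^+ 2)))).
    by rewrite le_eqVlt; apply/orP; left; apply/eqP; field; rewrite gt_eqF.
  by rewrite ler_wpM2l// mulr_ge0// ltW.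
have massle : nm n.+1 (w, m, (false, k, a)) U <= 2 * ka / N.
  rewrite nmS kids_large big_map.
  apply: (@le_trans _ _ (\sum_(e <- [seq e <- large_digits a | P e]) N^-1)).
    rewrite big_filter [leRHS]big_mkcond [leLHS]big_seq [leRHS]big_seq.
    apply: ler_sum => e ee.
    case: ifPn => [Pe|]; last by rewrite /P ee /= negbK => /eqP->; rewrite mulr0.
    have [_ ie _] := kids_inv ix (pc e Pe).
    have /andP[_ le1] := node_mass_le1 n U ie.
    by rewrite [(large_child _ _ _ _ _).1]/= -/N ler_piMr// invr_ge0 ltW.
  rewrite big_const_seq count_predT iter_addr_0 -[leLHS]mulr_natr mulrC ler_wpM2r ?invr_ge0 ?(ltW N0)//.
  have : (size [seq e <- large_digits a | P e] <= size (iota lo (up - lo).+1))%N.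
    apply: uniq_leq_size => [|e]; first by rewrite filter_uniq// iota_uniq.
    rewrite mem_filter mem_iota => /andP[Pe _].
    by rewrite lomin//= addnS ltnS subnKC ?upmax// ltnW.
  by rewrite size_iota -(ler_nat R) -natr1 -/ka; lra.
rewrite le_max; apply/orP; left; rewrite [nmass _]/=.
apply: (@le_trans _ _ (K2 * d `^ s)); last by rewrite ler_wpM2r ?powR_ge0// lerDr ltW.
have a0 : 0 < a by apply: lt_le_trans a1.
have cws := powR_ge0 (clen w) s.
have m1 : m <= 2 `^ s * N `^ (- s) * clen w `^ s.
  apply: (le_trans ma); rewrite ler_wpM2r//.
  apply: (@le_trans _ _ (a `^ (- s))).
    by rewrite ler_piMl ?powR_ge0// invf_le1 ?exprn_gt0// exprn_ege1// ler1n.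
  rewrite !powRN -[X in X / _]invrK -invfM lef_pV2 ?posrE ?powR_gt0//; last first.
    by rewrite mulr_gt0 ?invr_gt0 ?powR_gt0.
  rewrite mulrC ler_pdivrMr ?powR_gt0// mulrC -powRM//; last exact: ltW.
  by apply: ler_powR_base; rewrite ?(ltW s_gt0) ?(ltW N0).
apply: (@le_trans _ _ (2 `^ s * N `^ (- s) * clen w `^ s * (2 * ka / N))).
  by apply: ler_pM; rewrite ?(ltW m0)//; case/andP: (node_mass_le1 n.+1 U ix).
have kN : 0 <= ka / N ^+ 2 := divr_ge0 (le_trans ler01 ka1) (exprn_ge0 2 (ltW N0)).
have X0 : 0 <= clen w * (ka / N ^+ 2) := mulr_ge0 (ltW cw) kN.
have t36 : 0 <= th / 36 by rewrite divr_ge0// ltW.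
have ds : (th / 36) `^ s * (clen w `^ s * (ka / N ^+ 2) `^ s) <= d `^ s.
  rewrite -(powRM _ (ltW cw) kN) -(powRM _ t36 X0).
  by apply: ler_powR_base; rewrite ?(ltW s_gt0)// mulr_ge0.
(* This is where [s <= 1] enters: the proportion ka / N is at most 1, hence at most its own [s]-th
   power. *)
have kNs : ka / N * N `^ (- s) <= (ka / N ^+ 2) `^ s.
  have r0 : 0 < ka / N by rewrite divr_gt0// (lt_le_trans ltr01).
  have r1 : ka / N <= 1 by rewrite ler_pdivrMr// mul1r.
  have -> : ka / N ^+ 2 = ka / N * N^-1 by rewrite expr2 invfM mulrA.
  have NV0 : 0 <= N^-1 by rewrite invr_ge0 ltW.
  have NVs : N^-1 `^ s = N `^ (- s) by rewrite -powR_inv1 ?(ltW N0)// -powRrM mulN1r.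
  rewrite (powRM _ (ltW r0) NV0) NVs ler_wpM2r ?powR_ge0//.
  rewrite -[X in X <= _]powRr1 ?(ltW r0)//; apply: ger_powR => //.
  by rewrite r0.
apply: (@le_trans _ _ (K2 * ((th / 36) `^ s * (clen w `^ s * (ka / N ^+ 2) `^ s)))); last first.
  by rewrite ler_wpM2l// ltW.
have -> : K2 * ((th / 36) `^ s * (clen w `^ s * (ka / N ^+ 2) `^ s)) =
    2 * 2 `^ s * (((36 / th) `^ s * (th / 36) `^ s) * (clen w `^ s * (ka / N ^+ 2) `^ s)).
  by rewrite /K2; ring.
rewrite -powRM ?divr_ge0 ?(ltW th0)//.
have -> : 36 / th * (th / 36) = 1 by field; rewrite gt_eqF.
rewrite powR1 mul1r.
have -> : 2 `^ s * N `^ (- s) * clen w `^ s * (2 * ka / N) =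
   2 * 2 `^ s * (clen w `^ s * (ka / N * N `^ (- s))) by ring.
by rewrite ler_wpM2l ?mulr_ge0 ?powR_ge0// ler_wpM2l.
Qed.

Lemma hausdorff_measure_cantor (tau : R -> R) :
  (forall y, 0 <= y <= 1 -> tau (cfrac c y) <= t) ->
  hausdorff_measure s (limsup_set r.+1 tau h) <> 0%E.
Proof.
move=> htau; have [C C0 HC] := node_mass_holder.
apply: (mass_distribution root_inv nlo_le_nhi kids_inv kids_sum s_gt0 C0 _ (limit_subset htau)).
move=> U d d0 Ud.
have C10 : 0 < C1 by apply: lt_le_trans C1_ge1.
have K0 : 0 < C * d `^ s / C1 by rewrite divr_gt0// mulr_gt0// powR_gt0.
have e0 : 0 < (C * d `^ s / C1) `^ s^-1 by rewrite powR_gt0.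
have [n /(_ n (leqnn n))/ltW Hn] := half_pow_small e0.
exists n; have := HC U d d0 Ud n root root_inv; rewrite [nmass _]/= mul1r => H.
apply: (le_trans H); rewrite ge_max lexx /=.
apply: (le_trans (decay_anti (leq_addl _ _))).
rewrite /decay mulrC -ler_pdivlMr//.
apply: (le_trans (ler_powR_base (ltW s_gt0) _ Hn)).
  by rewrite mulr_ge0// exprn_ge0// invr_ge0.
by rewrite -powRrM mulVf ?gt_eqF// powRr1// ltW.
Qed.

End CantorTree.

(** * Lower bound *)

Section LowerBound.
Context {R : realType}.

(** The point may be rational, with too short an expansion; it is moved into the open interval
    before each digit is read off. *)
Lemma cylinder_near (x d : R) n : 0 <= x <= 1 -> 0 < d -> exists c,
  [/\ posw c, size c = n & exists2 y, 0 <= y <= 1 & `|cfrac c y - x| < d].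
Proof.
elim: n x d => [|n IH] x d x01 d0.
  by exists [::]; split=> //; exists x => //; rewrite subrr normr0.
have [x' x'01 xx'] : exists2 x', 0 < x' < 1 & `|x' - x| < d / 2.
  pose e := Num.min (d / 4) 4^-1.
  have e0 : 0 < e by rewrite lt_min; apply/andP; split; [rewrite divr_gt0|rewrite invr_gt0].
  have e1 : e <= 4^-1 by rewrite ge_min lexx orbT.
  have e2 : e <= d / 4 by rewrite ge_min lexx.
  have /andP[x0 x1] := x01; have [xh|xh] := leP x 2^-1.
    by exists (x + e); [lra|rewrite addrAC subrr add0r gtr0_norm//; lra].
  by exists (x - e); [lra|rewrite addrAC subrr add0r normrN gtr0_norm//; lra].
have [k0 Ex] := pquot1_inv x'01; set k := pquot 1 x' in k0 Ex.
have /andP[z0 z1] := gauss_itv x'.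
have z01 : 0 <= gauss x' <= 1 by rewrite z0 ltW.
have d20 : 0 < d / 2 by rewrite divr_gt0.
have [c [pc sc [y y01 Hy]]] := IH _ _ z01 d20.
exists (k :: c); have pk : posw [:: k] by rewrite /posw /= k0.
split; [by rewrite /posw /= k0|by rewrite /= sc|exists y => //].
have E : cfrac [:: k] (gauss x') = x' by rewrite cfrac_cons /cfrac.
have /andP[_ H] := cylinder_dist pk (cfrac_itv pc y01) z01.
rewrite -cfrac_cat E cat1s in H.
have H' : `|cfrac (k :: c) y - x'| < d / 2.
  apply: le_lt_trans Hy; apply: (le_trans H).
  by rewrite ler_piMl// clen_le1.
by have := ler_distD x' (cfrac (k :: c) y) x; lra.
Qed.

(** The recursion for g reads s / g_(r+1) = 1 + ((1 - s) / s) (s / g_r), so s / g_r is a partial sum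
    of the geometric series. *)
Lemma g_fun_sum r (s : R) : 0 < s <= 1 ->
  g_fun r.+1 s / s * (\sum_(j < r.+1) ((1 - s) / s) ^+ j) = 1.
Proof.
move=> s01; have /andP[s0 s1] := s01; elim: r => [|r IH].
  by rewrite big_ord_recl big_ord0 expr0 addr0 mulr1 /= divff// gt_eqF.
have /andP[g0 _] := @g_fun_itv R r s s01.
set g := g_fun r.+1 s in IH g0.
rewrite g_funSS -/g big_ord_recl expr0.
under eq_bigr do rewrite /bump /= exprS.
rewrite -mulr_sumr.
have -> : \sum_(j < r.+1) ((1 - s) / s) ^+ j = s / g.
  move: IH; set X := \sum_(j < _) _ => IH.
  by rewrite -[RHS]mulr1 -IH; field; rewrite !gt_eqF.
field; apply/and3P; split; rewrite gt_eqF//; lra.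
Qed.

Context (h tau : R -> R) (r : nat).
Hypothesis h_gt0 : forall x, x \in `[0, 1] -> 0 < h x.
Hypothesis tau_ge0 : forall x, x \in `[0, 1] -> 0 <= tau x.
Hypothesis h_cont : {within `[0, 1], continuous h}.
Hypothesis tau_cont : {within `[0, 1], continuous tau}.

Lemma min01_ge0 : 0 <= min01 tau.
Proof. by have [[x x01 <-] _] := min01P tau_cont; exact: tau_ge0. Qed.

Lemma potentialE s x : 0 < x -> potential r.+1 tau h s x =
  - (g_fun r.+1 s * min01 tau) * h x + s * ln (x ^+ 2).
Proof.
move=> x0; rewrite /potential gauss_derivE// normrN gtr0_norm ?invr_gt0 ?exprn_gt0//.
by rewrite lnV ?posrE ?exprn_gt0//; ring.
Qed.

Lemma hausdorff_measure_lower (s eta : R) : 0 < s <= 1 -> 0 < eta ->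
  (forall N, exists n, (N <= n)%N /\ exists M,
     expR (eta * n%:R) <= wsum h (g_fun r.+1 s * min01 tau) s M n) ->
  hausdorff_measure s (limsup_set r.+1 tau h) <> 0%E.
Proof.
move=> s01 eta0 growth; have /andP[s0 s1] := s01.
have [Hm Hm0 hHm] := potential_bounded h_gt0 h_cont.
have /andP[g0 _] := @g_fun_itv R r s s01; set g := g_fun r.+1 s in g0 growth.
have m0 := min01_ge0; set m := min01 tau in m0 growth.
(* Of the growth [eta], one quarter pays for [t = m + e] in place of the minimum [m], which also
   makes [t] positive. Another pays for the distortion of the ergodic sums through [e']. The
   remaining half overcomes the constants. *)
pose e := eta / (4 * g * Hm); have e0 : 0 < e by rewrite divr_gt0 ?mulr_gt0.
pose t := m + e; have t0 : 0 < t by rewrite ltr_wpDl.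
pose e' := eta / (8 * g * t); have e'0 : 0 < e' by rewrite divr_gt0 ?mulr_gt0.
have [C C0 HC] := cfsum_distortion h_gt0 h_cont e'0.
pose Hb b := cfsum h b 0 + e' * (size b)%:R + C.
have itv00 : 0 <= (0 : R) <= 1 by rewrite lexx ler01.
have h01 : 0 <= (2^-1 : R) <= 1 by lra.
(* The cost of the appended digit 2: 1/16 is its [clen] 1/4 times the constant of [clen_cat]; the
   exponential holds the value of [h] there, the added length and two distortion constants. *)
pose K := 16^-1 `^ s * expR (- (g * t * (e' + 2 * C + Hm))).
have K0 : 0 < K by rewrite mulr_gt0 ?expR_gt0// powR_gt0.
have fbig w : posw w -> K * expR (- (eta / 2 * (size w)%:R)) * weight h (g * m) s w <=
    clen (rcons w 2) `^ s * expR (- (g * t * Hb (rcons w 2))).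
  move=> pw; set n := size w.
  have p2 : posw [:: 2%N] by [].
  have cw := @clen_gt0 R _ pw.
  have c16 : 0 <= 16^-1 * clen w :> R by rewrite mulr_ge0// ltW.
  have cl : (16^-1 * clen w) `^ s <= clen (rcons w 2) `^ s.
    apply: ler_powR_base => //; first exact: ltW.
    by have /andP[H _] := @clen_cat R _ _ pw p2; rewrite cats1 clen1 in H; lra.
  have Hw : cfsum h w 2^-1 <= hinf h w + e' * n%:R + C.
    rewrite -lerBlDr -lerBlDr; apply: le_hinf => y y01.
    by rewrite !lerBlDr; exact: HC.
  have Hb2 : Hb (rcons w 2) <= hinf h w + 2 * e' * n%:R + (e' + 2 * C + Hm).
    rewrite /Hb size_rcons -cats1 cfsum_cat /= addr0 cfrac_cons /cfrac /= addr0 -natr1 -/n.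
    by have := hHm _ h01; lra.
  have inf0 := hinf_ge0 h_gt0 pw.
  have infn : hinf h w <= Hm * n%:R.
    exact: le_trans (hinf_le h_gt0 pw itv00) (cfsum_le hHm pw itv00).
  rewrite /weight [leLHS](_ : _ = (16^-1 `^ s * clen w `^ s) *
    expR (- (g * t * (e' + 2 * C + Hm)) + - (eta / 2 * n%:R) + - (g * m) * hinf h w)); last first.
    by rewrite /K !expRD; ring.
  rewrite -powRM ?invr_ge0 ?(ltW cw)//.
  apply: ler_pM; rewrite ?powR_ge0 ?expR_ge0// ler_expR.
  have gt0 : 0 <= g * t by rewrite mulr_ge0// ltW.
  have G1 := ler_wpM2l gt0 Hb2.
  have E1 : g * t * (2 * e' * n%:R) = eta / 4 * n%:R.
    by rewrite /e'; field; rewrite !gt_eqF.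
  have E2 : g * e * hinf h w <= eta / 4 * n%:R.
    have ge0 : 0 <= g * e by rewrite mulr_ge0// ltW.
    apply: (le_trans (ler_wpM2l ge0 infn)).
    by rewrite le_eqVlt; apply/orP; left; apply/eqP; rewrite /e; field; rewrite !gt_eqF.
  have E3 : g * t * hinf h w = g * m * hinf h w + g * e * hinf h w by rewrite /t; ring.
  lra.
pose n0 := Num.truncn ((8 / K) / (eta / 2)).
have [n [nN [M HM]]] := growth n0.+1.
have n8 : 8 <= K * expR (eta / 2 * n%:R).
  rewrite -ler_pdivrMl// mulrC; apply: le_trans (expR_ge1Dx _).
  apply: (@le_trans _ _ (eta / 2 * n%:R)); last by rewrite lerDr.
  rewrite [leRHS]mulrC -ler_pdivrMr ?divr_gt0// ltW//.
  by apply: lt_le_trans (truncnS_gt _) _; rewrite ler_nat.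
(* The alphabet has to contain the appended digit 2. *)
pose M2 := maxn M 2; pose blk := [seq rcons w 2%N | w <- words M n].
have F8 : 8 <= \sum_(b <- blk) clen b `^ s * expR (- (g * t * Hb b)).
  rewrite big_map; apply: (le_trans n8).
  apply: (@le_trans _ _ (\sum_(w <- words M n) K * expR (- (eta / 2 * n%:R)) * weight h (g * m) s w)).
    rewrite -mulr_sumr -[leRHS]mulrA ler_wpM2l ?(ltW K0)// expRN.
    rewrite -ler_pdivrMl ?invr_gt0 ?expR_gt0// invrK -expRD.
    by rewrite (_ : eta / 2 * n%:R + eta / 2 * n%:R = eta * n%:R)//; field.
  rewrite big_seq [leRHS]big_seq; apply: ler_sum => w wn.
  by have := fbig w (words_posw wn); rewrite (words_size wn).
have [[x0 x001 tx0] _] := min01P tau_cont.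
have [d d0 hd] := segment_uniformly_continuous tau_cont e0.
have d20 : 0 < d / 2 by rewrite divr_gt0.
have [k0 /(_ k0 (leqnn k0))/ltW hk0] := half_pow_small d20.
have d40 : 0 < d / 4 by rewrite divr_gt0.
have x001' : 0 <= x0 <= 1 by rewrite in_itv in x001.
have [c [pc sc [y0 y001 Hy0]]] := @cylinder_near x0 (d / 4) k0 x001' d40.
have tau_c y : 0 <= y <= 1 -> tau (cfrac c y) <= t.
  move=> y01; have /andP[_ D] := cylinder_dist pc y01 y001.
  have cl := @clen_rate R _ pc; rewrite sc in cl.
  have cl0 := @clen_gt0 R _ pc.
  have yy : `|y - y0| <= 1 by rewrite ler_norml; lra.
  have D2 : `|cfrac c y - cfrac c y0| <= d / 2.
    apply: (le_trans D); apply: (le_trans _ (le_trans cl hk0)).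
    by rewrite ler_piMr// ltW.
  have D3 : `|cfrac c y - x0| < d.
    by have := ler_distD (cfrac c y0) (cfrac c y) x0; lra.
  have cy := cfrac_itv pc y01.
  have := hd _ _ (_ : cfrac c y \in `[0, 1]) x001 D3; rewrite in_itv => /(_ cy) H.
  by have := ler_norm (tau (cfrac c y) - tau x0); rewrite /t /m -tx0; lra.
have /choice[kk Hkk] : forall k, exists j, ((clen c `^ s)^-1 * 64 ^+ r.+1) *
    expR (g * t * (Hm * k%:R)) <= 2 ^+ j.
  move=> k; set X := _ * expR _; exists (Num.truncn X).+1.
  apply: (le_trans (ltW (truncnS_gt X))).
  by rewrite -natrX ler_nat ltnW// ltn_expl.
have h_itv x : 0 <= x <= 1 -> 0 <= h x <= Hm.
  by move=> x01; rewrite hHm// ltW// h_gt0// in_itv.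
have q_s : (1 - s) / s * s = 1 - s by rewrite mulfVK// gt_eqF.
have be_s : g / s * s = g by rewrite mulfVK// gt_eqF.
have ublk : uniq blk.
  by rewrite map_inj_uniq ?words_uniq// => w w' /rcons_inj[].
have blkP b : b \in blk -> [/\ tame M2 b, size b = n.+1 &
    forall y, 0 <= y <= 1 -> cfsum h b y <= Hb b].
  move=> /mapP[w wn ->]; have pw : posw (rcons w 2) by rewrite posw_rcons (words_posw wn).
  split; [|by rewrite size_rcons (words_size wn)|by move=> y y01; exact: HC].
  rewrite /tame last_rcons andbT all_rcons /= leq_maxr /=.
  move: wn; rewrite mem_words => /andP[_ /allP aw]; apply/allP => j /aw /andP[-> /=].
  by move/leq_trans; apply; exact: leq_maxl.
exact: (hausdorff_measure_cantor h_itv s0 s1 t0 g0 q_s be_s (g_fun_sum r s01) pc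
          ublk blkP F8 Hkk tau_c).
Qed.

End LowerBound.

(** * Hausdorff dimension and the critical exponent *)

Theorem theorem1p1 (R : realType) (h tau : R -> R) (r : nat)
  (h_gt0 : forall x, x \in `[0, 1] -> 0 < h x)
  (tau_ge0 : forall x, x \in `[0, 1] -> 0 <= tau x)
  (h_cont : {within `[0, 1], continuous h})
  (tau_cont : {within `[0, 1], continuous tau})
  (h_tempered : tempered_distortion h)
  (r_gt0 : (0 < r)%N) :
  hausdorff_dim (limsup_set r tau h) = dim_number r tau h.
Proof.
case: r r_gt0 => // r _; clear h_tempered.
have m0 := min01_ge0 tau_ge0 tau_cont.
have [_ tau_min] := min01P tau_cont.
have dich s : 0 <= s <= 1 -> _ := fun s01 => pressure_dichotomy h_gt0 h_cont
  (mulr_ge0 (g_fun_ge0 r.+1 s01) m0) (proj1 (andP s01)) (@potentialE R h tau r s).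
apply/eqP; rewrite eq_le; apply/andP; split.
  apply: le_ereal_inf_tmp => _ [s1 [s10 Ps1] <-].
  apply: hausdorff_dim_le => // s s1s.
  have [s1_ge1|s1_lt1] := leP 1 s1.
    apply: (@hausdorff_measure_eq0_sub _ _ [set x | 0 <= x < 1]) => [x []//|].
    by apply: hausdorff_measure_itv01; apply: le_lt_trans s1s.
  (* The cover requires an exponent below 1; monotonicity then reaches [s]. *)
  pose s' := Num.min s ((1 + s1) / 2).
  have s's : s' <= s by rewrite ge_min lexx.
  have s1s' : s1 < s' by rewrite lt_min s1s; lra.
  have s'1 : s' < 1 by rewrite gt_min; apply/orP; right; lra.
  apply: (@hausdorff_measure_mono _ s') => //; first by rewrite (le_trans s10)// ltW.
  apply: (@hausdorff_measure_limsup_set _ h tau (min01 tau) h_gt0 m0 tau_min r s1) => //.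
  move=> e e0; have s101 : 0 <= s1 <= 1 by rewrite s10 ltW.
  case: (dich s1 s101) => [[Pinf _]|[L [PL HL]]]; first by rewrite Pinf in Ps1.
  rewrite PL lee_fin in Ps1; have [N HN] := HL e e0; exists N => n Nn M.
  have [H _] := HN n Nn; apply: (le_trans (H M)); rewrite ler_expR.
  by rewrite ler_wpM2r// gerDr.
apply: le_ereal_inf_tmp => _ [s [s0 Hs] <-]; rewrite leNgt; apply/negP => sd.
(* At exponent 1 the weights are at most the lengths of the cylinders, whose sums are bounded, so
   the pressure is at most 0. The critical exponent is therefore finite, and the exponents used
   below lie in (0, 1]. *)
have d1 : (dim_number r.+1 tau h <= 1%:E)%E.
  apply: ereal_inf_lbound; exists 1 => //; split => //.
  have s101 : 0 <= (1 : R) <= 1 by rewrite ler01 lexx.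
  have Z2 M n : wsum h (g_fun r.+1 1 * min01 tau) 1 M n <= 2.
    apply: le_trans (@sum_clen_le R M n).
    rewrite /wsum big_seq [leRHS]big_seq; apply: ler_sum => w /words_posw pw.
    rewrite /weight powRr1 ?(ltW (clen_gt0 pw))// ler_piMl ?(ltW (clen_gt0 pw))//.
    have g1 := g_fun_ge0 r.+1 s101.
    by rewrite -[leRHS]expR0 ler_expR mulNr oppr_le0 !mulr_ge0// (hinf_ge0 h_gt0 pw).
  case: (dich 1 s101) => [[_ unb]|[L [PL HL]]].
    by have [M] := unb 0%N 2; rewrite ltNge Z2.
  rewrite PL lee_fin leNgt; apply/negP => L0.
  have L20 : 0 < L / 2 by rewrite divr_gt0.
  have [N HN] := HL _ L20.
  pose n := maxn N (Num.truncn (1 / (L / 2))).+1.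
  have [_ [M HM]] := HN n (leq_maxl _ _).
  have := le_trans HM (Z2 M n); apply/negP; rewrite -ltNge.
  apply: lt_le_trans (expR_ge1Dx _).
  have : 1 < L / 2 * n%:R.
    rewrite mulrC -ltr_pdivrMr//; apply: (lt_le_trans (truncnS_gt _)).
    by rewrite ler_nat leq_maxr.
  rewrite (_ : L - L / 2 = L / 2); first lra.
  by field.
have [d dE] : exists d, dim_number r.+1 tau h = d%:E.
  case: (dim_number r.+1 tau h) sd d1 => [d| |]// _ _; first by exists d.
rewrite dE !lte_fin lee_fin in sd d1.
(* Strictly between the two numbers the Hausdorff measure vanishes while the pressure is positive,
   which the Cantor set excludes. *)
pose s' := (s + d) / 2.
have s'01 : 0 < s' <= 1 by rewrite /s'; lra.
have s'd : s' < d by rewrite /s'; lra.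
have /andP[s'0 s'1] := s'01.
have Hs' : hausdorff_measure s' (limsup_set r.+1 tau h) = 0%E.
  by apply: hausdorff_measure_mono Hs => //; rewrite /s'; lra.
have nP : ~ (pressure (potential r.+1 tau h s') <= 0)%E.
  move=> Ps'; have : (dim_number r.+1 tau h <= s'%:E)%E.
    by apply: ereal_inf_lbound; exists s' => //; split=> //; exact: ltW.
  by rewrite dE lee_fin leNgt s'd.
have s'01' : 0 <= s' <= 1 by rewrite ltW.
case: (dich s' s'01') => [[_ unb]|[L [PL HL]]].
  apply: (hausdorff_measure_lower h_gt0 tau_ge0 h_cont tau_cont s'01 ltr01 _ Hs').
  move=> N; exists N.+1; split=> //; have [M HM] := unb N (expR (1 * N.+1%:R)).
  by exists M; exact: ltW.
have L0 : 0 < L by rewrite ltNge; apply/negP => L0; apply: nP; rewrite PL lee_fin.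
have L20 : 0 < L / 2 by rewrite divr_gt0.
apply: (hausdorff_measure_lower h_gt0 tau_ge0 h_cont tau_cont s'01 L20 _ Hs').
have [N0 HN0] := HL _ L20 => N; exists (maxn N N0); split; first exact: leq_maxl.
have [_ [M HM]] := HN0 _ (leq_maxr N N0); exists M.
by apply: le_trans HM; rewrite ler_expR ler_wpM2r//; lra.
Qed.
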